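(* Let $H_0=H_0^*$ and $V=V^*$ be elements of $\mathcal{A}$, and suppose that $V$ is factored in the form $V=-K^*N^{-1}K$, where $K\in\mathcal{A}$ and $N=N^*\in\mathcal{A}$ has a bounded inverse. Put $H=H_0+V=H_0-K^*N^{-1}K$. Assume that the limit in the operator norm $$K(H_0+\mathrm{i}0I)^{-1}K^*:=\lim_{\varepsilon\downarrow 0}K(H_0+\mathrm{i}\varepsilon I)^{-1}K^*$$ exists and that both operators $$\mathcal{N}=N-K(H_0+\mathrm{i}0I)^{-1}K^*\quad\text{and}\quad \mathrm{Re}\,\mathcal{N}=\tfrac12(\mathcal{N}+\mathcal{N}^* )$$ have bounded inverses. Let $$\mathbf{S}=I-2\mathrm{i}\,(\mathrm{Im}\,\mathcal{N})^{1/2}\,\mathcal{N}^{-1}\,(\mathrm{Im}\,\mathcal{N})^{1/2}$$ be the characteristic function of the dissipative operator $\mathcal{N}$ at the zero value of the spectral parameter. Let $\det_\tau\mathbf{S}$ be the de la Harpe-Skandalis determinant associated with the homotopy class of the $C^1$-paths of invertible operators joining $\mathbf{S}$ and $I$ and containing the path $[0,1]\ni t\mapsto t\mathbf{S}+(1-t)I$. Then $$\det{}_\tau\mathbf{S}=\Theta\,\exp\big(-2\pi\mathrm{i}\,\xi(H,H_0)\big),\qquad\text{where}\quad \Theta=\exp\big(-2\pi\mathrm{i}\,\xi(N,\mathrm{Re}\,\mathcal{N})\big).$$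
   Context: $\mathcal{A}$ is a von Neumann algebra of finite type acting on a Hilbert space $\mathcal{H}$, and $\tau$ is a normal tracial state on $\mathcal{A}$. An operator $M\in\mathcal{A}$ is dissipative if $\mathrm{Im}\,M=\frac{1}{2\mathrm{i}}(M-M^* )\ge 0$. For a self-adjoint $A\in\mathcal{A}$ with spectral measure $E_A$, put $\Xi(A)=E_A((-\infty,0))+\frac12E_A(\{0\})$. For a pair $(A,B)$ of self-adjoint operators in $\mathcal{A}$ the $\xi$-index is $\xi(A,B)=\tau[\Xi(B)]-\tau[\Xi(A)]$. (These are the restrictions to self-adjoint operators of the $\Xi$-operator and $\xi$-index defined for dissipative operators; only self-adjoint arguments occur in the statement.) For a $C^1$-path $[0,1]\ni t\mapsto G_t$ of boundedly invertible elements of $\mathcal{A}$, the de la Harpe-Skandalis determinant is $$\Delta(t\mapsto G_t)=\exp\left(\int_0^1\tau\left[\dot G_tG_t^{-1}\right]dt\right);$$ it is invariant under fixed-endpoint homotopies. The determinant $\det_\tau\mathbf{S}$ associated with a homotopy class is the value of $\Delta$ on any $C^1$-path $t\mapsto G_t$ in the class, with $G_0=I$ and $G_1=\mathbf{S}$. *)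

(* Defs.v *)
From HB Require Import structures.
From mathcomp Require Import all_boot all_order all_algebra.
From mathcomp Require Import complex.
From mathcomp Require Import all_classical all_reals all_analysis.

Set Implicit Arguments.
Unset Strict Implicit.
Unset Printing Implicit Defensive.
Import Order.TTheory GRing.Theory Num.Theory.
Import numFieldNormedType.Exports.
Local Open Scope classical_set_scope.
Local Open Scope complex_scope.
Local Open Scope ring_scope.

(* [inner] is linear in its first argument and conjugate-linear in the
   second one. *)
HB.mixin Record CompleteNormedModule_isHilbert (R : realType) (H : Type)
    of CompleteNormedModule R[i] H := {
  inner : {dot H for (@Num.conj R[i])} ;
  inner_norm : forall x : H, inner x x = `|x| ^+ 2
}.

#[short(type="hilbertType")]
HB.structure Definition Hilbert (R : realType) :=
  {H of CompleteNormedModule R[i] H & CompleteNormedModule_isHilbert R H}.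

(* Operators are plain functions H -> H: sums and scalings are pointwise, the
   product is \o and the unit is idfun.  The operations specified by a property
   (adjoint, inverse, square root, spectral measure, derivative) are total, by
   choice, with default value 0. *)
Section Operators.
Context {R : realType} {H : hilbertType R}.
Implicit Types (A B : H -> H) (E : set R -> H -> H).

Definition bounded_operator A : Prop := linear A /\ continuous A.

Definition opnorm A : R :=
  sup [set complex.Re `|A x| | x in [set x : H | `|x| <= 1]].

Definition adjoint A : H -> H :=
  xget 0 [set B | bounded_operator B /\
                  forall x y, inner (A x) y = inner x (B y)].

Definition is_inverse A B : Prop :=
  [/\ bounded_operator B, A \o B = idfun & B \o A = idfun].

Definition has_bounded_inverse A : Prop := exists B, is_inverse A B.

Definition op_inv A : H -> H := xget 0 (is_inverse A).

Definition op_re A : H -> H := (2^-1 : R[i]) *: (A + adjoint A).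

Definition op_im A : H -> H := (2 * 'i : R[i])^-1 *: (A - adjoint A).

(* In the partial order of R[i], 0 <= z forces z to be real. *)
Definition op_ge0 A : Prop := forall x, 0 <= inner (A x) x.

Definition op_sqrt A : H -> H :=
  xget 0 [set B | [/\ bounded_operator B, op_ge0 B & B \o B = A]].

Definition orthogonal_projection A : Prop :=
  [/\ bounded_operator A, adjoint A = A & A \o A = A].

(* The scalar measures mu_x(X) = <E(X) x, x> encode the countable additivity
   of E, and the last clause is the weak form of A = \int t dE(t). *)
Definition is_spectral_measure A E : Prop :=
  [/\ forall X : set R, measurable X -> orthogonal_projection (E X),
      E setT = idfun,
      forall X Y : set R, measurable X -> measurable Y -> E (X `&` Y) = E X \o E Y
    & forall x : H, exists mu : {measure set (measurableTypeR R) -> \bar R},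
        [/\ forall X, measurable X -> mu X = (complex.Re (inner (E X x) x))%:E,
            mu.-integrable setT (fun t : R => t%:E)
          & inner (A x) x = (\int[mu]_t t)%:C]].

Definition spectral_measure A : set R -> H -> H :=
  xget 0 (is_spectral_measure A).

Definition Xi A : H -> H :=
  spectral_measure A `]-oo, 0%R[ +
  (2^-1 : R[i]) *: spectral_measure A [set 0].

Definition commutant (M : set (H -> H)) : set (H -> H) :=
  [set B | bounded_operator B /\ forall A, M A -> A \o B = B \o A].

Definition von_neumann_algebra (M : set (H -> H)) : Prop :=
  (forall A, M A -> M (adjoint A)) /\ commutant (commutant M) = M.

(* The unit is a finite projection: every isometry of M is unitary. *)
Definition finite_type (M : set (H -> H)) : Prop :=
  forall U, M U -> adjoint U \o U = idfun -> U \o adjoint U = idfun.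

Definition op_supremum (M D : set (H -> H)) (S : H -> H) : Prop :=
  [/\ M S, adjoint S = S, forall A, D A -> op_ge0 (S - A)
    & forall T, M T -> adjoint T = T ->
        (forall A, D A -> op_ge0 (T - A)) -> op_ge0 (T - S)].

Definition op_directed (D : set (H -> H)) : Prop :=
  D !=set0 /\
  forall A B, D A -> D B -> exists C, [/\ D C, op_ge0 (C - A) & op_ge0 (C - B)].

Definition normal_tracial_state (M : set (H -> H)) (tau : (H -> H) -> R[i]) :
    Prop :=
  [/\ forall (a : R[i]) A B, M A -> M B -> tau (a *: A + B) = a * tau A + tau B,
      forall A, M A -> op_ge0 A -> 0 <= tau A,
      tau idfun = 1,
      forall A B, M A -> M B -> tau (A \o B) = tau (B \o A)
    & forall (D : set (H -> H)) (S : H -> H),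
        D `<=` [set A | M A /\ adjoint A = A] ->
        op_directed D -> op_supremum M D S -> supremums (tau @` D) (tau S)].

Definition xi_index (tau : (H -> H) -> R[i]) A B : R[i] :=
  tau (Xi B) - tau (Xi A).

(* A_e converges in the operator norm to L as e decreases to 0. *)
Definition norm_lim_0p (F : R -> H -> H) (L : H -> H) : Prop :=
  bounded_operator L /\ opnorm (F e - L) @[e --> 0^'+] --> (0 : R).

(* One-sided at the end points of [0, 1]. *)
Definition is_path_derivative (G : R -> H -> H) (t : R) (D : H -> H) : Prop :=
  bounded_operator D /\
  opnorm (((s - t)^-1)%:C *: (G s - G t) - D)
    @[s --> within `[0%R, 1%R] t^'] --> (0 : R).

Definition path_derive (G : R -> H -> H) (t : R) : H -> H :=
  xget 0 (is_path_derivative G t).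

Definition invertibles (M : set (H -> H)) : set (H -> H) :=
  [set A | M A /\ has_bounded_inverse A].

Definition C1_path (M : set (H -> H)) (G : R -> H -> H) : Prop :=
  forall t : R, t \in `[0, 1] ->
  [/\ invertibles M (G t),
      exists D, is_path_derivative G t D
    & opnorm (path_derive G s - path_derive G t)
        @[s --> within `[0%R, 1%R] (nbhs t)] --> (0 : R)].

(* Fixed-endpoint homotopy in the invertible elements of M for the operator
   norm. *)
Definition homotopic (M : set (H -> H)) (G G' : R -> H -> H) : Prop :=
  exists F : R * R -> H -> H,
  [/\ forall p : R * R, (`[0%R, 1%R] `*` `[0%R, 1%R]) p ->
        invertibles M (F p) /\
        opnorm (F q - F p)
          @[q --> within (`[0%R, 1%R] `*` `[0%R, 1%R]) (nbhs p)] --> (0 : R),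
      forall t : R, t \in `[0, 1] -> F (0, t) = G t /\ F (1, t) = G' t
    & forall s : R, s \in `[0, 1] -> F (s, 0) = G 0 /\ F (s, 1) = G 1].

Definition expC (z : R[i]) : R[i] :=
  (expR (complex.Re z))%:C * (cos (complex.Im z) +i* sin (complex.Im z)).

Definition Cintegral01 (f : R -> R[i]) : R[i] :=
  (\int[@lebesgue_measure R]_(t in `[0%R, 1%R]) complex.Re (f t)) +i*
  (\int[@lebesgue_measure R]_(t in `[0%R, 1%R]) complex.Im (f t)).

Definition dlHS_det (tau : (H -> H) -> R[i]) (G : R -> H -> H) : R[i] :=
  expC (Cintegral01 (fun t => tau (path_derive G t \o op_inv (G t)))).

(* [d] is the determinant attached to the homotopy class of the C^1-path [P]
   of invertible elements of [M]: the common value of the path determinant on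
   all the C^1-paths of the class. *)
Definition is_class_det (M : set (H -> H)) (tau : (H -> H) -> R[i])
    (P : R -> H -> H) (d : R[i]) : Prop :=
  C1_path M P /\
  forall G, C1_path M G -> G 0 = P 0 -> G 1 = P 1 -> homotopic M P G ->
    dlHS_det tau G = d.

Definition segment_path (S : H -> H) (t : R) : H -> H :=
  t%:C *: S + (1 - t)%:C *: idfun.

(* The characteristic function of a dissipative operator at the point 0. *)
Definition characteristic0 A : H -> H :=
  idfun - (2 * 'i : R[i]) *:
    (op_sqrt (op_im A) \o op_inv A \o op_sqrt (op_im A)).

End Operators.

(* Main.v *)
Require Import Defs.
From HB Require Import structures.
From mathcomp Require Import all_boot all_order all_algebra.
From mathcomp Require Import complex ring lra.
From mathcomp Require Import all_classical all_reals all_analysis.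
From mathcomp Require Import measurable_realfun.
Import Order.TTheory GRing.Theory Num.Theory.
Import numFieldNormedType.Exports.
Local Open Scope classical_set_scope.
Local Open Scope complex_scope.
Local Open Scope ring_scope.
Set Implicit Arguments.
Unset Strict Implicit.
Unset Printing Implicit Defensive.

(** Write [nn = N - L] for the boundary value of
    [N - K (H0 + i e)^-1 K^*], and [a = Re nn] and [b = Im nn], so
    that [b = - Im L >= 0].  The proof rests on one fact: in a finite tracial
    algebra [tau b = 0] (lemma [im_limit_trace0]).  Put
    [B_e = K e (H0^2 + e^2)^-1 K^*], which converges in norm to [b].  The
    difference [B_e - B_(2e) / 2] tends to [b / 2]; it equals
    [3 e^3 K ((H0^2 + 4 e^2) (H0^2 + e^2))^-1 K^*], and cyclicity bounds the
    trace of this operator by [|B_e|] times the oscillation of the monotone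
    function [e |-> tau (e^2 (H0^2 + e^2)^-1)], up to an error that can be made
    small.  Hence [tau b / 2 <= 0].

    Positivity then gives [tau (b x) = 0] for every [x] of the algebra
    ([trace0_mul]), and both sides of the formula are equal to [1].

    For the left-hand side, the logarithmic derivative of the segment path
    [1 - 2 i t j nn^-1 j], where [j^2 = b], has the trace of
    [- 2 i b (nn - 2 i t b)^-1] by the Woodbury formula, that is [0]; here
    [nn - 2 i t b = a + i (1 - 2 t) b] is invertible since [a] is
    ([sa_im_unit]).  Any other path of the class has the same determinant by
    homotopy invariance ([homotopy_invariance]).

    For the right-hand side one shows
    [xi (H0, H) = xi (N, Re nn)] ([index_identity]).  The tool is
    [logint x y], the integral of [sg (dG G^-1)] along the segment from [x] to
    [y], for a real tracial functional [sg] such as the real or imaginary part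
    of [tau].  It is additive on triangles of invertible elements
    ([triangle]), from which homotopy invariance follows too.  The
    push-through identity gives
    [logint (H0 + i e) (H + i e) = logint N (N - K (H0 + i e)^-1 K^* )]
    exactly ([logint_push]).  For self-adjoint [x] and [y] the imaginary part
    of [logint (x + i e) (y + i e)] tends to
    [pi (tau (Xi y) - tau (Xi x))] ([logint_limit]): both ends are joined to a
    multiple of their sign, along which the integral disappears in the limit
    by normality, and the sign is compared with [i e] explicitly.  Since
    [logint a nn = 0] because [tau b = 0], the two limits agree.

    Inverses, adjoints, square roots and spectral measures are given by
    choice, so that their existence is part of the work.  For self-adjoint [t]
    the sign is a strong limit of polynomials ([sgn_exists]); the projections
    that it defines for the shifts [t - l] give a spectral measure, and every
    spectral measure has the same values on the negative half-line and at [0]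
    ([XiE]). *)

(** * Identities in non-commutative rings *)

(** A decision procedure by reflection: an expression is normalized to a sum of
    words in its atoms with integer coefficients. *)
Inductive ncexpr :=
  | NCvar of nat | NC0 | NC1
  | NCadd of ncexpr & ncexpr | NCopp of ncexpr | NCmul of ncexpr & ncexpr.

Section NCRing.
Variable V : pzRingType.
Implicit Types (env : seq V) (w : seq nat) (p : seq (int * seq nat)).

Fixpoint nceval env (t : ncexpr) : V :=
  match t with
  | NCvar n => nth 0 env n
  | NC0 => 0
  | NC1 => 1
  | NCadd u v => nceval env u + nceval env v
  | NCopp u => - nceval env u
  | NCmul u v => nceval env u * nceval env v
  end.

Definition ncword env w : V := foldr (fun n x => nth 0 env n * x) 1 w.

Definition ncpoly env p : V := foldr (fun m x => ncword env m.2 *~ m.1 + x) 0 p.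

Fixpoint ncinsert (c : int) w p :=
  if p is m :: p' then
    if m.2 == w then (c + m.1, w) :: p' else m :: ncinsert c w p'
  else [:: (c, w)].

Definition ncadd p p' := foldr (fun m q => ncinsert m.1 m.2 q) p' p.
Definition ncopp p := [seq (- m.1, m.2) | m <- p].
Definition ncmul p p' :=
  foldr (fun m q => foldr (fun m' q' => ncinsert (m.1 * m'.1) (m.2 ++ m'.2) q') q p') [::] p.

Fixpoint ncnorm (t : ncexpr) : seq (int * seq nat) :=
  match t with
  | NCvar n => [:: (1, [:: n])]
  | NC0 => [::]
  | NC1 => [:: (1, [::])]
  | NCadd u v => ncadd (ncnorm u) (ncnorm v)
  | NCopp u => ncopp (ncnorm u)
  | NCmul u v => ncmul (ncnorm u) (ncnorm v)
  end.

Lemma ncinsertE env c w p :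
  ncpoly env (ncinsert c w p) = ncword env w *~ c + ncpoly env p.
Proof.
elim: p => [//|[d v] p IH] /=; case: eqP => [->|_] /=; first by rewrite mulrzDr addrA.
by rewrite IH addrCA.
Qed.

Lemma ncaddE env p p' : ncpoly env (ncadd p p') = ncpoly env p + ncpoly env p'.
Proof. by elim: p => [|m p IH] /=; rewrite ?add0r // ncinsertE IH addrA. Qed.

Lemma ncoppE env p : ncpoly env (ncopp p) = - ncpoly env p.
Proof. by elim: p => [|m p IH] /=; rewrite ?oppr0 // IH mulrNz opprD. Qed.

Lemma ncword_cat env w w' : ncword env (w ++ w') = ncword env w * ncword env w'.
Proof. by elim: w => [|n w IH] /=; rewrite ?mul1r // IH mulrA. Qed.

Lemma ncmulE env p p' : ncpoly env (ncmul p p') = ncpoly env p * ncpoly env p'.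
Proof.
elim: p => [|m p IH] /=; rewrite ?mul0r // mulrDl -IH.
move: (ncmul p p') {IH} => q; elim: p' => [|m' p' IH'] /=; first by rewrite mulr0 add0r.
rewrite ncinsertE IH' ncword_cat mulrDr addrA; congr (_ + _ + _).
by rewrite mulrzAl mulrzAr mulrC mulrzA.
Qed.

Lemma ncnormE env t : ncpoly env (ncnorm t) = nceval env t.
Proof.
elim: t => //= [n|||t <-|t1 <- t2 <-]; rewrite /= ?addr0 ?mulr1 //.
- by move=> t1 <- t2 <-; rewrite ncaddE.
- by rewrite ncoppE.
- by rewrite ncmulE.
Qed.

Lemma nc_correct env t t' :
  all (fun m => m.1 == 0) (ncnorm (NCadd t (NCopp t'))) -> nceval env t = nceval env t'.
Proof.
move=> h; apply/eqP; rewrite -subr_eq0; apply/eqP.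
rewrite -[LHS]/(nceval env (NCadd t (NCopp t'))) -ncnormE.
elim: (ncnorm _) h => [//|m p IH] /= /andP[/eqP -> /IH ->].
by rewrite mulr0z addr0.
Qed.

End NCRing.

Ltac nc_find x env :=
  lazymatch env with
  | ?y :: ?env' =>
    match goal with
    | _ => let _ := match goal with _ => unify x y end in constr:(O)
    | _ => let n := nc_find x env' in constr:(S n)
    end
  end.

Ltac nc_atoms t env :=
  lazymatch t with
  | (?x + ?y)%R => let env := nc_atoms x env in nc_atoms y env
  | (?x * ?y)%R => let env := nc_atoms x env in nc_atoms y env
  | (- ?x)%R => nc_atoms x env
  | 0%R => env
  | 1%R => env
  | _ => match goal with
         | _ => let n := nc_find t env in env
         | _ => constr:(t :: env)
         end
  end.

Ltac nc_reify t env :=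
  lazymatch t with
  | (?x + ?y)%R => let u := nc_reify x env in let v := nc_reify y env in constr:(NCadd u v)
  | (?x * ?y)%R => let u := nc_reify x env in let v := nc_reify y env in constr:(NCmul u v)
  | (- ?x)%R => let u := nc_reify x env in constr:(NCopp u)
  | 0%R => constr:(NC0)
  | 1%R => constr:(NC1)
  | _ => let n := nc_find t env in constr:(NCvar n)
  end.

(** Proves an equality of non-commutative polynomials in a [pzRingType]. *)
Ltac ncring_in V :=
  lazymatch goal with
  | |- @eq _ ?l ?r =>
    let env := nc_atoms l (@nil V) in let env := nc_atoms r env in
    let u := nc_reify l env in let v := nc_reify r env in
    change (@nceval V env u = @nceval V env v);
    apply: nc_correct; vm_compute; reflexivity
  end.

Section RealHilbert.
Context {R : realType} {HH : hilbertType R}.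
Implicit Types x y z : HH.

Definition nr x : R := complex.Re `|x|.
Definition rip x y : R := complex.Re (inner x y).

Lemma normE x : `|x| = (nr x)%:C.
Proof. by rewrite RRe_real // ger0_real. Qed.

Lemma nr_ge0 x : 0 <= nr x.
Proof. by rewrite -ler0c -normE. Qed.

Lemma ReM_real (r : R) (z : R[i]) : complex.Re (r%:C * z) = r * complex.Re z.
Proof. by case: z => a b /=; rewrite mul0r subr0. Qed.

Lemma conjCE (z : R[i]) : Num.conj z = (z^*)%C.
Proof.
rewrite -[LHS](mulrK (x := 1)) ?unitr1 //; case: (eqVneq z 0) => [->|z0].
  by rewrite !rmorph0 !mul0r.
have := sqr_normc z; rewrite normCK => /(mulfI z0) ->.
by rewrite invr1 !mulr1.
Qed.

Lemma innerC x y : inner x y = ((inner y x)^*)%C.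
Proof. by rewrite hermC expr0 mul1r; exact: conjCE. Qed.

Lemma ripC x y : rip x y = rip y x.
Proof. by rewrite /rip innerC; case: (inner y x). Qed.

Lemma ripDl x y z : rip (x + y) z = rip x z + rip y z.
Proof. by rewrite /rip linearDl raddfD. Qed.

Lemma ripDr x y z : rip x (y + z) = rip x y + rip x z.
Proof. by rewrite !(ripC x) ripDl. Qed.

Lemma ripNl x y : rip (- x) y = - rip x y.
Proof. by rewrite /rip linearNl raddfN. Qed.

Lemma ripNr x y : rip x (- y) = - rip x y.
Proof. by rewrite !(ripC x) ripNl. Qed.

Lemma ripBl x y z : rip (x - y) z = rip x z - rip y z.
Proof. by rewrite ripDl ripNl. Qed.

Lemma ripBr x y z : rip x (y - z) = rip x y - rip x z.
Proof. by rewrite ripDr ripNr. Qed.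

Lemma innerZl (c : R[i]) x y : inner (c *: x) y = c * inner x y.
Proof. exact: linearZl_LR. Qed.

Lemma innerZr (c : R[i]) x y : inner x (c *: y) = (c^*)%C * inner x y.
Proof. by rewrite innerC innerZl rmorphM /= -innerC. Qed.

Lemma ripZl (r : R) x y : rip (r%:C *: x) y = r * rip x y.
Proof. by rewrite /rip innerZl ReM_real. Qed.

Lemma ripZr (r : R) x y : rip x (r%:C *: y) = r * rip x y.
Proof. by rewrite !(ripC x) ripZl. Qed.

Lemma rip_i x y : rip ('i *: x) y = - rip x ('i *: y).
Proof.
by rewrite /rip innerZl innerZr; case: (inner x y) => a b /=; rewrite !mul0r; ring.
Qed.

Lemma innerE x y : inner x y = rip x y +i* rip x ('i *: y).
Proof.
by rewrite /rip innerZr; case: (inner x y) => a b /=; congr Complex; ring.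
Qed.

Lemma rip_nr x : rip x x = nr x ^+ 2.
Proof. by rewrite /rip inner_norm normE !expr2 ReM_real. Qed.

Lemma rip_ge0 x : 0 <= rip x x.
Proof. by rewrite rip_nr sqr_ge0. Qed.

Lemma nr0 : nr 0 = 0. Proof. by rewrite /nr normr0. Qed.

Lemma nr_eq0 x : nr x = 0 -> x = 0.
Proof. by move=> h; apply/eqP; rewrite -normr_eq0 normE h. Qed.

Lemma nrN x : nr (- x) = nr x. Proof. by rewrite /nr normrN. Qed.

Lemma nrBC x y : nr (x - y) = nr (y - x).
Proof. by rewrite -nrN opprB. Qed.

Lemma nrD x y : nr (x + y) <= nr x + nr y.
Proof. by have := ler_normD x y; rewrite !normE -rmorphD lecR. Qed.

Lemma nrB x y : nr (x - y) <= nr x + nr y.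
Proof. by rewrite -(nrN y) nrD. Qed.

Lemma nrZ (c : R[i]) x : nr (c *: x) = complex.Re `|c| * nr x.
Proof. by rewrite /nr normrZ normc_def ReM_real. Qed.

Lemma nrZr (r : R) x : nr (r%:C *: x) = `|r| * nr x.
Proof. by rewrite nrZ normc_def /= expr0n /= addr0 sqrtr_sqr. Qed.

Lemma nr_i x : nr ('i *: x) = nr x.
Proof. by rewrite nrZ normc_def /= expr0n /= add0r expr1n sqrtr1 mul1r. Qed.

Lemma rip0_eq x : (forall y, rip x y = 0) -> x = 0.
Proof. by move=> /(_ x); rewrite rip_nr => /eqP; rewrite sqrf_eq0 => /eqP/nr_eq0. Qed.

Lemma rip_ext x x' : (forall y, rip x y = rip x' y) -> x = x'.
Proof.
move=> h; apply/eqP; rewrite -subr_eq0; apply/eqP/rip0_eq => y.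
by rewrite ripBl h subrr.
Qed.

Lemma rip0l y : rip 0 y = 0. Proof. by rewrite -(subrr y) ripBl subrr. Qed.
Lemma rip0r y : rip y 0 = 0. Proof. by rewrite ripC rip0l. Qed.

(** The step that turns positivity of a quadratic polynomial without constant
    term into the vanishing of its linear coefficient. *)
Lemma quad_ge0 (a b : R) : (forall t : R, 0 <= t ^+ 2 * a + 2 * t * b) -> b = 0.
Proof.
move=> h; apply/eqP/negPn/negP => b0.
have a0 : 0 <= a by have := h 1; have := h (-1); nra.
have := h (- b / (a + 1)).
have -> : (- b / (a + 1)) ^+ 2 * a + 2 * (- b / (a + 1)) * b =
  - (b ^+ 2 * (a + 2)) / (a + 1) ^+ 2 by field; lra.
rewrite mulNr oppr_ge0 leNgt => /negP; apply.
have b2 : 0 < b ^+ 2 by rewrite exprn_even_gt0.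
by apply: divr_gt0; [apply: mulr_gt0 => //; lra|apply: exprn_gt0; lra].
Qed.

(** The real form of the Cauchy-Schwarz inequality, stated for a positive
    symmetric form so that it also serves for [rip (a x) y]. *)
Lemma cauchy_form (B : HH -> HH -> R)
    (BD : forall x y z, B (x + y) z = B x z + B y z)
    (BZ : forall r x y, B (r%:C *: x) y = r * B x y)
    (BC : forall x y, B x y = B y x) (B0 : forall x, 0 <= B x x) x y :
  B x y ^+ 2 <= B x x * B y y.
Proof.
have key t : 0 <= B x x + 2 * t * B x y + t ^+ 2 * B y y.
  have := B0 (x + t%:C *: y).
  rewrite BD [B x (_ + _)]BC [B (_ *: _) (_ + _)]BZ BD [B y (_ + _)]BC BD !BZ.
  rewrite (BC y x); lra.
have [y0|y0] := eqVneq (B y y) 0.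
  suff -> : B x y = 0 by rewrite y0 mulr0 expr0n.
  apply: (@quad_ge0 0) => t; rewrite mulr0 add0r.
  have [//|neg] := lerP 0 (2 * t * B x y).
  have s0 := B0 x; have := key (- (t * (B x x + 1)) / (2 * t * B x y) * 2).
  rewrite y0 mulr0 addr0.
  have tb : t * B x y != 0 by apply/eqP => e; move: neg; rewrite -mulrA e; lra.
  have -> : B x x + 2 * (- (t * (B x x + 1)) / (2 * t * B x y) * 2) * B x y =
    - B x x - 2.
    by move: tb; rewrite mulf_eq0 negb_or => /andP[t0 b0]; field; rewrite b0 t0.
  lra.
have yp : 0 < B y y by rewrite lt_neqAle eq_sym y0 B0.
have := key (- B x y / B y y).
have -> : B x x + 2 * (- B x y / B y y) * B x y + (- B x y / B y y) ^+ 2 * B y y =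
  (B x x * B y y - B x y ^+ 2) / B y y by field.
by rewrite pmulr_lge0 ?invr_gt0 // subr_ge0.
Qed.

Lemma rip_CS x y : `|rip x y| <= nr x * nr y.
Proof.
rewrite -(ler_pXn2r (n := 2)) ?nnegrE ?mulr_ge0 ?nr_ge0 // real_normK ?num_real //.
rewrite exprMn -!rip_nr; apply: (cauchy_form ripDl ripZl ripC rip_ge0).
Qed.

(** Radii are real, whereas the norm of [HH] takes its values in [R[i]]. *)
Definition hcvg (u : nat -> HH) (l : HH) :=
  forall e : R, 0 < e -> exists N, forall n, (N <= n)%N -> nr (u n - l) < e.

Definition hcauchy (u : nat -> HH) :=
  forall e : R, 0 < e ->
    exists N, forall n m, (N <= n)%N -> (N <= m)%N -> nr (u n - u m) < e.

Lemma gt0_complex (e : R[i]) : 0 < e -> exists2 r : R, 0 < r & e = r%:C.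
Proof.
case: e => a b; rewrite ltcE /= => /andP[/eqP b0 a0]; exists a => //.
by rewrite b0.
Qed.

Lemma hcomplete (u : nat -> HH) : hcauchy u -> exists l, hcvg u l.
Proof.
move=> cu.
have: cvg (u @ \oo).
  apply/cauchy_cvgP/cauchy_ballP => e /gt0_complex[r r0 ->].
  have [N hN] := cu _ r0.
  exists ([set z | exists2 n, (N <= n)%N & z = u n],
          [set z | exists2 n, (N <= n)%N & z = u n]) => /=.
    by split; exists N => // n /= hn; exists n.
  move=> [a b] /= [[n hn ->] [m hm ->]].
  by rewrite -ball_normE /ball_ /= normE ltcR; exact: hN.
move=> cvu; exists (lim (u @ \oo)) => e e0.
have e0' : 0 < e%:C :> R[i] by rewrite ltcR.
have /cvgrPdist_lt/(_ _ e0')[N _ hN] := cvu; exists N => n hn.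
by have := hN n hn; rewrite normE ltcR nrBC.
Qed.

Lemma hcvg_unique u l l' : hcvg u l -> hcvg u l' -> l = l'.
Proof.
move=> h h'; apply/eqP; rewrite -subr_eq0; apply/eqP/nr_eq0/eqP.
rewrite eq_le nr_ge0 andbT leNgt; apply/negP => p.
have p2 : 0 < nr (l - l') / 2 by rewrite divr_gt0.
have [N hN] := h _ p2; have [N' hN'] := h' _ p2.
have := hN _ (leq_maxl N N'); have := hN' _ (leq_maxr N N').
set v := u _ => a b.
have := nrD (l - v) (v - l'); rewrite addrA subrK (nrBC l v); lra.
Qed.

Lemma hcvgD u v l l' : hcvg u l -> hcvg v l' -> hcvg (fun n => u n + v n) (l + l').
Proof.
move=> h h' e e0; have p2 : 0 < e / 2 by rewrite divr_gt0.
have [N hN] := h _ p2; have [N' hN'] := h' _ p2.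
exists (maxn N N') => n; rewrite geq_max => /andP[/hN a /hN' b].
by rewrite opprD addrACA; have := nrD (u n - l) (v n - l'); lra.
Qed.

Lemma hcvg_lip (f : HH -> HH) (c : R) u l :
  (forall x y, nr (f x - f y) <= c * nr (x - y)) -> hcvg u l ->
  hcvg (fun n => f (u n)) (f l).
Proof.
move=> fc h e e0.
have c1 : 0 < `|c| + 1 by rewrite ltr_wpDl.
have [N hN] := h (e / (`|c| + 1)) (divr_gt0 e0 c1); exists N => n /hN.
rewrite ltr_pdivlMr // => hn; apply: le_lt_trans (fc _ _) (le_lt_trans _ hn).
rewrite mulrC ler_wpM2l ?nr_ge0 //; have := ler_norm c; lra.
Qed.

Definition rcvg (u : nat -> R) (l : R) :=
  forall e : R, 0 < e -> exists N, forall n, (N <= n)%N -> `|u n - l| < e.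

Lemma rcvg_le u v l l' : rcvg u l -> rcvg v l' -> (forall n, u n <= v n) -> l <= l'.
Proof.
move=> h h' uv; rewrite leNgt; apply/negP => p.
have p2 : 0 < (l - l') / 2 by rewrite divr_gt0 // subr_gt0.
have [N hN] := h _ p2; have [N' hN'] := h' _ p2.
have := hN _ (leq_maxl N N'); have := hN' _ (leq_maxr N N').
have := uv (maxn N N'); rewrite !ltr_norml => a /andP[b c] /andP[d g]; lra.
Qed.

Lemma rcvg_const l : rcvg (fun=> l) l.
Proof. by move=> e e0; exists 0%N => n _; rewrite subrr normr0. Qed.

Lemma rcvg_rip u l y : hcvg u l -> rcvg (fun n => rip (u n) y) (rip l y).
Proof.
move=> h e e0.
have y1 : 0 < nr y + 1 by rewrite ltr_wpDl ?nr_ge0.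
have [N hN] := h (e / (nr y + 1)) (divr_gt0 e0 y1); exists N => n /hN.
rewrite ltr_pdivlMr // => hn; rewrite -ripBl.
apply: le_lt_trans (rip_CS _ _) (le_lt_trans _ hn).
by rewrite ler_wpM2l ?nr_ge0 // lerDl.
Qed.

Lemma rcvg_ripr u l y : hcvg u l -> rcvg (fun n => rip y (u n)) (rip y l).
Proof. by move=> /(rcvg_rip y) h e /h[N hN]; exists N => n /hN; rewrite !(ripC y). Qed.

Lemma rcvg_nr u l : hcvg u l -> rcvg (fun n => nr (u n)) (nr l).
Proof.
move=> h e /h[N hN]; exists N => n /hN; apply: le_lt_trans.
rewrite ler_norml; apply/andP; split.
  by have := nrD (l - u n) (u n); rewrite subrK (nrBC l); lra.
by have := nrD (u n - l) l; rewrite subrK; lra.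
Qed.

Lemma invS_small (e : R) : 0 < e -> exists N, forall n, (N <= n)%N -> n.+1%:R^-1 < e.
Proof.
move=> e0; exists (Num.truncn e^-1) => n hn; rewrite invf_plt ?posrE //.
apply: lt_le_trans (truncnS_gt _) _; by rewrite ler_nat.
Qed.

(** The Lax-Milgram principle for a coercive symmetric [P], obtained by
    minimising [rip (P x) x - 2 f x].  For [P = id] it is the Riesz
    representation theorem, which provides adjoints; for [P = A^* A] it
    provides inverses. *)
Lemma coercive_solve (P : HH -> HH) (f : HH -> R) (c C : R) :
  0 < c ->
  (forall x y, P (x + y) = P x + P y) ->
  (forall r x, P (r%:C *: x) = r%:C *: P x) ->
  (forall x y, rip (P x) y = rip x (P y)) ->
  (forall x, c * nr x ^+ 2 <= rip (P x) x) ->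
  (forall x y, f (x + y) = f x + f y) ->
  (forall r x, f (r%:C *: x) = r * f x) ->
  (forall x, `|f x| <= C * nr x) ->
  exists l, forall x, f x = rip (P l) x.
Proof.
move=> c0 PD PZ Ps Pc fD fZ fb.
pose g x := rip (P x) x - 2 * f x.
have g_lb x : - (C ^+ 2 / c) <= g x.
  have := Pc x; have := fb x; have := nr_ge0 x; rewrite /g ler_norml.
  set n := nr x; set p := rip _ _; set w := f x => n0 /andP[w1 w2] h.
  have : 0 <= (c * n - C) ^+ 2 / c by rewrite divr_ge0 ?sqr_ge0 // ltW.
  have -> : (c * n - C) ^+ 2 / c = c * n ^+ 2 - 2 * (C * n) + C ^+ 2 / c.
    by field; lra.
  lra.
have hi : has_inf (range g).
  split; first by exists (g 0); exists 0.
  by exists (- (C ^+ 2 / c)) => _ [x _ <-].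
set m := inf (range g).
have gm x : m <= g x by apply: ge_inf; [case: hi|exists x].
have ex n : exists x, g x < m + n.+1%:R^-1.
  have [|_ [x _ <-] h] := @inf_adherent _ (range g) n.+1%:R^-1 _ hi.
    by rewrite invr_gt0.
  by exists x.
have [u hu] := choice ex.
have gD x y : g (x + y) = g x + g y + 2 * rip (P x) y.
  rewrite /g PD fD !ripDl !ripDr [rip (P y) x]Ps [rip y _]ripC; lra.
have gZ r x : g (r%:C *: x) = r ^+ 2 * rip (P x) x - 2 * r * f x.
  rewrite /g PZ fZ ripZl ripZr; lra.
have PN x : P (- x) = - P x by have := PZ (-1) x; rewrite rmorphN1 !scaleN1r.
have fN x : f (- x) = - f x by have := fZ (-1) x; rewrite rmorphN1 !scaleN1r mulN1r.
have cau : hcauchy u.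
  move=> e e0.
  have [N hN] := @invS_small (c * e ^+ 2 / 4) ltac:(by rewrite divr_gt0 // mulr_gt0 // exprn_gt0).
  exists N => n k hn hk.
  have a := hu n; have b := hu k; have a' := hN n hn; have b' := hN k hk.
  have d := gm ((2^-1 : R)%:C *: (u n + u k)).
  have pc := Pc (u n - u k).
  rewrite -(ltr_pXn2r (n := 2)) ?nnegrE ?nr_ge0 ?(ltW e0) //.
  rewrite -(ltr_pM2l c0); apply: le_lt_trans pc _.
  move: d a b; rewrite gZ /g PD fD PD PN !ripDl !ripDr !ripNl !ripNr.
  rewrite [rip (P (u k)) (u n)]Ps [rip (u k) _]ripC.
  set p := rip _ _; set q := rip _ _; set r := rip _ _.
  have -> : 2^-1 ^+ 2 = 4^-1 :> R by rewrite exprVn; congr _^-1; ring.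
  move: a' b'; set X := n.+1%:R^-1; set Y := k.+1%:R^-1 => a' b' d a b.
  clearbody X Y p q r; lra.
have [l hl] := hcomplete cau; exists l => x.
suff : rip (P l) x - f x = 0 by lra.
apply: (@quad_ge0 (rip (P x) x)) => t.
have h n : - n.+1%:R^-1 <= t ^+ 2 * rip (P x) x + 2 * t * (rip (u n) (P x) - f x).
  have := gm (u n + t%:C *: x); rewrite gD gZ ripZr [rip (P (u n)) x]Ps.
  by have := hu n; set X := n.+1%:R^-1; clearbody X; lra.
have /(rcvg_rip (P x)) lx := hl.
rewrite -[rip (P l) x]ripC -[rip x (P l)]Ps ripC.
rewrite leNgt; apply/negP => neg.
set w := _ + _ in neg.
have t1 : 0 < 4 * `|t| + 1 by rewrite ltr_wpDl // mulr_ge0.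
have [N hN] := lx (- w / (4 * `|t| + 1)) ltac:(by rewrite divr_gt0 // oppr_gt0).
have [N' hN'] := @invS_small (- w / 2) ltac:(by rewrite divr_gt0 // oppr_gt0).
have := hN _ (leq_maxl N N'); have := hN' _ (leq_maxr N N').
have := h (maxn N N'); set i := _^-1; set v := rip (u _) _; clearbody i v => a b.
rewrite ltr_pdivlMr // => d.
have : 2 * t * (v - rip l (P x)) <= - w / 2.
  apply: le_trans (ler_norm _) _; rewrite !normrM normr_nat.
  move: d; set q := `|_ - _|; set s := `|t|; have : 0 <= q by exact: normr_ge0.
  have : 0 <= s by exact: normr_ge0.
  nra.
move: neg b; rewrite /w [rip x (P x)]ripC [rip (P x) l]ripC; lra.
Qed.

End RealHilbert.

(** * The ring of bounded operators *)

Section BoundedOperators.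
Context {R : realType} {HH : hilbertType R}.
Implicit Types x y z : HH.

Lemma boundedP (A : HH -> HH) : linear A ->
  bounded_operator A <-> exists c : R, 0 <= c /\ forall x, nr (A x) <= c * nr x.
Proof.
move=> linA; pose f := HB.pack_for {linear HH -> HH} A (GRing.isLinear.Build _ _ _ _ A linA).
split=> [[_ cA]|[c [c0 hc]]].
  have : bounded_near (f : HH -> HH) (nbhs 0) by apply/linear_bounded_continuous.
  move=> /linear_boundedP /pinfty_ex_gt0[r /gt0_complex[s s0 ->] h].
  exists s; split; first exact: ltW.
  by move=> x; have := h x; rewrite !normE -rmorphM lecR.
split => //; apply: (linear_bounded_continuous f).1; apply/linear_boundedP.
exists (c%:C); split; first by rewrite ger0_real // ler0c.
move=> r cr x; rewrite /f /= normE.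
apply: (@le_trans _ _ (c%:C * `|x|)).
  by rewrite normE -rmorphM lecR.
by rewrite ler_wpM2r // ltW.
Qed.

Record bop := Bop { bfun :> HH -> HH; bopP : bounded_operator bfun }.

HB.instance Definition _ := gen_eqMixin bop.
HB.instance Definition _ := gen_choiceMixin bop.

Lemma bop_ext (a b : bop) : (forall x, a x = b x) -> a = b.
Proof.
case: a b => [f fP] [g gP] /= h; have fg : f = g by apply/funext.
by move: fP; rewrite fg => fP; congr Bop; exact: Prop_irrelevance.
Qed.

Lemma bop_inj (a b : bop) : bfun a = bfun b -> a = b.
Proof. by move=> h; apply: bop_ext => x; rewrite h. Qed.

Lemma bop_linear (a : bop) : linear a. Proof. by case: (bopP a). Qed.

Lemma bopD (a : bop) x y : a (x + y) = a x + a y.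
Proof. by have := bop_linear a 1 x y; rewrite !scale1r. Qed.

Lemma bop0 (a : bop) : a 0 = 0.
Proof. by have := bopD a 0 0; rewrite addr0 => /eqP; rewrite -subr_eq0 opprD addNKr oppr_eq0 => /eqP. Qed.

Lemma bopZ (a : bop) c x : a (c *: x) = c *: a x.
Proof. by have := bop_linear a c x 0; rewrite !addr0 bop0 addr0. Qed.

Lemma bopN (a : bop) x : a (- x) = - a x.
Proof. by rewrite -scaleN1r bopZ scaleN1r. Qed.

Lemma bopB (a : bop) x y : a (x - y) = a x - a y.
Proof. by rewrite bopD bopN. Qed.

Lemma bop_bound (a : bop) : exists c : R, 0 <= c /\ forall x, nr (a x) <= c * nr x.
Proof. by apply/boundedP; [exact: bop_linear|exact: bopP]. Qed.

Definition bddop (A : HH -> HH) :=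
  linear A /\ exists c : R, 0 <= c /\ forall x, nr (A x) <= c * nr x.

Lemma bddopP A : bddop A -> bounded_operator A.
Proof. by move=> [l h]; apply/boundedP. Qed.

Lemma zero_bdd : bddop (0 : HH -> HH).
Proof.
have z x : (0 : HH -> HH) x = 0 by [].
split; first by move=> c x y; rewrite !z scaler0 addr0.
by exists 0; split => // x; rewrite z nr0 mul0r.
Qed.

Lemma id_bdd : bddop (@idfun HH).
Proof. by split => //; exists 1; split => // x; rewrite mul1r. Qed.

Lemma add_bdd (a b : bop) : bddop (bfun a + bfun b).
Proof.
split; first by move=> c x y; rewrite !fctE !bop_linear scalerDr addrACA.
have [c [c0 hc]] := bop_bound a; have [d [d0 hd]] := bop_bound b.
exists (c + d); split; first exact: addr_ge0.
by move=> x; rewrite fctE mulrDl; apply: le_trans (nrD _ _) _; rewrite lerD.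
Qed.

Lemma scale_bdd k (a : bop) : bddop (k *: bfun a).
Proof.
split; first by move=> c x y; rewrite !fctE bop_linear scalerDr !scalerA mulrC.
have [c [c0 hc]] := bop_bound a; exists (complex.Re `|k| * c).
have k0 : 0 <= complex.Re `|k| by rewrite normc_def /= sqrtr_ge0.
split; first exact: mulr_ge0.
by move=> x; rewrite fctE nrZ -mulrA ler_wpM2l.
Qed.

Lemma comp_bdd (a b : bop) : bddop (bfun a \o bfun b).
Proof.
split; first by move=> c x y; rewrite /= !bop_linear.
have [c [c0 hc]] := bop_bound a; have [d [d0 hd]] := bop_bound b.
exists (c * d); split; first exact: mulr_ge0.
by move=> x; apply: le_trans (hc _) _; rewrite -mulrA ler_wpM2l.
Qed.

Definition bzero := Bop (bddopP zero_bdd).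
Definition bone := Bop (bddopP id_bdd).
Definition badd a b := Bop (bddopP (add_bdd a b)).
Definition bscale k a := Bop (bddopP (scale_bdd k a)).
Definition bmul a b := Bop (bddopP (comp_bdd a b)).
Definition bopp a := bscale (-1) a.

Lemma baddA : associative badd.
Proof. by move=> a b c; apply: bop_ext => x; rewrite /= !fctE addrA. Qed.
Lemma baddC : commutative badd.
Proof. by move=> a b; apply: bop_ext => x; rewrite /= !fctE addrC. Qed.
Lemma badd0 : left_id bzero badd.
Proof. by move=> a; apply: bop_ext => x; rewrite /= !fctE add0r. Qed.
Lemma baddN : left_inverse bzero bopp badd.
Proof. by move=> a; apply: bop_ext => x; rewrite /= !fctE scaleN1r addNr. Qed.
HB.instance Definition _ := GRing.isZmodule.Build bop baddA baddC badd0 baddN.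

Lemma bmulA : associative bmul.
Proof. by move=> a b c; apply: bop_ext. Qed.
Lemma bmul1l : left_id bone bmul.
Proof. by move=> a; apply: bop_ext. Qed.
Lemma bmul1r : right_id bone bmul.
Proof. by move=> a; apply: bop_ext. Qed.
Lemma bmulDl : left_distributive bmul +%R.
Proof. by move=> a b c; apply: bop_ext. Qed.
Lemma bmulDr : right_distributive bmul +%R.
Proof. by move=> a b c; apply: bop_ext => x; rewrite /= !fctE bopD. Qed.
HB.instance Definition _ :=
  GRing.Zmodule_isPzRing.Build bop bmulA bmul1l bmul1r bmulDl bmulDr.

Lemma bscaleA c d a : bscale c (bscale d a) = bscale (c * d) a.
Proof. by apply: bop_ext => x; rewrite /= !fctE scalerA. Qed.
Lemma bscale1 : left_id 1 bscale.
Proof. by move=> a; apply: bop_ext => x; rewrite /= !fctE scale1r. Qed.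
Lemma bscaleDr : right_distributive bscale +%R.
Proof. by move=> c a b; apply: bop_ext => x; rewrite /= !fctE scalerDr. Qed.
Lemma bscaleDl a : {morph bscale^~ a : c d / c + d}.
Proof. by move=> c d; apply: bop_ext => x; rewrite /= !fctE scalerDl. Qed.
HB.instance Definition _ :=
  GRing.Zmodule_isLmodule.Build R[i] bop bscaleA bscale1 bscaleDr bscaleDl.

Implicit Types a b c : bop.

Lemma bDE a b x : (a + b) x = a x + b x. Proof. by []. Qed.
Lemma bZE k a x : (k *: a) x = k *: a x. Proof. by []. Qed.
Lemma bME a b x : (a * b) x = a (b x). Proof. by []. Qed.
Lemma b1E x : (1 : bop) x = x. Proof. by []. Qed.
Lemma b0E x : (0 : bop) x = 0. Proof. by []. Qed.
Lemma bNE a x : (- a) x = - a x. Proof. exact: scaleN1r. Qed.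
Lemma bBE a b x : (a - b) x = a x - b x. Proof. by rewrite bDE bNE. Qed.
Definition bE := (bBE, bNE, bDE, bZE, bME, b1E, b0E).

Lemma bscaleAl k a b : (k *: a) * b = k *: (a * b).
Proof. by apply: bop_ext. Qed.
Lemma bscaleAr k a b : a * (k *: b) = k *: (a * b).
Proof. by apply: bop_ext => x; rewrite !bE bopZ. Qed.

(** * Operator norm *)

Definition on a : R := opnorm a.

Lemma on_set a : has_sup [set complex.Re `|a x| | x in [set x : HH | `|x| <= 1]].
Proof.
split; first by exists (nr (a 0)); exists 0 => //=; rewrite normr0.
have [c [c0 hc]] := bop_bound a; exists c => _ [x /= x1 <-].
apply: le_trans (hc x) _; rewrite ler_piMr //.
by move: x1; rewrite normE (_ : 1 = 1%:C) // lecR.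
Qed.

Lemma on_ge0 a : 0 <= on a.
Proof.
apply: le_trans (nr_ge0 (a 0)) _; apply: ub_le_sup; first by case: (on_set a).
by exists 0 => //=; rewrite normr0.
Qed.

Lemma nr_on a x : nr (a x) <= on a * nr x.
Proof.
have [->|x0] := eqVneq x 0; first by rewrite bop0 nr0 mulr0.
have n0 : 0 < nr x.
  by rewrite lt_neqAle nr_ge0 andbT eq_sym; apply: contraNN x0 => /eqP/nr_eq0 ->.
rewrite -ler_pdivrMr //.
have -> : nr (a x) / nr x = nr (a ((nr x)^-1%:C *: x)).
  by rewrite bopZ nrZr ger0_norm ?invr_ge0 ?nr_ge0 // mulrC.
apply: ub_le_sup; first by case: (on_set a).
exists ((nr x)^-1%:C *: x) => //=; rewrite normE nrZr ger0_norm ?invr_ge0 ?nr_ge0 //.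
by rewrite mulVf // gt_eqF.
Qed.

Lemma on_le a (c : R) : 0 <= c -> (forall x, nr (a x) <= c * nr x) -> on a <= c.
Proof.
move=> c0 h; apply: ge_sup; first by case: (on_set a).
move=> _ [x /= x1 <-]; apply: le_trans (h x) _; rewrite ler_piMr //.
by move: x1; rewrite normE (_ : 1 = 1%:C) // lecR.
Qed.

Lemma onD a b : on (a + b) <= on a + on b.
Proof.
apply: on_le => [|x]; first by rewrite addr_ge0 ?on_ge0.
by rewrite bDE mulrDl; apply: le_trans (nrD _ _) (lerD _ _); exact: nr_on.
Qed.

Lemma onM a b : on (a * b) <= on a * on b.
Proof.
apply: on_le => [|x]; first by rewrite mulr_ge0 ?on_ge0.
rewrite bME -mulrA; apply: le_trans (nr_on _ _) _.
by rewrite ler_wpM2l ?on_ge0 // nr_on.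
Qed.

Lemma onZ k a : on (k *: a) <= complex.Re `|k| * on a.
Proof.
have k0 : 0 <= complex.Re `|k| by rewrite normc_def /= sqrtr_ge0.
apply: on_le => [|x]; first by rewrite mulr_ge0 ?on_ge0.
by rewrite bZE nrZ -mulrA ler_wpM2l // nr_on.
Qed.

Lemma onZr (r : R) a : on (r%:C *: a) <= `|r| * on a.
Proof. by apply: le_trans (onZ _ _) _; rewrite normc_def /= expr0n /= addr0 sqrtr_sqr. Qed.

Lemma on_i a : on ('i *: a) <= on a.
Proof.
apply: le_trans (onZ _ _) _.
by rewrite normc_def /= expr0n /= add0r expr1n sqrtr1 mul1r.
Qed.

Lemma onN a : on (- a) = on a.
Proof.
have h b : on (- b) <= on b.
  by apply: on_le => [|x]; [exact: on_ge0|rewrite bNE nrN nr_on].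
by apply/eqP; rewrite eq_le h /= -{1}[a]opprK h.
Qed.

Lemma onB a b : on (a - b) <= on a + on b.
Proof. by rewrite -(onN b) onD. Qed.

Lemma onBC a b : on (a - b) = on (b - a).
Proof. by rewrite -onN opprB. Qed.

Lemma on0 : on 0 = 0.
Proof.
by apply/eqP; rewrite eq_le on_ge0 andbT; apply: on_le => // x; rewrite b0E nr0 mul0r.
Qed.

Lemma on1 : on 1 <= 1.
Proof. by apply: on_le => // x; rewrite b1E mul1r. Qed.

Lemma on_eq0 a : on a <= 0 -> a = 0.
Proof.
move=> h; apply: bop_ext => x; apply: nr_eq0; apply/eqP; rewrite eq_le nr_ge0 andbT.
by apply: le_trans (nr_on a x) _; rewrite mulr_le0_ge0 ?nr_ge0.
Qed.

(** * Adjoints *)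

Lemma adj_ex a y : exists z, forall x, rip (a x) y = rip x z.
Proof.
have [z hz] := @coercive_solve R HH id (fun x => rip (a x) y) 1 (on a * nr y)
  ltr01 (fun _ _ => erefl) (fun _ _ => erefl) (fun _ _ => erefl)
  (fun x => ltac:(by rewrite mul1r rip_nr))
  (fun x x' => ltac:(by rewrite /= bopD ripDl)) (fun r x => ltac:(by rewrite /= bopZ ripZl))
  (fun x => ltac:(by apply: le_trans (rip_CS _ _) _; rewrite mulrAC ler_wpM2r ?nr_ge0 ?nr_on)).
by exists z => x; rewrite hz ripC.
Qed.

Definition adj_fun a y := projT1 (cid (adj_ex a y)).

Lemma adj_funP a x y : rip (a x) y = rip x (adj_fun a y).
Proof. by rewrite /adj_fun; case: cid. Qed.

Lemma adj_bdd a : bddop (adj_fun a).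
Proof.
split.
  move=> k x y; apply: rip_ext => z; rewrite ripC -adj_funP [RHS]ripC.
  rewrite ripDr ripDr -adj_funP; congr (_ + _).
  rewrite {1}/rip innerZr [in RHS]/rip innerZr (innerE (a z)) (innerE z).
  rewrite !adj_funP -!adj_funP.
  suff -> : rip (a z) ('i *: x) = rip z ('i *: adj_fun a x) by rewrite adj_funP.
  by rewrite -[LHS]opprK -rip_i -bopZ adj_funP rip_i opprK.
exists (on a); split; first exact: on_ge0.
move=> y; have [->|y0] := eqVneq (nr (adj_fun a y)) 0.
  by rewrite mulr_ge0 ?on_ge0 ?nr_ge0.
have yp : 0 < nr (adj_fun a y) by rewrite lt_neqAle eq_sym y0 nr_ge0.
rewrite -(ler_pM2l yp) -expr2 -rip_nr -adj_funP.
apply: le_trans (ler_norm _) (le_trans (rip_CS _ _) _).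
by rewrite mulrCA mulrA ler_wpM2r ?nr_ge0 ?nr_on.
Qed.

Definition adj a := Bop (bddopP (adj_bdd a)).

Lemma rip_adj a x y : rip (a x) y = rip x (adj a y).
Proof. exact: adj_funP. Qed.

Lemma adj_rip a x y : rip (adj a x) y = rip x (a y).
Proof. by rewrite ripC -rip_adj ripC. Qed.

Lemma inner_of_rip (A B : HH -> HH) :
  (forall k x, A (k *: x) = k *: A x) ->
  (forall x y, rip (A x) y = rip x (B y)) -> forall x y, inner (A x) y = inner x (B y).
Proof.
move=> AZ h x y; rewrite !innerE h; congr Complex.
by rewrite -[LHS]opprK -rip_i -AZ h rip_i opprK.
Qed.

Lemma adj_uniq a (b : bop) : (forall x y, rip (a x) y = rip x (b y)) -> b = adj a.
Proof.
by move=> h; apply: bop_ext => y; apply: rip_ext => x; rewrite ripC -h rip_adj ripC.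
Qed.

Lemma adjointE a : adjoint a = adj a :> (HH -> HH).
Proof.
rewrite /adjoint; case: xgetP => [B _ [bB hB]|/(_ (adj a)) []].
  suff <- : Bop bB = adj a by [].
by apply: adj_uniq => x y; rewrite /rip hB.
split; first exact: bopP.
by apply: inner_of_rip; [exact: bopZ|exact: rip_adj].
Qed.

Lemma adjK a : adj (adj a) = a.
Proof. by symmetry; apply: adj_uniq => x y; rewrite adj_rip. Qed.
Lemma adjD a b : adj (a + b) = adj a + adj b.
Proof. by symmetry; apply: adj_uniq => x y; rewrite !bE ripDl ripDr !rip_adj. Qed.
Lemma adjN a : adj (- a) = - adj a.
Proof. by symmetry; apply: adj_uniq => x y; rewrite !bE ripNl ripNr !rip_adj. Qed.
Lemma adjB a b : adj (a - b) = adj a - adj b.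
Proof. by rewrite adjD adjN. Qed.
Lemma adjM a b : adj (a * b) = adj b * adj a.
Proof. by symmetry; apply: adj_uniq => x y; rewrite !bE !rip_adj. Qed.
Lemma adj1 : adj 1 = 1.
Proof. by symmetry; apply: adj_uniq => x y; rewrite !bE. Qed.
Lemma adj0 : adj 0 = 0.
Proof. by symmetry; apply: adj_uniq => x y; rewrite !bE rip0l rip0r. Qed.
Lemma adjZr (r : R) a : adj (r%:C *: a) = r%:C *: adj a.
Proof. by symmetry; apply: adj_uniq => x y; rewrite !bE ripZl ripZr rip_adj. Qed.
Lemma adj_i a : adj ('i *: a) = - ('i *: adj a).
Proof. by symmetry; apply: adj_uniq => x y; rewrite !bE ripNr rip_i rip_adj bopZ. Qed.

Lemma on_adj a : on (adj a) = on a.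
Proof.
have h b : on (adj b) <= on b.
  apply: on_le => [|x]; first exact: on_ge0.
  have [->|y0] := eqVneq (nr (adj b x)) 0; first by rewrite mulr_ge0 ?on_ge0 ?nr_ge0.
  have yp : 0 < nr (adj b x) by rewrite lt_neqAle eq_sym y0 nr_ge0.
  rewrite -(ler_pM2l yp) -expr2 -rip_nr adj_rip ripC.
  apply: le_trans (ler_norm _) (le_trans (rip_CS _ _) _).
  by rewrite mulrCA mulrA ler_wpM2r ?nr_ge0 ?nr_on.
by apply/eqP; rewrite eq_le h -{1}(adjK a) h.
Qed.

(** * Invertible operators *)

Definition invb a b := a * b = 1 /\ b * a = 1.
Definition unitb a := exists b, invb a b.
Definition binv a : bop := xget 0 [set b | invb a b].

Lemma invb_uniq a b b' : invb a b -> invb a b' -> b = b'.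
Proof. by move=> [_ ba] [ab' _]; rewrite -[b]mulr1 -ab' mulrA ba mul1r. Qed.

Lemma binvP a : unitb a -> invb a (binv a).
Proof. by move=> [b ab]; rewrite /binv; case: xgetP => [_ -> //|/(_ b)]. Qed.

Lemma binv_eq a b : invb a b -> binv a = b.
Proof. by move=> ab; apply: (invb_uniq _ ab); apply: binvP; exists b. Qed.

Lemma mulbV a : unitb a -> a * binv a = 1. Proof. by move/binvP => []. Qed.
Lemma mulVb a : unitb a -> binv a * a = 1. Proof. by move/binvP => []. Qed.

Lemma is_inverseE a b : is_inverse a b <-> invb a b.
Proof.
split=> [[_ h1 h2]|[h1 h2]]; first by split; apply: bop_inj.
by split; [exact: bopP|rewrite -[RHS]/(bfun 1) -h1|rewrite -[RHS]/(bfun 1) -h2].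
Qed.

Lemma has_bounded_inverseE a : has_bounded_inverse a <-> unitb a.
Proof.
split=> [[B iB]|[b ab]]; last by exists b; apply/is_inverseE.
by case: (iB) => bB _ _; exists (Bop bB); apply/is_inverseE.
Qed.

Lemma op_invE a : unitb a -> op_inv a = binv a :> (HH -> HH).
Proof.
move=> ua; rewrite /op_inv; case: xgetP => [B _ iB|/(_ (binv a)) []].
  case: (iB) => bB _ _.
  by have /binv_eq -> : invb a (Bop bB) by apply/is_inverseE.
by apply/is_inverseE; exact: binvP.
Qed.

Lemma unitM a b : unitb a -> unitb b -> unitb (a * b).
Proof.
move=> [a' [h1 h2]] [b' [k1 k2]]; exists (b' * a'); split.
  by rewrite mulrA -[a * b * b']mulrA k1 mulr1.
by rewrite mulrA -[b' * a' * a]mulrA h2 mulr1.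
Qed.

Lemma invb_adj a b : invb a b -> invb (adj a) (adj b).
Proof. by move=> [h1 h2]; rewrite /invb -!adjM h1 h2 adj1. Qed.

(** An operator that is bounded below, together with its adjoint, is
    invertible: [a^* a] and [a a^*] are coercive. *)
Lemma lower_bound_inv a (k : R) : 0 < k ->
  (forall x, k * nr x <= nr (a x)) -> (forall x, k * nr x <= nr (adj a x)) ->
  unitb a /\ on (binv a) <= k^-1.
Proof.
move=> k0 h h'.
have solve b : (forall x, k * nr x <= nr (b x)) -> forall y, exists l, adj b (b l) = y.
  move=> hb y.
  have [l hl] := @coercive_solve R HH (adj b * b) (fun x => rip x y) (k ^+ 2) (nr y)
    ltac:(by rewrite exprn_gt0)
    (fun _ _ => bopD _ _ _) (fun _ _ => bopZ _ _ _)
    (fun x x' => ltac:(by rewrite !bME adj_rip rip_adj))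
    (fun x => ltac:(by rewrite bME adj_rip rip_nr -exprMn ler_pXn2r ?nnegrE ?mulr_ge0 ?nr_ge0 ?(ltW k0)))
    (fun x x' => ripDl _ _ _) (fun r x => ripZl _ _ _)
    (fun x => ltac:(by apply: le_trans (rip_CS _ _) _; rewrite mulrC)).
  by exists l; apply: rip_ext => x; rewrite -[_ (_ l)]/((adj b * b) l) -hl ripC.
have sur y : exists x, a x = y.
  have [l hl] := @solve (adj a) h' y; exists (adj a l).
  by rewrite -[RHS]hl adjK.
have inj x : nr (a x) = 0 -> x = 0.
  by move=> e; apply: nr_eq0; have := h x; rewrite e pmulr_rle0 // => ?; apply/eqP; rewrite eq_le nr_ge0 andbT.
have [g hg] := choice sur.
have ga x : g (a x) = x.
  apply/eqP; rewrite -subr_eq0; apply/eqP/inj.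
  by rewrite bopB hg subrr nr0.
have gb y : nr (g y) <= k^-1 * nr y.
  by rewrite -ler_pdivrMl ?invr_gt0 // invrK -{2}(hg y); exact: h.
have bg : bddop g.
  split; last by exists k^-1; split => //; rewrite invr_ge0 ltW.
  by move=> c x y; rewrite -[RHS]ga bop_linear !hg.
have ig : invb a (Bop (bddopP bg)) by split; apply: bop_ext => x; rewrite bME.
split; first by exists (Bop (bddopP bg)).
by rewrite (binv_eq ig); apply: on_le => //; rewrite invr_ge0 ltW.
Qed.

Lemma inv_lower a x : unitb a -> nr x <= on (binv a) * nr (a x).
Proof. by move=> ua; rewrite -{1}[x]b1E -(mulVb ua) bME nr_on. Qed.

(** The open ball of radius [1 / (2 |a^-1|)]: there [b] is bounded below by half
    the lower bound of [a], and so is its adjoint. *)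
Lemma unit_perturb a b : unitb a -> 2 * on (binv a) * on (b - a) <= 1 ->
  unitb b /\ on (binv b) <= 2 * on (binv a).
Proof.
move=> ua; have [a0|a0] := eqVneq (on (binv a)) 0.
  have i0 : binv a = 0 by apply: on_eq0; rewrite a0.
  have e0 : (1 : bop) = 0 by rewrite -(mulbV ua) i0 mulr0.
  have b0 c : c = 0 by rewrite -[c]mul1r e0 mul0r.
  move=> _; split; first by exists 0; rewrite /invb e0 (b0 b) mul0r.
  by rewrite (b0 (binv b)) on0 mulr_ge0 ?on_ge0.
have ap : 0 < on (binv a) by rewrite lt_neqAle eq_sym a0 on_ge0.
move=> h.
have low c d : unitb c -> on (binv c) = on (binv a) -> on (d - c) = on (b - a) ->
    forall x, (2 * on (binv a))^-1 * nr x <= nr (d x).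
  move=> uc ec ed x; rewrite ler_pdivrMl ?mulr_gt0 //.
  have := inv_lower x uc; rewrite ec.
  have := nr_on (d - c) x; rewrite ed bBE.
  have := nrD (d x) (c x - d x); rewrite addrC subrK (nrBC (c x)).
  have := nr_ge0 x; move: (nr (c x)) (nr (d x - c x)) (nr (d x)) (nr x) (on_ge0 (b - a)).
  move: h ap; move: (on _) (on _) => A B h ap n1 n2 n3 n4 B0 g1 g2 g3 g4.
  nra.
have uat : unitb (adj a) by exists (adj (binv a)); apply: invb_adj; exact: binvP.
have bat : binv (adj a) = adj (binv a) by apply: binv_eq; apply: invb_adj; exact: binvP.
have [] := @lower_bound_inv b (2 * on (binv a))^-1.
- by rewrite invr_gt0 mulr_gt0.
- exact: (low a).
- by apply: (low (adj a)) => //; rewrite ?bat ?on_adj // -adjB on_adj.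
by rewrite invrK.
Qed.

End BoundedOperators.
Arguments bop {R} HH.

(** * Positive operators and the sign of a self-adjoint operator *)

Section Positive.
Context {R : realType} {HH : hilbertType R}.
Implicit Types (x y z : HH) (a b c s t : bop HH).
Local Notation Ib := (1 : bop HH).

Definition pos a := adj a = a /\ forall x, 0 <= rip (a x) x.

Lemma pos_sa a : pos a -> adj a = a. Proof. by case. Qed.

Lemma posD a b : pos a -> pos b -> pos (a + b).
Proof.
by move=> [a1 a2] [b1 b2]; split=> [|x]; rewrite ?adjD ?a1 ?b1 // bE ripDl addr_ge0.
Qed.

Lemma posZ (r : R) a : 0 <= r -> pos a -> pos (r%:C *: a).
Proof.
by move=> r0 [a1 a2]; split=> [|x]; rewrite ?adjZr ?a1 // bE ripZl mulr_ge0.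
Qed.

Lemma pos_conj a c : pos a -> pos (adj c * a * c).
Proof.
move=> [a1 a2]; split=> [|x]; first by rewrite !adjM adjK a1 mulrA.
by rewrite !bE adj_rip.
Qed.

Lemma pos_adjM c : pos (adj c * c).
Proof. by split=> [|x]; [rewrite adjM adjK|rewrite bE adj_rip rip_ge0]. Qed.

Lemma pos1 : pos 1.
Proof. by split=> [|x]; [rewrite adj1|rewrite bE rip_ge0]. Qed.

Lemma pos0 : pos 0.
Proof. by split=> [|x]; [rewrite adj0|rewrite bE rip0l]. Qed.

Lemma pos_sqr a : adj a = a -> pos (a * a).
Proof. by move=> {1}<-; exact: pos_adjM. Qed.

(** For [0 <= a], the Cauchy-Schwarz inequality of the form [rip (a x) y]
    gives [a^2 <= |a| a]. *)
Lemma pos_nr a x : pos a -> nr (a x) ^+ 2 <= on a * rip (a x) x.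
Proof.
move=> [a1 a2].
have symB y z : rip (a y) z = rip (a z) y by rewrite rip_adj a1 ripC.
have := @cauchy_form R HH (fun y z => rip (a y) z)
  (fun y y' z => ltac:(by rewrite /= bopD ripDl))
  (fun r y z => ltac:(by rewrite /= bopZ ripZl)) symB a2 x (a x).
rewrite rip_nr => h.
have : rip (a (a x)) (a x) <= on a * nr (a x) ^+ 2.
  apply: le_trans (ler_norm _) (le_trans (rip_CS _ _) _).
  by rewrite expr2 mulrA ler_wpM2r ?nr_ge0 ?nr_on.
have [->|n0] := eqVneq (nr (a x)) 0; first by rewrite expr0n mulr_ge0 ?on_ge0.
have np : 0 < nr (a x) ^+ 2 by rewrite exprn_even_gt0.
move=> h2; rewrite -(ler_pM2r np) -expr2; apply: le_trans h _.
by rewrite [leRHS]mulrAC [leRHS]mulrC ler_wpM2l.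
Qed.

Lemma pos_ker a x : pos a -> rip (a x) x <= 0 -> a x = 0.
Proof.
move=> pa h; apply: nr_eq0; apply/eqP; rewrite -sqrf_eq0 eq_le sqr_ge0 andbT.
by apply: le_trans (pos_nr x pa) _; rewrite mulr_ge0_le0 ?on_ge0.
Qed.

Lemma pos_le_on a x : rip (a x) x <= on a * nr x ^+ 2.
Proof.
apply: le_trans (ler_norm _) (le_trans (rip_CS _ _) _).
by rewrite expr2 mulrA ler_wpM2r ?nr_ge0 ?nr_on.
Qed.

Lemma pos_norm_sub a (r : R) : adj a = a -> on a <= r -> pos (r%:C *: Ib - a).
Proof.
move=> sa ar; split=> [|x]; first by rewrite adjB adjZr adj1 sa.
rewrite !bE ripBl ripZl rip_nr subr_ge0.
by apply: le_trans (pos_le_on a x) _; rewrite ler_wpM2r ?sqr_ge0.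
Qed.

(** The product of two commuting positive operators is positive.  After
    scaling, [0 <= a <= 1]; with [A_0 = a] and [A_(k+1) = A_k - A_k^2] one has
    [0 <= A_k <= 1] and [a = A_0^2 + ... + A_(n-1)^2 + A_n], where [A_n x]
    comes arbitrarily close to [0]; each [A_k b A_k] is positive. *)
Lemma pos_mul a b : pos a -> pos b -> a * b = b * a -> pos (a * b).
Proof.
move=> pa pb ab; split=> [|x]; first by rewrite adjM (pos_sa pa) (pos_sa pb).
pose m := on a + 1; have m0 : 0 < m by rewrite ltr_wpDl ?on_ge0.
pose A := fix A n : bop HH := if n is n'.+1 then A n' - A n' * A n' else (m^-1)%:C *: a.
have m1 : 0 <= m^-1 by rewrite invr_ge0 ltW.
have hA n : [/\ pos (A n), pos (1 - A n) & A n * b = b * A n].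
  elim: n => [|n [p1 p2 cb]] /=.
    split; first exact: posZ.
      have -> : 1 - (m^-1)%:C *: a = (m^-1)%:C *: (m%:C *: Ib - a).
        by rewrite scalerBr scalerA -rmorphM mulVf ?gt_eqF // scale1r.
      by apply: posZ => //; apply: pos_norm_sub; [exact: pos_sa|rewrite lerDl].
    by rewrite bscaleAl bscaleAr ab.
  set B := A n in p1 p2 cb *; have sB := pos_sa p1.
  have sC : adj (1 - B) = 1 - B by rewrite adjB adj1 sB.
  split.
  - have -> : B - B * B = adj B * (1 - B) * B + adj (1 - B) * B * (1 - B).
      by rewrite sB sC; ncring_in (bop HH).
    by apply: posD; exact: pos_conj.
  - by rewrite opprB addrCA addrC; apply: posD => //; apply: pos_sqr.
  - by rewrite mulrBl mulrBr cb -mulrA cb !mulrA cb.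
have dec n y z : rip (A 0 y) z = \sum_(k < n) rip (A k y) (A k z) + rip (A n y) z.
  elim: n => [|n IH]; first by rewrite big_ord0 add0r.
  rewrite IH big_ord_recr -addrA; congr (_ + _).
  have [p1 _ _] := hA n; rewrite (_ : A n.+1 = A n - A n * A n) //.
  by rewrite !bE ripBl [rip (A n (A n y)) z]rip_adj (pos_sa p1) addrC subrK.
have small (e : R) : 0 < e -> exists n, nr (A n x) ^+ 2 < e.
  move=> e0; apply: contrapT => h.
  have h' n : e <= nr (A n x) ^+ 2 by rewrite leNgt; apply/negP => g; apply: h; exists n.
  have [N] : exists N : nat, rip (A 0 x) x < N%:R * e.
    exists (Num.truncn (rip (A 0 x) x / e)).+1; rewrite -ltr_pdivrMr //.
    exact: truncnS_gt.
  rewrite (dec N) ltNge => /negP; apply.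
  apply: ler_wpDr; first by case: (hA N) => [[]].
  rewrite mulr_natl -[N in _ *+ N]card_ord -sumr_const; apply: ler_sum => k _.
  by rewrite rip_nr.
have key : 0 <= rip (A 0 (b x)) x.
  rewrite leNgt; apply/negP => neg.
  have c0 : 0 < nr (b x) + 1 by rewrite ltr_wpDl ?nr_ge0.
  have [|n hn] := small ((- rip (A 0 (b x)) x / (nr (b x) + 1)) ^+ 2).
    by rewrite exprn_gt0 // divr_gt0 // oppr_gt0.
  have hn' : nr (A n x) < - rip (A 0 (b x)) x / (nr (b x) + 1).
    by rewrite -(ltr_pXn2r (n := 2)) ?nnegrE ?nr_ge0 // ltW // divr_gt0 // oppr_gt0.
  move: hn'; rewrite ltr_pdivlMr // => hn'.
  have := dec n (b x) x.
  have : 0 <= \sum_(k < n) rip (A k (b x)) (A k x).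
    apply: sumr_ge0 => k _; have [p1 _ cb] := hA k.
    by rewrite -[A k (b x)]/((A k * b) x) cb bME; case: pb.
  have [p1 _ _] := hA n.
  have := rip_CS (b x) (A n x); rewrite -{1}(pos_sa p1) -rip_adj.
  rewrite ler_norml => /andP[e1 e2] e3 e4.
  have := nr_ge0 (A n x); nra.
move: key; rewrite /A bE ripZl pmulr_rge0 ?invr_gt0 //.
Qed.

(** * Real polynomials of an operator *)

Definition pe t (p : {poly R}) : bop HH := \sum_(i < size p) (p`_i)%:C *: t ^+ i.

Lemma pe_wide t (p : {poly R}) n : (size p <= n)%N ->
  pe t p = \sum_(i < n) (p`_i)%:C *: t ^+ i.
Proof.
move=> h; rewrite /pe (big_ord_widen n (fun i => (p`_i)%:C *: t ^+ i) h).
rewrite big_mkcond /=; apply: eq_bigr => i _; case: ltnP => // hi.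
by rewrite nth_default // rmorph0 scale0r.
Qed.

Lemma peD t p q : pe t (p + q) = pe t p + pe t q.
Proof.
pose n := maxn (size p) (size q).
rewrite (@pe_wide _ _ n) ?size_polyD // (@pe_wide _ p n) ?leq_maxl //.
rewrite (@pe_wide _ q n) ?leq_maxr // -big_split; apply: eq_bigr => i _ /=.
by rewrite coefD rmorphD scalerDl.
Qed.

Lemma peC t (r : R) : pe t r%:P = r%:C *: Ib.
Proof.
rewrite (@pe_wide _ _ 1) ?size_polyC ?leq_b1 // big_ord1 coefC /= expr0 //.
Qed.

Lemma pe_mulC t (r : R) p : pe t (r%:P * p) = r%:C *: pe t p.
Proof.
rewrite (@pe_wide _ _ (size p)) ?size_Cmul_leq //; last first.
  have [->|r0] := eqVneq r 0; first by rewrite mul0r size_poly0.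
  by rewrite size_Cmul.
by rewrite scaler_sumr; apply: eq_bigr => i _; rewrite coefCM rmorphM scalerA.
Qed.

Lemma pe_mulX t p : pe t (p * 'X) = pe t p * t.
Proof.
rewrite (@pe_wide _ _ (size p).+1); last first.
  by apply: leq_trans (size_polyMleq _ _) _; rewrite size_polyX addn2.
rewrite big_ord_recl coefMX /= rmorph0 scale0r add0r /pe mulr_suml.
by apply: eq_bigr => i _; rewrite coefMX /= bscaleAl /bump /= exprSr.
Qed.

Lemma peM t p q : pe t (p * q) = pe t p * pe t q.
Proof.
elim/poly_ind: q => [|q c IH]; first by rewrite mulr0 /pe size_poly0 big_ord0 mulr0.
rewrite mulrDr mulrA !peD !pe_mulX IH mulrDr mulrA; congr (_ + _).
by rewrite mulrC pe_mulC peC bscaleAr mulr1.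
Qed.

Lemma pe1 t : pe t 1 = 1. Proof. by rewrite -[1]/(1%:P) peC scale1r. Qed.
Lemma peX t : pe t 'X = t. Proof. by rewrite -['X]mul1r pe_mulX pe1 mul1r. Qed.
Lemma peN t p : pe t (- p) = - pe t p.
Proof. by rewrite -mulN1r -polyCN pe_mulC rmorphN1 scaleN1r. Qed.
Lemma peB t p q : pe t (p - q) = pe t p - pe t q. Proof. by rewrite peD peN. Qed.

Lemma pe_comm t p q : pe t p * pe t q = pe t q * pe t p.
Proof. by rewrite -!peM mulrC. Qed.

Lemma pe_commute t b p : b * t = t * b -> b * pe t p = pe t p * b.
Proof.
move=> bt; elim/poly_ind: p => [|p c IH]; first by rewrite /pe size_poly0 big_ord0 mulr0 mul0r.
by rewrite peD pe_mulX peC mulrDr mulrDl mulrA IH -mulrA bt mulrA bscaleAl bscaleAr mulr1 mul1r.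
Qed.

Lemma pe_sa t p : adj t = t -> adj (pe t p) = pe t p.
Proof.
move=> st; elim/poly_ind: p => [|p c IH]; first by rewrite /pe size_poly0 big_ord0 adj0.
rewrite peD adjD peC adjZr adj1 pe_mulX adjM st IH -{1}[t]peX pe_comm peX //.
Qed.

Definition posp t p := pos (pe t p).

Lemma pospD t p q : posp t p -> posp t q -> posp t (p + q).
Proof. by rewrite /posp peD; exact: posD. Qed.
Lemma pospM t p q : posp t p -> posp t q -> posp t (p * q).
Proof. by rewrite /posp peM => pp pq; apply: pos_mul => //; exact: pe_comm. Qed.
Lemma pospC t (r : R) : 0 <= r -> posp t r%:P.
Proof. by rewrite /posp peC => r0; apply: posZ => //; exact: pos1. Qed.
Lemma posp_sqr t p : adj t = t -> posp t (p * p).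
Proof. by move=> st; rewrite /posp peM; apply: pos_sqr; exact: pe_sa. Qed.

(** * Strong limits *)

(** The pointwise limit is linear, and bounded by the common norm bound. *)
Lemma strong_limit (u : nat -> bop HH) (r : R) :
  0 <= r -> (forall n, on (u n) <= r) -> (forall x, hcauchy (fun n => u n x)) ->
  exists s, forall x, hcvg (fun n => u n x) (s x).
Proof.
move=> r0 ur cu; have [f hf] := choice (fun x => hcomplete (cu x)).
have fb x : nr (f x) <= r * nr x.
  apply: (rcvg_le (rcvg_nr (hf x)) (rcvg_const (r * nr x))) => n.
  by apply: le_trans (nr_on _ _) _; rewrite ler_wpM2r ?nr_ge0.
have bf : bddop f.
  split; last by exists r.
  move=> k x y; apply: hcvg_unique (hf _) _.
  have lipk (z z' : HH) : nr (k *: z - k *: z') <= complex.Re `|k| * nr (z - z').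
    by rewrite -scalerBr nrZ.
  move=> e /(hcvgD (hcvg_lip lipk (hf x)) (hf y))[N hN]; exists N => n /hN.
  by rewrite bop_linear.
by exists (Bop (bddopP bf)).
Qed.

Lemma strong_limitM (u v : nat -> bop HH) (r : R) s s' :
  (forall n, on (u n) <= r) -> (forall x, hcvg (fun n => u n x) (s x)) ->
  (forall x, hcvg (fun n => v n x) (s' x)) ->
  forall x, hcvg (fun n => u n (v n x)) (s (s' x)).
Proof.
move=> ur hu hv x e e0.
have r1 : 0 < `|r| + 1 by rewrite ltr_wpDl.
have [N hN] := hv x (e / 2 / (`|r| + 1)) (divr_gt0 (divr_gt0 e0 (ltr0Sn _ 1)) r1).
have [N' hN'] := hu (s' x) (e / 2) (divr_gt0 e0 (ltr0Sn _ 1)).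
exists (maxn N N') => n; rewrite geq_max => /andP[/hN a /hN' b].
rewrite -(subrK (u n (s' x)) (u n (v n x))) -addrA -bopB.
apply: le_lt_trans (nrD _ _) _.
have := nr_on (u n) (v n x - s' x).
move: a; rewrite ltr_pdivlMr // => a.
have := ur n; have := ler_norm r; have := nr_ge0 (v n x - s' x); have := on_ge0 (u n).
nra.
Qed.

End Positive.

Section Sign.
Context {R : realType} {HH : hilbertType R}.
Implicit Types (x y z : HH) (a b c s t : bop HH).
Local Notation Ib := (1 : bop HH).

Lemma mono_cauchy (a : nat -> R) (M : R) :
  {homo a : n m / (n <= m)%N >-> n <= m} -> (forall n, a n <= M) ->
  forall e, 0 < e -> exists N, forall n, (N <= n)%N -> a n - a N < e.
Proof.
move=> ma aM e e0.
have hs : has_sup (range a) by split; [exists (a 0%N); exists 0%N|exists M => _ [n _ <-]].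
have [_ [N _ <-] hN] := sup_adherent e0 hs; exists N => n _.
have : a n <= sup (range a) by apply: ub_le_sup; [case: hs|exists n].
lra.
Qed.

Lemma posp_nat t n : posp t n%:R.
Proof. by rewrite -(polyC_natr R n); apply: pospC. Qed.

Definition half : {poly R} := (2^-1)%:P.
Lemma half2 : half * 2 = 1.
Proof. by rewrite /half -polyC_natr -polyCM mulVf ?pnatr_eq0. Qed.
Lemma posp_half t : posp t half. Proof. by apply: pospC; rewrite invr_ge0. Qed.

Lemma small_eq0 (a c : R) : 0 <= c -> (forall e, 0 < e -> `|a| <= e * c) -> a = 0.
Proof.
move=> c0 h; apply/normr0_eq0/eqP; rewrite eq_le normr_ge0 andbT leNgt.
apply/negP => a0; have c1 : 0 < c + 1 by rewrite ltr_wpDl.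
have := h (`|a| / (2 * (c + 1))) (divr_gt0 a0 (mulr_gt0 (ltr0Sn _ 1) c1)).
rewrite mulrAC ler_pdivlMr ?mulr_gt0 //; nra.
Qed.

Section Iteration.
Variables (t : bop HH) (st : adj t = t).

Let m : R := on t + 1.
Let m0 : 0 < m. Proof. by rewrite ltr_wpDl ?on_ge0. Qed.

(** The iteration [s |-> s (3 - s^2) / 2] increases [s^2] towards [1] and keeps
    signs, so that its strong limit started from [t / m] is [sgn t]. *)
Fixpoint sgnp n : {poly R} :=
  if n is k.+1 then half * (3 * sgnp k - sgnp k * sgnp k * sgnp k)
  else (m^-1)%:P * 'X.

Let u n := pe t (sgnp n).

Lemma sgnpS n : sgnp n.+1 = half * (3 * sgnp n - sgnp n * sgnp n * sgnp n).
Proof. by []. Qed.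

Lemma sgnp_le1 n : posp t (1 - sgnp n * sgnp n).
Proof.
elim: n => [|n IH].
  rewrite /posp /= peB pe1 peM pe_mulC peX.
  have sA : adj ((m^-1)%:C *: t) = (m^-1)%:C *: t by rewrite adjZr st.
  split=> [|x]; first by rewrite adjB adj1 adjM sA.
  rewrite bBE bME ripBl b1E -{1}sA adj_rip !rip_nr subr_ge0.
  rewrite ler_pXn2r ?nnegrE ?nr_ge0 // bZE nrZr ger0_norm ?invr_ge0 ?(ltW m0) //.
  rewrite ler_pdivrMl //; apply: le_trans (nr_on _ _) _.
  by rewrite ler_wpM2r ?nr_ge0 // lerDl.
rewrite sgnpS; move: (sgnp n) IH => p IH.
have -> : 1 - half * (3 * p - p * p * p) * (half * (3 * p - p * p * p)) =
    half * half * ((1 - p * p) * (1 - p * p) * (3 + (1 - p * p))).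
  have e : 1 = half * 2 * (half * 2) by rewrite half2 mulr1.
  rewrite {1}e; ring.
have h := posp_half t; have h3 := posp_nat t 3.
by apply: pospM; [exact: pospM|apply: pospM; [exact: pospM|exact: pospD]].
Qed.

Lemma sgnp_incr n k : (k <= n)%N -> posp t (sgnp n * sgnp n - sgnp k * sgnp k).
Proof.
move=> /subnK <-; elim: (n - k)%N => [|j IH].
  by rewrite add0n subrr /posp -[0]/(0%:P) peC scale0r; exact: pos0.
rewrite addSn sgnpS.
have := sgnp_le1 (j + k); move: (sgnp (j + k)) IH => p IH IH1.
rewrite -(subrK (p * p) (half * _ * _)) -addrA; apply: pospD => //.
have -> : half * (3 * p - p * p * p) * (half * (3 * p - p * p * p)) - p * p =
    half * half * ((p * p) * (1 - p * p) * (4 + (1 - p * p))).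
  have e : p * p = half * 2 * (half * 2) * (p * p) by rewrite half2 !mul1r.
  rewrite [X in _ - X]e; ring.
have h := posp_half t; have h3 := posp_nat t 4.
apply: pospM; first exact: pospM.
by apply: pospM; [apply: pospM => //; exact: posp_sqr|exact: pospD].
Qed.

Lemma sgnp_abs n : posp t (sgnp n * 'X).
Proof.
elim: n => [|n IH] /=.
  rewrite -mulrA; apply: pospM; last exact: posp_sqr.
  by apply: pospC; rewrite invr_ge0 ltW.
have := sgnp_le1 n; move: (sgnp n) IH => p IH IH1.
have -> : half * (3 * p - p * p * p) * 'X = half * ((p * 'X) * (2 + (1 - p * p))) by ring.
have h := posp_half t; have h3 := posp_nat t 2.
by apply: pospM => //; apply: pospM => //; exact: pospD.
Qed.

Lemma sgnp_same n k : (k <= n)%N -> posp t (sgnp n * sgnp k - sgnp k * sgnp k).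
Proof.
move=> /subnK <-; elim: (n - k)%N => [|j IH].
  by rewrite add0n subrr /posp -[0]/(0%:P) peC scale0r; exact: pos0.
rewrite addSn sgnpS.
have := sgnp_le1 (j + k); move: (sgnp (j + k)) IH => p IH IH1.
move: (sgnp k) IH => q IH.
have -> : half * (3 * p - p * p * p) * q - q * q =
    (p * q - q * q) + half * (((p * q - q * q) + q * q) * (1 - p * p)).
  transitivity (half * 2 * (p * q) - q * q + half * (p * q * (1 - p * p))); first by ring.
  rewrite half2; ring.
have h := posp_half t.
apply: pospD => //; apply: pospM => //; apply: pospM => //; apply: pospD => //.
exact: posp_sqr.
Qed.

Lemma u_sa n : adj (u n) = u n. Proof. exact: pe_sa. Qed.

Lemma rip_uu n x : rip (pe t (sgnp n * sgnp n) x) x = nr (u n x) ^+ 2.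
Proof. by rewrite peM -/(u n) bME -{1}(u_sa n) adj_rip rip_nr. Qed.

Lemma u_le1 n x : nr (u n x) <= nr x.
Proof.
rewrite -(ler_pXn2r (n := 2)) ?nnegrE ?nr_ge0 // -rip_uu -(rip_nr x).
by have [_ /(_ x)] := sgnp_le1 n; rewrite peB pe1 bBE ripBl b1E subr_ge0.
Qed.

Lemma u_on n : on (u n) <= 1.
Proof. by apply: on_le => // x; rewrite mul1r u_le1. Qed.

Lemma u_incr n k x : (k <= n)%N -> nr (u k x) ^+ 2 <= nr (u n x) ^+ 2.
Proof.
move=> /sgnp_incr[_ /(_ x)].
by rewrite peB bBE ripBl !rip_uu subr_ge0.
Qed.

Lemma u_dist n k x : (k <= n)%N -> nr (u n x - u k x) ^+ 2 <= nr (u n x) ^+ 2 - nr (u k x) ^+ 2.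
Proof.
move=> /sgnp_same[_ /(_ x)]; rewrite peB bBE ripBl rip_uu peM -/(u n) -/(u k) bME -{1}(u_sa n) adj_rip.
rewrite -!rip_nr ripBl !ripBr !rip_nr (ripC (u k x)); lra.
Qed.

Lemma u_cauchy x : hcauchy (fun n => u n x).
Proof.
move=> e e0.
have [N hN] := @mono_cauchy (fun n => nr (u n x) ^+ 2) (nr x ^+ 2)
  (fun k n kn => u_incr x kn)
  (fun n => ltac:(by rewrite ler_pXn2r ?nnegrE ?nr_ge0 ?u_le1)) (e ^+ 2 / 4)
  ltac:(by rewrite divr_gt0 // exprn_gt0).
have h n : (N <= n)%N -> nr (u n x - u N x) < e / 2.
  move=> /[dup] /hN h /(@u_dist _ _ x) h'.
  rewrite -(ltr_pXn2r (n := 2)) ?nnegrE ?nr_ge0 ?divr_ge0 ?(ltW e0) //.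
  apply: le_lt_trans h' _; rewrite exprMn (_ : 2^-1 ^+ 2 = 4^-1) //.
  by rewrite exprVn; congr _^-1; ring.
exists N => n k /h hn /h hk.
have := nrD (u n x - u N x) (u N x - u k x); rewrite addrA subrK (nrBC (u N x)); lra.
Qed.

Lemma sgnp_X n : exists g, sgnp n = 'X * g.
Proof.
elim: n => [|n [g IH]]; first by exists (m^-1)%:P; rewrite mulrC.
exists (half * (3 * g - sgnp n * sgnp n * g)); rewrite sgnpS {1 4}IH; ring.
Qed.

(** The iterates are bounded and strongly Cauchy, because their squares
    increase.  The limit [s] satisfies [s^3 = s], being a fixed point of the
    iteration.  By the last clause the range of [s^2] lies in the closure of
    that of [t^2], so that [s] vanishes on the kernel of [t]. *)
Lemma sgn_exists : exists s,
  [/\ adj s = s, s * s * s = s, pos (s * t),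
      forall b, b * t = t * b -> b * s = s * b & t * (s * s) = t] /\
  forall x e, 0 < e -> exists z, nr (s (s x) - t (t z)) < e.
Proof.
have [s hs] := strong_limit ler01 u_on u_cauchy.
have hss := strong_limitM u_on hs hs.
have sS : adj s = s.
  symmetry; apply: adj_uniq => x y.
  apply/eqP; rewrite eq_le; apply/andP; split.
    apply: (rcvg_le (rcvg_rip y (hs x)) (rcvg_ripr x (hs y))) => n.
    by rewrite rip_adj u_sa.
  apply: (rcvg_le (rcvg_ripr x (hs y)) (rcvg_rip y (hs x))) => n.
  by rewrite rip_adj u_sa.
have commS b : b * t = t * b -> b * s = s * b.
  move=> bt; apply: bop_ext => x; rewrite !bME.
  have lipb y y' : nr (b y - b y') <= on b * nr (y - y') by rewrite -bopB nr_on.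
  apply: hcvg_unique (hcvg_lip lipb (hs x)) _ => e /(hs (b x))[N hN].
  exists N => n /hN; rewrite -[u n (b x)]/((u n * b) x) -(pe_commute (sgnp n) bt) //.
have s3 : s * s * s = s.
  have hsss x : hcvg (fun n => u n (u n (u n x))) (s (s (s x))).
    exact: (@strong_limitM _ _ u (fun n => u n * u n) 1 s (s * s) u_on hs hss x).
  apply: bop_ext => x; rewrite !bME.
  have lip2 y y' : nr ((2 : R)%:C *: y - (2 : R)%:C *: y') <= 2 * nr (y - y').
    by rewrite -scalerBr nrZr ger0_norm.
  have lip3 y y' : nr ((3 : R)%:C *: y - (3 : R)%:C *: y') <= 3 * nr (y - y').
    by rewrite -scalerBr nrZr ger0_norm.
  have h1 : hcvg (fun n => (2 : R)%:C *: u n.+1 x + u n (u n (u n x)))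
     ((2 : R)%:C *: s x + s (s (s x))).
    apply: hcvgD => //; apply: (hcvg_lip (u := fun n => u n.+1 x) lip2).
    by move=> e /(hs x)[N hN]; exists N => n hn; apply: hN; exact: leqW.
  have h2 := hcvg_lip lip3 (hs x).
  have e : (2 : R)%:C *: s x + s (s (s x)) = (3 : R)%:C *: s x.
    apply: hcvg_unique h1 _ => e /h2[N hN]; exists N => n /hN.
    suff -> : (2 : R)%:C *: u n.+1 x + u n (u n (u n x)) = (3 : R)%:C *: u n x by [].
    rewrite /u sgnpS; move: (sgnp n) => p.
    suff E : (2 : R)%:C *: pe t (half * (3 * p - p * p * p)) + pe t p * (pe t p * pe t p)
        = (3 : R)%:C *: pe t p by exact: (congr1 (fun o : bop HH => o x) E).
    rewrite -pe_mulC -!peM -peD -pe_mulC; congr (pe t _).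
    rewrite polyC_natr polyC_natr mulrA [2 * half]mulrC half2; ring.
  have h3 : (3 : R)%:C = (2 : R)%:C + 1.
    by apply/eqP; rewrite eq_complex /= addr0 eqxx andbT; apply/eqP; ring.
  by move: e; rewrite h3 scalerDl scale1r; exact: addrI.
have tss : t * (s * s) = t.
  have ker y : s y = 0 -> t y = 0.
    move=> sy; have : nr (u 0 y) ^+ 2 <= 0.
      have <- : rip y (s (s y)) = 0 by rewrite sy bop0 rip0r.
      apply: (rcvg_le (rcvg_const _) (rcvg_ripr y (hss y))) => n.
      by rewrite -{1}(u_sa n) -rip_adj rip_nr; apply: u_incr.
    rewrite -[X in X <= _]ger0_norm ?sqr_ge0 // normr_le0 sqrf_eq0 => /eqP/nr_eq0.
    rewrite /u /= pe_mulC peX bZE => /eqP; rewrite scaler_eq0 => /orP[|/eqP //].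
    by rewrite fmorph_eq0 invr_eq0 gt_eqF.
  apply: bop_ext => x; apply/eqP; rewrite bME -subr_eq0 -bopB; apply/eqP; apply: ker.
  by rewrite bopB -!bME mulrA s3 subrr.
have pst : pos (s * t).
  have st' : s * t = t * s by rewrite -commS.
  split=> [|x]; first by rewrite adjM sS st st'.
  apply: (rcvg_le (rcvg_const 0) (rcvg_rip x (hs (t x)))) => n.
  by have [_ /(_ x)] := sgnp_abs n; rewrite peM peX.
exists s; split=> // x e /(hss x)[N hN].
have [g gE] := sgnp_X N; exists (pe t (g * g) x).
rewrite nrBC -[t (t _)]/((t * (t * pe t (g * g))) x) -{1 2}(peX t) -!peM.
have -> : 'X * ('X * (g * g)) = sgnp N * sgnp N by rewrite gE; ring.
by rewrite peM; exact: hN.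
Qed.

End Iteration.

Definition sgn_spec t s :=
  [/\ adj s = s, s * s * s = s, pos (s * t),
      forall b, b * t = t * b -> b * s = s * b & t * (s * s) = t] /\
  forall x e, 0 < e -> exists z, nr (s (s x) - t (t z)) < e.

Definition sgn t : bop HH := xget 0 [set s | sgn_spec t s].

Lemma sgnP t : adj t = t -> sgn_spec t (sgn t).
Proof. by move=> /sgn_exists[s hs]; rewrite /sgn; case: xgetP => [//|/(_ s)]. Qed.

(* the spectral projections of the half-lines and of the kernel *)
Definition neg_proj t : bop HH := (2^-1 : R)%:C *: (sgn t * sgn t - sgn t).
Definition pos_proj t : bop HH := (2^-1 : R)%:C *: (sgn t * sgn t + sgn t).
Definition ker_proj t : bop HH := 1 - sgn t * sgn t.

Definition proj a := adj a = a /\ a * a = a.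

Section Projections.
Variables (t : bop HH) (st : adj t = t).
Let s := sgn t.

Lemma sgn_sa : adj s = s. Proof. by have [[]] := sgnP st. Qed.
Lemma sgn3 : s * s * s = s. Proof. by have [[]] := sgnP st. Qed.
Lemma sgn_abs : pos (s * t). Proof. by have [[]] := sgnP st. Qed.
Lemma sgn_commute b : b * t = t * b -> b * s = s * b.
Proof. by have [[_ _ _ h _] _] := sgnP st; apply: h. Qed.
Lemma mul_sgn2 : t * (s * s) = t. Proof. by have [[]] := sgnP st. Qed.
Lemma sgn_range x e : 0 < e -> exists z, nr (s (s x) - t (t z)) < e.
Proof. by have [_ h] := sgnP st; apply: h. Qed.
Lemma sgn_t : s * t = t * s. Proof. by symmetry; apply: sgn_commute. Qed.
Lemma sgn4 : s * s * (s * s) = s * s. Proof. by rewrite mulrA sgn3. Qed.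

Lemma half_scale a : (2^-1 : R)%:C *: (a + a) = a.
Proof.
rewrite -[X in X + _]scale1r -[X in _ + X]scale1r -scalerDl scalerA.
by rewrite -(rmorph1 (real_complex R)) -rmorphD -rmorphM mulVf ?scale1r ?rmorph1 ?scale1r // pnatr_eq0.
Qed.

Lemma quarter_scale a b c : a * b = c + c ->
  ((2^-1 : R)%:C *: a) * ((2^-1 : R)%:C *: b) = (2^-1 : R)%:C *: c.
Proof. by move=> e; rewrite bscaleAl bscaleAr e half_scale. Qed.

Lemma neg_proj_proj : proj (neg_proj t).
Proof.
split; first by rewrite adjZr adjB adjM sgn_sa.
apply: quarter_scale; rewrite -/s.
transitivity (s * s * (s * s) - s * s * s - s * s * s + s * s); first by ncring_in (bop HH).
by rewrite sgn4 sgn3; ncring_in (bop HH).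
Qed.

Lemma pos_proj_proj : proj (pos_proj t).
Proof.
split; first by rewrite adjZr adjD adjM sgn_sa.
apply: quarter_scale; rewrite -/s.
transitivity (s * s * (s * s) + s * s * s + s * s * s + s * s); first by ncring_in (bop HH).
by rewrite sgn4 sgn3; ncring_in (bop HH).
Qed.

Lemma ker_proj_proj : proj (ker_proj t).
Proof.
split; first by rewrite adjB adj1 adjM sgn_sa.
rewrite /ker_proj -/s.
transitivity (1 - s * s - s * s + s * s * (s * s)); first by ncring_in (bop HH).
by rewrite sgn4; ncring_in (bop HH).
Qed.

Lemma commute_neg b : b * t = t * b -> b * neg_proj t = neg_proj t * b.
Proof.
move=> /sgn_commute bs; rewrite /neg_proj -/s bscaleAl bscaleAr; congr (_ *: _).
by rewrite mulrBr mulrBl mulrA bs -mulrA bs mulrA.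
Qed.
Lemma commute_pos b : b * t = t * b -> b * pos_proj t = pos_proj t * b.
Proof.
move=> /sgn_commute bs; rewrite /pos_proj -/s bscaleAl bscaleAr; congr (_ *: _).
by rewrite mulrDr mulrDl mulrA bs -mulrA bs mulrA.
Qed.

Lemma ker_projE x : t x = 0 <-> ker_proj t x = x.
Proof.
split=> [tx|<-]; last by rewrite -bME /ker_proj -/s mulrBr mulr1 mul_sgn2 subrr.
have sx : s x = 0.
  apply: nr_eq0; apply/eqP; rewrite -sqrf_eq0 -rip_nr -{1}sgn_sa adj_rip.
  rewrite ripC; apply/eqP; apply: (@small_eq0 _ (nr x)); first exact: nr_ge0.
  move=> e e0; have [z hz] := sgn_range x e0.
  rewrite -[s (s x)](subrK (t (t z))) ripDl rip_adj st tx rip0r addr0.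
  by apply: le_trans (rip_CS _ _) _; rewrite ler_wpM2r ?nr_ge0 // ltW.
by rewrite /ker_proj bBE b1E bME -/s sx bop0 subr0.
Qed.

Lemma sgn_neg : s * neg_proj t = - neg_proj t.
Proof.
by rewrite /neg_proj -/s bscaleAr -scalerN mulrBr mulrA sgn3 opprB.
Qed.

Lemma sgn_pos : s * pos_proj t = pos_proj t.
Proof. by rewrite /pos_proj -/s bscaleAr mulrDr mulrA sgn3 addrC. Qed.

Lemma abs_ker y : rip ((s * t) y) y <= 0 -> t y = 0.
Proof.
move=> h; have e : t = s * (s * t) by rewrite sgn_t mulrA sgn_t -mulrA mul_sgn2.
by rewrite {1}e bME (pos_ker sgn_abs h) bop0.
Qed.

(** On the eigenspace of [s] for [-1] the form of [t] is that of [- |t|], and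
    it vanishes only on the kernel of [t], where [s] is zero. *)
Lemma neg_strict y : s y = - y -> 0 <= rip (t y) y -> y = 0.
Proof.
move=> sy h; have ty : t y = 0.
  by apply: abs_ker; rewrite bME -{1}sgn_sa adj_rip -/s sy ripNr oppr_le0.
have := (ker_projE y).1 ty; rewrite /ker_proj bBE b1E bME -/s sy bopN sy opprK subrr.
by move <-.
Qed.

Lemma pos_strict y : s y = y -> rip (t y) y <= 0 -> y = 0.
Proof.
move=> sy h; have ty : t y = 0.
  by apply: abs_ker; rewrite bME -{1}sgn_sa adj_rip -/s sy.
have := (ker_projE y).1 ty; rewrite /ker_proj bBE b1E bME -/s sy sy subrr.
by move <-.
Qed.

Lemma neg_compl y : neg_proj t y = 0 -> 0 <= rip (t y) y.
Proof.
rewrite /neg_proj -/s bZE bBE bME => /eqP; rewrite scaler_eq0 fmorph_eq0 invr_eq0.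
rewrite pnatr_eq0 /= subr_eq0 => /eqP ssy.
rewrite -{1}mul_sgn2 !bME ssy -[t (s y)]bME -sgn_t; exact: sgn_abs.2.
Qed.

Lemma pos_compl y : pos_proj t y = 0 -> rip (t y) y <= 0.
Proof.
rewrite /pos_proj -/s bZE bDE bME => /eqP; rewrite scaler_eq0 fmorph_eq0 invr_eq0.
rewrite pnatr_eq0 /= addr_eq0 => /eqP ssy.
rewrite -{1}mul_sgn2 !bME ssy bopN ripNl oppr_le0 -[t (s y)]bME -sgn_t; exact: sgn_abs.2.
Qed.

(** A commuting projection that splits the form of [t] by sign has to be the
    spectral one: a vector in one range and in the complement of the other
    has a form of both signs. *)
Lemma neg_proj_unique Q : proj Q -> Q * t = t * Q ->
  (forall y, Q y = y -> 0 <= rip (t y) y -> y = 0) ->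
  (forall y, Q y = 0 -> 0 <= rip (t y) y) -> Q = neg_proj t.
Proof.
move=> [sQ QQ] Qt h1 h2; have [sP PP] := neg_proj_proj.
have QP := commute_neg Qt; set P := neg_proj t in sP PP QP *.
have e1 : P * (1 - Q) = 0.
  apply: bop_ext => x; rewrite b0E; apply: neg_strict.
    by rewrite -bME mulrA sgn_neg mulNr bNE.
  apply: h2; rewrite -bME mulrA QP -mulrA mulrBr mulr1 QQ subrr mulr0 //.
have e2 : Q * (1 - P) = 0.
  apply: bop_ext => x; rewrite b0E; apply: h1.
    by rewrite -bME mulrA QQ.
  apply: neg_compl; rewrite -/P -bME mulrA -QP -mulrA mulrBr mulr1 PP subrr mulr0 //.
move: e1 e2; rewrite !mulrBr !mulr1 -QP => /subr0_eq <- /subr0_eq <- //.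
Qed.

Lemma ker_proj_unique Q : proj Q -> (forall y, Q y = y <-> t y = 0) -> Q = ker_proj t.
Proof.
move=> [sQ QQ] h; have [sP PP] := ker_proj_proj; set P := ker_proj t in sP PP *.
have e1 : Q * P = P.
  apply: bop_ext => x; rewrite bME; apply/h/ker_projE.
  by rewrite -/P -bME PP.
have e2 : P * Q = Q.
  apply: bop_ext => x; rewrite bME; apply/ker_projE/h.
  by rewrite -bME QQ.
by rewrite -e2 -sP -sQ -adjM e1.
Qed.

End Projections.
End Sign.

(** * Spectral measures *)

Section ProjectionLimits.
Context {R : realType} {HH : hilbertType R}.
Implicit Types (x y z : HH) (a b c s t : bop HH).

Lemma proj_rip a x : proj a -> rip (a x) x = nr (a x) ^+ 2.
Proof. by move=> [sa aa]; rewrite -{1}aa bME -{1}sa adj_rip rip_nr. Qed.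

Lemma proj_nr a x : proj a -> nr (a x) <= nr x.
Proof.
move=> pa; have [->|n0] := eqVneq (nr (a x)) 0; first exact: nr_ge0.
have np : 0 < nr (a x) by rewrite lt_neqAle eq_sym n0 nr_ge0.
rewrite -(ler_pM2l np) -expr2 -proj_rip //.
exact: le_trans (ler_norm _) (rip_CS _ _).
Qed.

Lemma proj_on a : proj a -> on a <= 1.
Proof. by move=> pa; apply: on_le => // x; rewrite mul1r proj_nr. Qed.

Lemma proj_compl a : proj a -> proj (1 - a).
Proof.
move=> [sa aa]; split; first by rewrite adjB adj1 sa.
transitivity (1 - a - a + a * a); first by ncring_in (bop HH).
by rewrite aa; ncring_in (bop HH).
Qed.

Lemma proj0 : proj (0 : bop HH). Proof. by split; rewrite ?adj0 ?mul0r. Qed.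
Lemma proj1 : proj (1 : bop HH). Proof. by split; rewrite ?adj1 ?mul1r. Qed.

Lemma proj_sub a b : proj a -> proj b -> a * b = a -> proj (b - a).
Proof.
move=> [sa aa] [sb bb] ab; split; first by rewrite adjB sa sb.
have ba : b * a = a by rewrite -sa -sb -adjM ab.
by rewrite mulrBl !mulrBr bb ab ba aa subrr subr0.
Qed.

Lemma sa_quad_eq a b : adj a = a -> adj b = b ->
  (forall x, rip (a x) x = rip (b x) x) -> a = b.
Proof.
move=> sa sb h; apply/eqP; rewrite -subr_eq0; apply/eqP/bop_ext => x; rewrite b0E.
have q0 y : rip ((a - b) y) y = 0 by rewrite bBE ripBl h subrr.
apply: pos_ker; last by rewrite q0.
by split=> [|y]; rewrite ?adjB ?sa ?sb // q0.
Qed.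

(** For increasing projections [nr (Q n x - Q m x)^2] is the difference of
    [nr (Q n x)^2] and [nr (Q m x)^2], and these are bounded by [nr x ^ 2]. *)
Lemma proj_sup (Q : nat -> bop HH) : (forall n, proj (Q n)) ->
  (forall m n, (m <= n)%N -> Q m * Q n = Q m) ->
  exists q, [/\ proj q, forall x, hcvg (fun n => Q n x) (q x),
    forall b, (forall n, b * Q n = Q n * b) -> b * q = q * b & forall n, Q n * q = Q n].
Proof.
move=> pQ incr.
have dist n m x : (m <= n)%N -> nr (Q n x - Q m x) ^+ 2 = nr (Q n x) ^+ 2 - nr (Q m x) ^+ 2.
  move=> mn; have := proj_rip x (proj_sub (pQ m) (pQ n) (incr _ _ mn)).
  by rewrite bBE => <-; rewrite ripBl !proj_rip.
have mono x : {homo (fun n => nr (Q n x) ^+ 2) : n m / (n <= m)%N >-> n <= m}.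
  by move=> n m nm; rewrite -subr_ge0 -dist // sqr_ge0.
have cau x : hcauchy (fun n => Q n x).
  move=> e e0.
  have [N hN] := @mono_cauchy _ (fun n => nr (Q n x) ^+ 2) (nr x ^+ 2) (@mono x)
    (fun n => ltac:(by rewrite ler_pXn2r ?nnegrE ?nr_ge0 ?proj_nr)) (e ^+ 2 / 4)
    ltac:(by rewrite divr_gt0 // exprn_gt0).
  have h n : (N <= n)%N -> nr (Q n x - Q N x) < e / 2.
    move=> /[dup] /hN h /(@dist _ _ x) h'.
    rewrite -(ltr_pXn2r (n := 2)) ?nnegrE ?nr_ge0 ?divr_ge0 ?(ltW e0) //.
    rewrite h'; apply: lt_le_trans h _; rewrite exprMn (_ : 2^-1 ^+ 2 = 4^-1) //.
    by rewrite exprVn; congr _^-1; ring.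
  exists N => n k /h hn /h hk.
  have := nrD (Q n x - Q N x) (Q N x - Q k x); rewrite addrA subrK (nrBC (Q N x)); lra.
have [q hq] := strong_limit ler01 (fun n => proj_on (pQ n)) cau.
have Qq n : Q n * q = Q n.
  apply: bop_ext => x; rewrite bME.
  have lipQ y y' : nr (Q n y - Q n y') <= 1 * nr (y - y').
    by rewrite -bopB mul1r proj_nr.
  apply: hcvg_unique (hcvg_lip lipQ (hq x)) _ => e e0; exists n => k nk.
  by rewrite -[Q n (Q k x)]bME incr // subrr nr0.
have sq : adj q = q.
  symmetry; apply: adj_uniq => x y; apply/eqP; rewrite eq_le; apply/andP; split.
    apply: (rcvg_le (rcvg_rip y (hq x)) (rcvg_ripr x (hq y))) => n.
    by rewrite rip_adj (pQ n).1.
  apply: (rcvg_le (rcvg_ripr x (hq y)) (rcvg_rip y (hq x))) => n.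
  by rewrite rip_adj (pQ n).1.
exists q; split=> //.
  split=> //; apply: bop_ext => x; rewrite bME.
  apply: hcvg_unique (hq (q x)) _ => e /(hq x)[N hN]; exists N => n /hN.
  by rewrite -[Q n (q x)]bME Qq.
move=> b hb; apply: bop_ext => x; rewrite !bME.
have lipb y y' : nr (b y - b y') <= on b * nr (y - y') by rewrite -bopB nr_on.
apply: hcvg_unique (hcvg_lip lipb (hq x)) _ => e /(hq (b x))[N hN].
by exists N => n /hN; rewrite -[Q n (b x)]bME -hb.
Qed.

End ProjectionLimits.

Section Resolution.
Context {R : realType} {HH : hilbertType R}.
Implicit Types (x y z : HH) (a b c s : bop HH) (l m : R).
Local Notation Ib := (1 : bop HH).
Variables (t : bop HH) (st : adj t = t).

Definition shift l : bop HH := t - l%:C *: Ib.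

Lemma shift_sa l : adj (shift l) = shift l.
Proof. by rewrite adjB adjZr adj1 st. Qed.

Lemma rip_shift l x y : rip (shift l x) y = rip (t x) y - l * rip x y.
Proof. by rewrite bBE ripBl bZE ripZl b1E. Qed.

Lemma shift_commute l b : b * t = t * b -> b * shift l = shift l * b.
Proof. by move=> h; rewrite mulrBr mulrBl h bscaleAl bscaleAr mulr1 mul1r. Qed.

(* the resolution of the identity [E_l = 1_(]-oo, l])(t)] *)
Definition spec l : bop HH := 1 - pos_proj (shift l).

Lemma spec_proj l : proj (spec l).
Proof. exact/proj_compl/pos_proj_proj/shift_sa. Qed.

Lemma spec_commute l b : b * t = t * b -> b * spec l = spec l * b.
Proof.
move=> /(shift_commute l) h; rewrite /spec mulrBr mulrBl mulr1 mul1r.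
by rewrite (commute_pos (shift_sa l)).
Qed.

Lemma spec_t l : spec l * t = t * spec l.
Proof. by rewrite spec_commute. Qed.

Lemma spec_comm l m : spec l * spec m = spec m * spec l.
Proof. by rewrite spec_commute // spec_t. Qed.

Lemma spec_le l y : spec l y = y -> rip (t y) y <= l * nr y ^+ 2.
Proof.
move=> e; have p0 : pos_proj (shift l) y = 0.
  by have := e; rewrite /spec bBE b1E => /eqP; rewrite -subr_eq0 addrAC subrr sub0r oppr_eq0 => /eqP.
have := pos_compl (shift_sa l) p0; rewrite rip_shift rip_nr; lra.
Qed.

Lemma spec_gt l y : spec l y = 0 -> rip (t y) y <= l * nr y ^+ 2 -> y = 0.
Proof.
rewrite /spec bBE b1E => /subr0_eq e h; apply: (pos_strict (shift_sa l)).
  by rewrite e -bME (sgn_pos (shift_sa l)).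
by rewrite rip_shift rip_nr; lra.
Qed.

Lemma spec_ge l y : spec l y = 0 -> l * nr y ^+ 2 <= rip (t y) y.
Proof.
move=> e; rewrite leNgt; apply/negP => h.
by move: (h); rewrite (spec_gt e (ltW h)) nr0 expr0n mulr0 bop0 rip0l ltxx.
Qed.

(** On the range of [spec l (1 - spec m)] the form of [t] is at most [l] and
    more than [m >= l], so this range is zero. *)
Lemma spec_mono l m : l <= m -> spec l * spec m = spec l.
Proof.
move=> lm; have [_ ll] := spec_proj l; have [_ mm] := spec_proj m.
suff : spec l * (1 - spec m) = 0 by rewrite mulrBr mulr1 => /subr0_eq <-.
apply: bop_ext => x; rewrite b0E; apply: (@spec_gt m).
  rewrite -bME mulrA -(spec_comm l m) -mulrA mulrBr mulr1 mm subrr mulr0 //.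
have h : spec l ((spec l * (1 - spec m)) x) = (spec l * (1 - spec m)) x.
  by rewrite -bME mulrA ll.
by apply: le_trans (spec_le h) _; rewrite ler_wpM2r // sqr_ge0.
Qed.

Lemma spec_min l m : spec l * spec m = spec (Num.min l m).
Proof.
case: (leP l m) => h; first exact: spec_mono.
by rewrite spec_comm spec_mono // ltW.
Qed.

Lemma spec_lo l : l < - on t -> spec l = 0.
Proof.
move=> h; apply: bop_ext => x; rewrite b0E; set y := spec l x.
have e : spec l y = y by rewrite /y -bME (spec_proj l).2.
have := spec_le e; have := rip_CS (t y) y; have := nr_on t y; have := nr_ge0 y.
rewrite ler_norml => n0 h1 /andP[h2 _] h3; apply: nr_eq0; apply/eqP.
rewrite eq_le n0 andbT leNgt; apply/negP => n1.
have h4 : nr (t y) * nr y <= on t * nr y * nr y by rewrite ler_wpM2r.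
have h5 : (l + on t) * nr y ^+ 2 < 0 by rewrite pmulr_llt0 ?exprn_gt0 //; lra.
by move: h5; rewrite mulrDl expr2 mulrA; lra.
Qed.

Lemma spec_hi l : on t <= l -> spec l = 1.
Proof.
move=> h; apply/eqP; rewrite eq_sym -subr_eq0; apply/eqP/bop_ext => x; rewrite b0E.
apply: (@spec_gt l).
  by rewrite -bME mulrBr mulr1 (spec_proj l).2 subrr.
by apply: le_trans (pos_le_on _ _) _; rewrite ler_wpM2r // sqr_ge0.
Qed.

(** Right continuity: the decreasing projections [spec (l + 1/n)] have a limit,
    on whose range the form of [t] is at most [l]. *)
Lemma spec_right l x (e : R) : 0 < e ->
  exists N : nat, nr (spec (l + N.+1%:R^-1) x) ^+ 2 - nr (spec l x) ^+ 2 < e.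
Proof.
move=> e0; pose r n := l + n.+1%:R^-1.
have lr n : l <= r n by rewrite lerDl invr_ge0.
have rr (i j : nat) : (i <= j)%N -> r j <= r i.
  by move=> ij; rewrite lerD2l lef_pV2 ?posrE // ler_nat.
pose Q n := 1 - spec (r n).
have [q [pq hq _ Qq]] := @proj_sup R HH Q (fun n => proj_compl (spec_proj _))
  ltac:(move=> m n mn; rewrite /Q mulrBl mul1r mulrBr mulr1 spec_comm spec_mono ?rr //;
        by ncring_in (bop HH)).
have sq n : spec (r n) * (1 - q) = 1 - q.
  have -> : spec (r n) = 1 - Q n by rewrite /Q; ncring_in (bop HH).
  by rewrite mulrBl mul1r mulrBr mulr1 Qq subrr subr0.
have sl0 : spec l * (1 - spec l) = 0 by rewrite mulrBr mulr1 (spec_proj l).2 subrr.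
have w0 : (1 - spec l) * (1 - q) = 0.
  apply: bop_ext => y; rewrite b0E; set w := bfun _ y.
  have wn n : spec (r n) w = w.
    have E : spec (r n) * (1 - spec l) = (1 - spec l) * spec (r n).
      by rewrite [in LHS]mulrBr [in RHS]mulrBl mulr1 mul1r spec_comm.
    by rewrite /w -bME mulrA E -mulrA sq.
  apply: (@spec_gt l); first by rewrite /w -bME mulrA sl0 mul0r.
  rewrite leNgt; apply/negP => h.
  have [n0|n1] := eqVneq (nr w) 0.
    by move: h; rewrite n0 (nr_eq0 n0) bop0 rip0l expr0n mulr0 ltxx.
  have n2 : 0 < nr w ^+ 2 by rewrite exprn_even_gt0.
  have [N hN] := @invS_small _ ((rip (t w) w - l * nr w ^+ 2) / nr w ^+ 2)
    ltac:(by rewrite divr_gt0 // subr_gt0).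
  have := hN _ (leqnn N); rewrite ltr_pdivlMr //.
  by have := spec_le (wn N); rewrite /r mulrDl; set X := N.+1%:R^-1; clearbody X; lra.
have qE : q = 1 - spec l.
  have e1 : (1 - q) * (1 - spec l) = 0.
    have := congr1 adj w0.
    by rewrite adjM adj0 (proj_compl pq).1 (proj_compl (spec_proj l)).1.
  have e2 n : Q n * (1 - spec l) = Q n.
    by rewrite /Q mulrBl mul1r mulrBr mulr1 spec_comm spec_mono //; ncring_in (bop HH).
  have e3 : q * (1 - spec l) = q.
    apply: bop_ext => y; rewrite bME; apply: hcvg_unique (hq _) _ => d /(hq y)[N hN].
    by exists N => n /hN; rewrite -[Q n (_ y)]bME e2.
  by rewrite -e3; move: e1; rewrite mulrBl mul1r => /subr0_eq.
have [N hN] := rcvg_ripr x (hq x) e0; exists N.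
have Qx : Q N x = x - spec (r N) x by rewrite /Q bBE.
have qx : q x = x - spec l x by rewrite qE bBE.
have := hN N (leqnn N); rewrite Qx qx !ripBr.
rewrite ![rip x (spec _ x)]ripC !(proj_rip _ (spec_proj _)) ltr_norml => /andP[h _].
move: h; rewrite /r; lra.
Qed.

Definition spec_fun x l : R := rip (spec l x) x.

Lemma spec_fun_nd x : {homo spec_fun x : l m / l <= m}.
Proof.
move=> l m lm; rewrite /spec_fun -subr_ge0 -ripBl -bBE.
rewrite proj_rip ?sqr_ge0 //; apply: proj_sub; try exact: spec_proj; exact: spec_mono.
Qed.

Lemma spec_fun_rc x : right_continuous (spec_fun x).
Proof.
move=> l; apply/cvgrPdist_lt => e e0.
have [N hN] := spec_right l x e0.
near=> m; rewrite ler0_norm; last by rewrite subr_le0; apply: spec_fun_nd.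
rewrite opprB; apply: le_lt_trans hN; rewrite -!proj_rip ?spec_proj //; try exact: spec_proj.
rewrite lerD2r; apply: spec_fun_nd; near: m; apply: nbhs_right_le.
by rewrite ltrDl invr_gt0.
Unshelve. all: by end_near. Qed.

Definition spec_cum x : cumulative R R :=
  HB.pack_for (cumulative R R) (spec_fun x)
    (isCumulative.Build R _ R (spec_fun x) (@spec_fun_nd x) (@spec_fun_rc x)).

Definition smu x : {measure set (measurableTypeR R) -> \bar R} :=
  lebesgue_stieltjes_measure (spec_cum x).

Definition oc l m : bop HH := if l < m then spec m - spec l else 0.

Lemma smu_oc x l m : smu x `]l, m]%classic = (rip (oc l m x) x)%:E.
Proof.
rewrite /smu /= /lebesgue_stieltjes_measure /measure_extension measurable_mu_extE; last exact: is_ocitv.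
rewrite /oc; case: ifPn => lm; last first.
  by rewrite b0E rip0l set_itv_ge ?bnd_simp //; exact: wlength0.
by rewrite bBE ripBl; exact: wlength_itv_bnd (ltW lm).
Qed.

Lemma oc_proj l m : proj (oc l m).
Proof.
rewrite /oc; case: ifPn => lm; last exact: proj0.
by apply: proj_sub; try exact: spec_proj; apply: spec_mono; exact: ltW.
Qed.

Lemma oc_commute l m b : b * t = t * b -> b * oc l m = oc l m * b.
Proof.
move=> bt; rewrite /oc; case: ifPn => _; last by rewrite mulr0 mul0r.
by rewrite [in LHS]mulrBr [in RHS]mulrBl !spec_commute.
Qed.

Lemma oc_mul l m l' m' : oc l m * oc l' m' = oc (Num.max l l') (Num.min m m').
Proof.
rewrite /oc; case: (ltP l m) => lm; last first.
  rewrite mul0r lt_min !gt_max [l < m]ltNge lm //.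
case: (ltP l' m') => lm'; last first.
  by rewrite mulr0 lt_min !gt_max [l' < m']ltNge lm' /= !andbF.
transitivity (spec m * spec m' - spec m * spec l' - spec l * spec m' + spec l * spec l').
  ncring_in (bop HH).
rewrite !spec_min lt_min !gt_max lm lm' /= andbT.
case: (ltP l' m) => h1; case: (ltP l m') => h2 //=.
- case: (leP l l') => h; first by rewrite subrK.
  by rewrite addrAC subrK.
- have -> : Num.min m m' = m' by apply: min_r; exact: le_trans h2 (ltW lm).
  have -> : Num.min l l' = l' by apply: min_r; exact: le_trans (ltW lm') h2.
  by rewrite addrAC subrK subrr.
- have -> : Num.min m m' = m by apply: min_l; exact: le_trans h1 (ltW lm').
  have -> : Num.min l l' = l by apply: min_l; exact: le_trans (ltW lm) h1.
  by rewrite subrr sub0r addNr.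
- by have := lt_le_trans (lt_trans (lt_le_trans lm h1) lm') h2; rewrite ltxx.
Qed.

Lemma oc_comm l m l' m' : oc l m * oc l' m' = oc l' m' * oc l m.
Proof. by rewrite !oc_mul maxC minC. Qed.

Lemma ocI l m l' m' : `]l, m]%classic `&` `]l', m']%classic =
  `]Num.max l l', Num.min m m']%classic :> set R.
Proof.
apply/seteqP; split=> z /=; rewrite !in_itv /= gt_max le_min.
  by move=> [/andP[-> ->] /andP[-> ->]].
by move=> /andP[/andP[-> ->] /andP[-> ->]].
Qed.

Lemma smuT x : smu x setT = (nr x ^+ 2)%:E.
Proof.
pose I (n : nat) : set (measurableTypeR R) := `](- n%:R), n%:R]%classic.
have cv : (smu x \o I) n @[n --> \oo] --> smu x (\bigcup_n I n).
  apply: nondecreasing_cvg_mu.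
  - by move=> n; exact: measurable_itv.
  - by apply: bigcup_measurable => n _; exact: measurable_itv.
  - move=> n k nk; apply/subsetPset => z; rewrite /I /= !in_itv /= => /andP[z1 z2].
    have h : n%:R <= k%:R :> R by rewrite ler_nat.
    by apply/andP; split; [apply: le_lt_trans z1; rewrite lerN2|exact: le_trans h].
have -> : setT = \bigcup_n I n.
  by rewrite -(bigcup_itvT false false).
rewrite -(cvg_lim _ cv) //; apply: lim_near_cst => //.
near=> n; have hn : on t < n%:R.
  near: n; exists (Num.truncn (on t)).+1 => // n /= hn.
  by apply: lt_le_trans (truncnS_gt _) _; rewrite ler_nat.
have n0 : 0 < n%:R :> R by apply: le_lt_trans hn; exact: on_ge0.
rewrite /= smu_oc /oc gtrN // spec_hi ?(ltW hn) // spec_lo ?ltrN2 // subr0 b1E rip_nr //.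
Unshelve. all: by end_near. Qed.

Lemma smu_fin x X : measurable X -> (smu x X < +oo)%E.
Proof.
move=> mX; apply: (@le_lt_trans _ _ (smu x setT)); last by rewrite smuT ltry.
by apply: le_measure => //; rewrite inE.
Qed.

(** Half-open intervals determine the Lebesgue-Stieltjes measure; this is how
    all identities between scalar measures are proved. *)
Lemma smu_unique x (mu : {measure set (measurableTypeR R) -> \bar R}) :
  (forall l m, mu `]l, m]%classic = (rip (oc l m x) x)%:E) ->
  forall X, measurable X -> mu X = smu x X.
Proof.
move=> h X mX; symmetry; apply: lebesgue_stieltjes_measure_unique => // _ [[l m] _ <-].
by rewrite h -smu_oc.
Qed.

(** [q] is the value at [X] of the spectral measure. *)
Definition spec_of (X : set R) (q : bop HH) :=
  [/\ proj q, forall b, b * t = t * b -> b * q = q * b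
    & forall x, smu x X = (rip (q x) x)%:E].

(** Every Borel set has a spectral projection: such sets form a Dynkin class,
    where a disjoint union corresponds to the strong sum of projections that
    are orthogonal because their partial sums stay below [1]. *)
Lemma spec_of_exists (X : set R) : measurable X -> exists q, spec_of X q.
Proof.
move=> mX.
apply: (@dynkin_induction _ (measurableTypeR R) (@ocitv R) (fun X => exists q, spec_of X q)).
- by [].
- move=> _ _ [[l m] _ <-] [[l' m'] _ <-]; exists (Num.max l l', Num.min m m') => //=.
  by rewrite ocI.
- exists 1; split; [exact: proj1|by move=> b _; rewrite mulr1 mul1r|].
  by move=> x; rewrite smuT b1E rip_nr.
- move=> _ [[l m] _ <-]; exists (oc l m); split; [exact: oc_proj|exact: oc_commute|].
  by move=> x; rewrite smu_oc.
- move=> S mS [q [pq cq hq]]; exists (1 - q); split.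
  + exact: proj_compl.
  + by move=> b /cq bq; rewrite mulrBr mulrBl bq mulr1 mul1r.
  + move=> x; have e : smu x (~` S) = (smu x setT - smu x S)%E.
      have := @measureD _ _ _ (smu x) _ _ measurableT mS (smu_fin x measurableT).
      by rewrite setTD setTI.
    by rewrite e smuT hq bBE ripBl b1E rip_nr.
- move=> F mF tF hF; have [q hq] := choice hF.
  have pq n : proj (q n) by case: (hq n).
  have orth i j : i != j -> q i * q j = 0.
    move=> ij; apply: bop_ext => y; rewrite b0E bME; set x := q j y.
    have xx : q j x = x by rewrite /x -bME (pq j).2.
    have h : (smu x (F i) + smu x (F j) <= smu x setT)%E.
      rewrite -measureU //; last by move/trivIsetP : tF; apply.
      by apply: le_measure => //; rewrite inE //; exact: measurableU.
    move: h; have [_ _ ->] := hq i; have [_ _ ->] := hq j.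
    rewrite smuT -EFinD lee_fin !proj_rip // xx gerDr => h.
    by apply: nr_eq0; apply/eqP; rewrite -sqrf_eq0 eq_le h sqr_ge0.
  pose S n := \sum_(i < n) q i.
  have Sq n k : (n <= k)%N -> S n * q k = 0.
    by move=> nk; rewrite /S mulr_suml big1 // => i _; rewrite orth // ltn_eqF // (leq_trans _ nk).
  have SS n : S n.+1 = S n + q n by rewrite /S big_ord_recr.
  have pS n : proj (S n).
    elim: n => [|n [s1 s2]]; first by rewrite /S big_ord0; exact: proj0.
    rewrite SS; have [q1 q2] := pq n; split; first by rewrite adjD s1 q1.
    have qS : q n * S n = 0 by rewrite -s1 -q1 -adjM Sq // adj0.
    by rewrite mulrDl !mulrDr s2 q2 (Sq n n) // qS addr0 add0r.
  have inc (i j : nat) : (i <= j)%N -> S i * S j = S i.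
    move=> /subnK <-; elim: (j - i)%N => [|k IH]; first by rewrite add0n (pS i).2.
    by rewrite addSn SS mulrDr IH Sq ?addr0 // leq_addl.
  have [Q [pQ cvQ cQ _]] := proj_sup pS inc; exists Q; split=> // [b bt|x].
    apply: cQ => n; rewrite /S mulr_sumr mulr_suml; apply: eq_bigr => i _.
    by case: (hq i) => _ -> .
  have mU : measurable (\bigcup_k F k) by apply: bigcup_measurable.
  have := @measure_semi_sigma_additive _ _ _ (smu x) F mF tF mU.
  move=> /cvg_lim <- //; apply: cvg_lim => //.
  have -> : (fun n => \sum_(0 <= i < n) smu x (F i))%E = (fun n => (rip (S n x) x)%:E).
    apply/funext => n; rewrite big_mkord.
    elim: n => [|n IH]; first by rewrite big_ord0 /S big_ord0 b0E rip0l.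
    by rewrite big_ord_recr IH SS bDE ripDl EFinD; case: (hq n) => _ _ ->.
  apply: cvg_EFin; first by near=> n.
  apply/cvgrPdist_lt => e e0; have [N hN] := rcvg_rip x (cvQ x) e0.
  by exists N => // n /= /hN; rewrite distrC.
- exact: mX.
Unshelve. all: by end_near. Qed.

Lemma smu_oc_vec x l m Y : measurable Y -> smu (oc l m x) Y = smu x (Y `&` `]l, m]%classic).
Proof.
move=> mY; symmetry.
have mI : measurable (`]l, m]%classic : set (measurableTypeR R)) by exact: measurable_itv.
apply: (@smu_unique (oc l m x) (mrestr (smu x) mI)) => // l' m'.
apply: (etrans (congr1 (smu x) (ocI l' m' l m))).
rewrite smu_oc -oc_mul; have [sp pp] := oc_proj l m.
by rewrite -[in RHS]adj_rip sp -!bME (oc_comm l m) -mulrA pp.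
Qed.

(** The scalar measure of [q x] is the restriction to [Y] of that of [x]: this
    is checked on half-open intervals, one variable at a time. *)
Lemma smu_spec_vec x q X Y : measurable X -> measurable Y -> spec_of Y q ->
  smu (q x) X = smu x (X `&` Y).
Proof.
move=> mX mY [[sq qq] cq hq]; symmetry.
have mY' : @measurable _ (measurableTypeR R) Y by [].
apply: (@smu_unique (q x) (mrestr (smu x) mY')) => // l m.
apply: (etrans (congr1 (smu x) (setIC _ _))).
apply: (etrans (esym (smu_oc_vec x l m mY'))).
rewrite hq; have [sp pp] := oc_proj l m.
have c : oc l m * q = q * oc l m by apply: cq; rewrite oc_commute.
rewrite -[in LHS]adj_rip sp -[in RHS]adj_rip sq -!bME c -mulrA pp.
by rewrite -mulrA c mulrA qq.
Qed.

Lemma spec_of_inter X Y p q r : measurable X -> measurable Y ->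
  spec_of X p -> spec_of Y q -> spec_of (X `&` Y) r -> r = p * q.
Proof.
move=> mX mY hX hY [[sr _] _ hr].
have [[sp _] cp ep] := hX; have [[sq qq] cq _] := hY.
have c : p * q = q * p by apply: cq; rewrite cp.
apply: sa_quad_eq => //; first by rewrite adjM sp sq c.
move=> x; apply: EFin_inj; rewrite -hr -(smu_spec_vec x mX mY hY) ep.
by rewrite -[in LHS]adj_rip sq -!bME -c -mulrA qq.
Qed.

(** * The weak integral formula *)

Lemma smu_integrable x X : measurable X -> (exists m : R, forall z : R, X z -> `|z| <= m) ->
  (smu x).-integrable X (fun z : R => z%:E).
Proof.
move=> mX [m hm]; apply: (@measurable_bounded_integrable _ _ _ (smu x)) => //.
- exact: smu_fin.
- by exists m; split; [exact: num_real|move=> k mk z /hm; move/le_trans; apply; exact: ltW].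
Qed.

(** The increments of [D] are of second order with respect to those of the
    monotone [G], so that a fine subdivision makes their sum arbitrarily
    small. *)
Lemma real_increments (D G : R -> R) (a b : R) : a <= b ->
  (forall l m : R, a <= l -> l <= m -> m <= b -> `|D m - D l| <= (m - l) * (G m - G l)) ->
  D a = D b.
Proof.
move=> ab h; apply/eqP; rewrite -subr_eq0 -oppr_eq0 opprB; apply/eqP.
apply: (@small_eq0 _ _ (`|(b - a) * (G b - G a)|)) => // e e0.
have [N hN] := invS_small e0.
pose r (k : nat) := a + k%:R * ((b - a) / N.+1%:R).
have d0 : 0 <= (b - a) / N.+1%:R by rewrite divr_ge0 ?subr_ge0.
have rN : r N.+1 = b by rewrite /r mulrC divfK ?pnatr_eq0 // addrC subrK.
have rm : {homo r : i j / (i <= j)%N >-> i <= j}.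
  by move=> i j ij; rewrite lerD2l ler_wpM2r // ler_nat.
have ra : r 0%N = a by rewrite /r mul0r addr0.
have key k : (k <= N.+1)%N -> `|D (r k) - D a| <= (b - a) / N.+1%:R * (G (r k) - G a).
  elim: k => [|k IH] kN; first by rewrite ra !subrr normr0 mulr0.
  have {IH} := IH (ltnW kN).
  have a1 : a <= r k by rewrite -ra rm.
  have b1 : r k.+1 <= b by rewrite -rN rm.
  have := h _ _ a1 (rm _ _ (leqnSn k)) b1.
  have -> : r k.+1 - r k = (b - a) / N.+1%:R by rewrite /r -natr1; ring.
  move=> h1 h2.
  rewrite -(subrK (D (r k)) (D (r k.+1))) -addrA; apply: le_trans (ler_normD _ _) _.
  by rewrite (le_trans (lerD h1 h2)) // -mulrDr subrKA.
have := key _ (leqnn _); rewrite rN => h1; apply: le_trans h1 _.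
rewrite mulrAC mulrC; set X := (b - a) * _.
apply: (@le_trans _ _ (N.+1%:R^-1 * `|X|)).
  by rewrite ler_wpM2l ?invr_ge0 // ler_norm.
by rewrite ler_wpM2r // ltW // hN.
Qed.

Lemma int_oc_bounds x l m : l <= m ->
  l * rip (oc l m x) x <= \int[smu x]_(z in `]l, m]%classic) z <= m * rip (oc l m x) x.
Proof.
move=> lm; have mI : @measurable _ (measurableTypeR R) `]l, m]%classic by exact: measurable_itv.
have bI (z : R) : `]l, m]%classic z -> `|z| <= `|l| + `|m|.
  rewrite /= in_itv /= => /andP[h1 h2]; rewrite ler_norml.
  have := ler_norm m; have := ler_norm (- l); rewrite normrN.
  have := normr_ge0 l; have := normr_ge0 m; move=> a b c d; apply/andP; split; lra.
have ic (k : R) : (smu x).-integrable `]l, m]%classic (EFin \o cst k).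
  apply: measurable_bounded_integrable => //; first exact: smu_fin.
  by exists `|k|; split; [exact: num_real|move=> k' kk z _; exact: ltW].
have ii : (smu x).-integrable `]l, m]%classic (EFin \o (fun z : R => z)).
  by apply: smu_integrable => //; exists (`|l| + `|m|).
have e k : k * rip (oc l m x) x = \int[smu x]_(z in `]l, m]%classic) cst k z.
  by rewrite /cst Rintegral_cst // smu_oc.
rewrite !e; apply/andP; split; apply: le_Rintegral => // z /=; rewrite in_itv /= => /andP[h1 h2] //.
exact: ltW.
Qed.

(** Both [\int_(]-m, l]) z] and [rip (t (spec l x)) x] increase over [(l, k]]
    by an amount between [l] and [k] times the mass of the interval, so
    [real_increments] applies to their difference. *)
Lemma smu_mean x :
  (smu x).-integrable setT (fun z : R => z%:E) /\ \int[smu x]_z z = rip (t x) x.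
Proof.
pose m := on t + 1; have m0 : 0 < m by rewrite ltr_wpDl ?on_ge0.
have tm : on t <= m by rewrite lerDl.
have mm : - m < m by lra.
have mI (a b : R) : @measurable _ (measurableTypeR R) `]a, b]%classic by exact: measurable_itv.
have mE : oc (- m) m = 1.
  rewrite /oc mm spec_hi // spec_lo ?subr0 // ltrN2 /m; lra.
have z0 : smu x (~` `]- m, m]%classic) = 0%E.
  have e1 : smu x (~` `]- m, m]%classic) = (smu x setT - smu x `](- m)%R, m]%classic)%E.
    have := @measureD _ _ _ (smu x) _ _ measurableT (mI (- m) m) (smu_fin x measurableT).
    by rewrite setTD setTI.
  by rewrite e1 smuT smu_oc mE b1E rip_nr subee.
have bI (z : R) : `]- m, m]%classic z -> `|z| <= m.
  by rewrite /= in_itv /= => /andP[h1 h2]; rewrite ler_norml (ltW h1) h2.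
have ii (a b : R) : (smu x).-integrable `]a, b]%classic (fun z : R => z%:E).
  apply: smu_integrable => //; exists (`|a| + `|b|) => z.
  rewrite /= in_itv /= => /andP[h1 h2]; rewrite ler_norml.
  have := ler_norm b; have := ler_norm (- a); rewrite normrN.
  have := normr_ge0 a; have := normr_ge0 b; move=> a1 b1 c1 d1; apply/andP; split; lra.
have iT : (smu x).-integrable setT (fun z : R => z%:E).
  apply/(@negligible_integrable _ _ _ (smu x) setT (~` `]- m, m]%classic)) => //.
  - exact: measurableC.
  - exact: EFin_measurable.
  - by rewrite setDE setCK setTI.
split=> //.
have -> : \int[smu x]_z z = \int[smu x]_(z in `]- m, m]%classic) z.
  rewrite /Rintegral (@negligible_integral _ _ _ (smu x) setT (~` `]- m, m]%classic)) //.
    by rewrite setDE setCK setTI.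
  exact: measurableC.
pose D l := \int[smu x]_(z in `]- m, l]%classic) z - rip (t (spec l x)) x.
suff : D (- m) = D m.
  have s0 : spec (- m) = 0 by rewrite spec_lo // ltrN2 /m; lra.
  rewrite /D set_itv_ge ?bnd_simp ?ltxx // Rintegral_set0 s0 (spec_hi tm) b0E bop0 rip0l b1E; lra.
apply: (@real_increments D (spec_fun x)) => [|l k ml lk km]; first exact: ltW.
have [->|nlk] := eqVneq l k; first by rewrite !subrr normr0 mul0r.
have lk' : l < k by rewrite lt_neqAle nlk lk.
have eI : \int[smu x]_(z in `]- m, k]%classic) z =
    \int[smu x]_(z in `]- m, l]%classic) z + \int[smu x]_(z in `]l, k]%classic) z.
  rewrite -Rintegral_setU //; last first.
  - apply/disj_setPS => z [] /=; rewrite !in_itv /= => /andP[_ h1] /andP[h2 _].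
    by move: (lt_le_trans h2 h1); rewrite ltxx.
  - by rewrite -itv_bndbnd_setU ?bnd_simp //; exact: ii.
  by rewrite -itv_bndbnd_setU ?bnd_simp.
have /andP[] := int_oc_bounds x lk.
have ocE : oc l k = spec k - spec l by rewrite /oc lk'.
have eS : rip (oc l k x) x = spec_fun x k - spec_fun x l by rewrite ocE bBE ripBl.
set w := oc l k x; have [sp pp] := oc_proj l k.
have wE : rip (t (spec k x)) x - rip (t (spec l x)) x = rip (t w) w.
  rewrite -ripBl -bopB -bBE -ocE -/w.
  have -> : t w = oc l k (t w).
    have c : t * oc l k = oc l k * t by apply: oc_commute.
    have c' : t * oc l k = oc l k * (t * oc l k) by rewrite c mulrA pp.
    exact: (congr1 (fun o : bop HH => o x) c').
  transitivity (rip (oc l k (oc l k (t w))) x); first by rewrite -[in RHS]bME pp.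
  by rewrite -{1}sp adj_rip.
have w1 : rip (t w) w <= k * nr w ^+ 2.
  apply: spec_le; rewrite /w -bME ocE mulrBr (spec_proj k).2 spec_comm spec_mono ?lk //.
have w2 : l * nr w ^+ 2 <= rip (t w) w.
  by apply: spec_ge; rewrite /w -bME ocE mulrBr (spec_proj l).2 spec_mono ?lk // subrr.
have wn : nr w ^+ 2 = rip w x by rewrite proj_rip //; exact: oc_proj.
move: w1 w2; rewrite wn -/w in eS *; rewrite eS -wE /D eI => w1 w2 h1 h2.
rewrite ler_norml; apply/andP; split; lra.
Qed.

Definition spec_choice (X : set R) : HH -> HH :=
  bfun (xget (0 : bop HH) [set q | spec_of X q]).

Lemma spec_choiceP X : measurable X -> exists2 q : bop HH, spec_choice X = q & spec_of X q.
Proof.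
move=> mX; have [q hq] := spec_of_exists mX.
exists (xget (0 : bop HH) [set q | spec_of X q]) => //.
by case: xgetP => [//|/(_ q)].
Qed.

Lemma orthogonal_projectionE (q : bop HH) : orthogonal_projection q <-> proj q.
Proof.
split=> [[_ h1 h2]|[h1 h2]]; first by split; apply: bop_inj => //; rewrite -adjointE.
split; [exact: bopP|by rewrite adjointE h1|by rewrite -[RHS]/(bfun q) -{3}h2].
Qed.

Lemma spectral_exists : exists E, is_spectral_measure t E.
Proof.
exists spec_choice; split.
- by move=> X /spec_choiceP[q -> [pq _ _]]; apply/orthogonal_projectionE.
- have [q -> [pq _ hq]] := spec_choiceP (@measurableT _ R).
  suff -> : q = 1 by [].
  apply: sa_quad_eq; [exact: pq.1|exact: adj1|move=> x].
  by apply: EFin_inj; rewrite -hq b1E rip_nr; exact: smuT.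
- move=> X Y mX mY; have [p -> hp] := spec_choiceP mX; have [q -> hq] := spec_choiceP mY.
  have [r -> hr] := spec_choiceP (measurableI _ _ mX mY).
  by rewrite (spec_of_inter mX mY hp hq hr).
- move=> x; exists (smu x); have [h1 h2] := smu_mean x; split=> //.
    by move=> X mX; have [q -> [_ _ hq]] := spec_choiceP mX; rewrite hq.
  rewrite h2 innerE; congr (_ +i* _); rewrite rip_adj st.
  have e : rip ('i *: x) (t x) = rip x (t ('i *: x)) by rewrite ripC rip_adj st.
  by have := rip_i x (t x); rewrite -bopZ e; lra.
Qed.

End Resolution.

(** * Uniqueness on the negative half-line and at the origin *)

Section Uniqueness.
Context {R : realType} {HH : hilbertType R}.
Implicit Types (x y z : HH) (a b c s : bop HH).
Variables (t : bop HH) (st : adj t = t) (E : set R -> HH -> HH).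
Hypothesis hE : is_spectral_measure t E.

Lemma spectral_proj X : measurable X -> exists2 q : bop HH, E X = q & proj q.
Proof.
case: hE => h _ _ _ mX; have [bq h1 h2] := h X mX.
exists (Bop bq) => //; apply/orthogonal_projectionE; split => //.
Qed.

Lemma spectral_scalar x : exists mu : {measure set (measurableTypeR R) -> \bar R},
  [/\ forall X, measurable X -> mu X = (nr (E X x) ^+ 2)%:E,
     mu.-integrable setT (fun z : R => z%:E) & rip (t x) x = \int[mu]_z z].
Proof.
case: hE => _ _ _ /(_ x)[mu [h1 h2 h3]]; exists mu; split=> //.
  move=> X mX; rewrite h1 //; have [q -> pq] := spectral_proj mX.
  by rewrite -proj_rip.
by rewrite /rip h3.
Qed.

Lemma spectral_inter X Y : measurable X -> measurable Y -> E (X `&` Y) = E X \o E Y.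
Proof. by case: hE => _ _ h _; exact: h. Qed.

Lemma spectral_T : E setT = idfun. Proof. by case: hE. Qed.

Lemma spectral_0 : E set0 = 0.
Proof.
have [q eq pq] := spectral_proj (@measurable0 _ R); rewrite eq.
suff -> : q = 0 by [].
apply: bop_ext => x; rewrite b0E; apply: nr_eq0; apply/eqP.
have [mu [h1 _ _]] := spectral_scalar x.
have := h1 _ (@measurable0 _ R); rewrite eq => e.
have : mu set0 = (nr (q x) ^+ 2)%:E by exact: e.
by rewrite measure0 => -[] /esym /eqP; rewrite sqrf_eq0.
Qed.

Lemma spectral_C X (q q' : bop HH) : measurable X -> E X = q -> E (~` X) = q' -> q' = 1 - q.
Proof.
move=> mX eq eq'; have mC : measurable (~` X) by exact: measurableC.
have [p ep pq] := spectral_proj mX; have := ep; rewrite eq => /bop_inj ?; subst p.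
have [p ep' pq'] := spectral_proj mC; have := ep'; rewrite eq' => /bop_inj ?; subst p.
apply: sa_quad_eq; [exact: pq'.1|exact: (proj_compl pq).1|move=> x].
have [mu [h1 _ _]] := spectral_scalar x.
have mT : mu setT = (nr x ^+ 2)%:E by have := h1 _ (@measurableT _ R); rewrite spectral_T.
have := @measureU _ _ _ mu X (~` X) mX mC (setICr X).
rewrite setUCr => e.
have {}e : mu setT = (mu X + mu (~` X))%E by exact: e.
move: e; rewrite mT !h1 // eq eq' -EFinD => -[].
by rewrite bBE ripBl b1E rip_nr !proj_rip //; lra.
Qed.

(** [E (~` X) x = E (~` X) (E X x) = 0], so the scalar measure of [x] is carried
    by [X]. *)
Lemma spectral_int X (q : bop HH) x : measurable X -> E X = q -> q x = x ->
  exists mu : {measure set (measurableTypeR R) -> \bar R},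
  [/\ forall Y, measurable Y -> mu Y = (nr (E Y x) ^+ 2)%:E,
     mu.-integrable X (fun z : R => z%:E), mu (~` X) = 0%E
   & rip (t x) x = \int[mu]_(z in X) z].
Proof.
move=> mX eq qx; have [mu [h1 h2 h3]] := spectral_scalar x.
have mC : measurable (~` X) by exact: measurableC.
have mX' : @measurable _ (measurableTypeR R) X by [].
have mC' : @measurable _ (measurableTypeR R) (~` X) by [].
have z0 : mu (~` X) = 0%E.
  rewrite h1 // -{1}qx; have := spectral_inter mC mX; rewrite setICl spectral_0 eq.
  by move=> /(congr1 (fun f => f x)) /= <-; rewrite nr0 expr0n.
exists mu; split=> //.
  by apply: integrableS h2 => //.
rewrite h3 /Rintegral (@negligible_integral _ _ _ mu setT (~` X)) //.
by rewrite setDE setCK setTI.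
Qed.

Lemma spectral_restrict X (q : bop HH) x (mu : {measure set (measurableTypeR R) -> \bar R}) :
  measurable X -> E X = q -> proj q ->
  (forall Y, measurable Y -> mu Y = (nr (E Y x) ^+ 2)%:E) ->
  rip (t (q x)) (q x) = \int[mu]_(z in X) z.
Proof.
move=> mX eq pq h; have qqx : q (q x) = q x by rewrite -bME pq.2.
have [nu [n1 n2 _ ->]] := spectral_int mX eq qqx.
rewrite /Rintegral; congr fine; apply: eq_measure_integral => A mA AX.
rewrite n1 // h // -eq; congr (nr _ ^+ 2)%:E.
rewrite -[E A (E X x)]/((E A \o E X) x) -spectral_inter //.
by rewrite (setIidl AX).
Qed.

(** The form of [t] splits along [E X] and its complement, since the scalar
    measures do; polarization then kills the off-diagonal terms. *)
Lemma spectral_commute X (q : bop HH) : measurable X -> E X = q -> q * t = t * q.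
Proof.
move=> mX eq; have mC : measurable (~` X) by exact: measurableC.
have [q' eq' pq'] := spectral_proj mC; have q'E := spectral_C mX eq eq'.
have [p ep pq] := spectral_proj mX; have := ep; rewrite eq => /bop_inj ?; subst p.
have split x : rip (t x) x = rip (t (q x)) (q x) + rip (t (q' x)) (q' x).
  have [mu [h1 h2 ->]] := spectral_scalar x.
  rewrite (spectral_restrict mX eq pq h1) (spectral_restrict mC eq' pq' h1).
  have mX' : @measurable _ (measurableTypeR R) X by [].
  have mC' : @measurable _ (measurableTypeR R) (~` X) by [].
  rewrite -(@Rintegral_setU _ _ _ mu X (~` X)) //.
  - by rewrite setUCr.
  - by rewrite setUCr.
  - by apply/disj_setPS; rewrite setICr.
have qq' : q * q' = 0 by rewrite q'E mulrBr mulr1 pq.2 subrr.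
have q'q : q' * q = 0 by rewrite q'E mulrBl mul1r pq.2 subrr.
have off x y : rip (t (q x)) (q' y) = 0.
  have e1 : q (q x) = q x by rewrite -bME pq.2.
  have e2 : q' (q' y) = q' y by rewrite -bME pq'.2.
  have e3 : q (q' y) = 0 by rewrite -bME qq'.
  have e4 : q' (q x) = 0 by rewrite -bME q'q.
  have := split (q x + q' y); rewrite !bopD e1 e2 e3 e4 bop0 !add0r !addr0.
  rewrite !ripDl !ripDr [rip (t (q' y)) (q x)]rip_adj st [rip (q' y) _]ripC; lra.
have z : q' * t * q = 0.
  by apply: bop_ext => x; apply: rip_ext => y; rewrite b0E rip0l !bME -{1}pq'.1 adj_rip off.
have e1 : t * q = q * t * q.
  by apply/eqP; rewrite -subr_eq0; apply/eqP; rewrite -z q'E; ncring_in (bop HH).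
have := congr1 adj e1; rewrite !adjM st pq.1 => ->.
by rewrite mulrA -e1.
Qed.

(** The integral of [|z|] over [X] is zero, hence so is the measure of [X],
    which is the squared norm of [y]. *)
Lemma spectral_strict X (q : bop HH) y : measurable X -> E X = q -> q y = y ->
  (forall z : R, X z -> z < 0) \/ (forall z : R, X z -> 0 < z) -> rip (t y) y = 0 -> y = 0.
Proof.
move=> mX eq qy sgnX; have [mu [h1 h2 h3 ->]] := spectral_int mX eq qy => i0.
have mX' : @measurable _ (measurableTypeR R) X by [].
have fi : (\int[mu]_(z in X) z%:E)%E \is a fin_num by exact: integrable_fin_num.
have i1 : (\int[mu]_(z in X) z%:E = 0)%E by rewrite -[LHS]fineK //; congr (_%:E).
have i2 : (\int[mu]_(z in X) `|z%:E| = 0)%E.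
  case: sgnX => sX.
    transitivity (\int[mu]_(z in X) - z%:E)%E.
      by apply: eq_integral => z /set_mem /sX z0; rewrite /= ltr0_norm.
    by rewrite integralN ?i1 ?oppe0 //; apply: integrable_add_def.
  rewrite -[RHS]i1.
  by apply: eq_integral => z /set_mem /sX z0; rewrite /= gtr0_norm.
have mE : measurable_fun X (@EFin R) by exact: EFin_measurable.
have [N [mN N0 hN]] := (@ae_eq_integral_abs _ _ _ mu X mX' EFin mE).1 i2.
have X0 : mu X = 0%E.
  apply: (@subset_measure0 _ _ _ mu X N) => // z Xz; apply: hN => /= /(_ Xz) [].
  by case: sgnX => /(_ z Xz) + e; rewrite e ltxx.
have := h1 X mX'; rewrite X0 eq qy => -[] /esym/eqP; rewrite sqrf_eq0 => /eqP.
exact: nr_eq0.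
Qed.

Lemma spectral_neg : E `]-oo, 0%R[%classic = neg_proj t.
Proof.
have mX : measurable (`]-oo, 0%R[%classic : set R) by exact: measurable_itv.
have [q eq pq] := spectral_proj mX; rewrite eq; congr bfun.
apply: neg_proj_unique => //; first exact: (spectral_commute mX eq).
- move=> y qy ge0; apply: (spectral_strict mX eq qy).
    by left => z; rewrite /= in_itv.
  apply/eqP; rewrite eq_le ge0 andbT.
  have [mu [h1 h2 h3 ->]] := spectral_int mX eq qy.
  rewrite -oppr_ge0 -mulN1r -RintegralZl //; apply: Rintegral_ge0 => z.
  by rewrite /= in_itv /= mulN1r oppr_ge0 => /ltW.
- move=> y qy; have mC := measurableC mX; have [q' eq' pq'] := spectral_proj mC.
  have q'y : q' y = y by rewrite (spectral_C mX eq eq') bBE qy subr0.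
  have [mu [h1 h2 h3 ->]] := spectral_int mC eq' q'y.
  by apply: Rintegral_ge0 => z; rewrite /= in_itv /= => /negP; rewrite -leNgt.
Qed.

(** On the range of [E {0}] the form of [t] is an integral over [{0}], hence
    zero; conversely a vector in the kernel of [t] has no component in the
    ranges of the two open half-lines, by [spectral_strict]. *)
Lemma spectral_ker : E [set 0] = ker_proj t.
Proof.
have mX : measurable ([set 0] : set R) by [].
have [q eq pq] := spectral_proj mX; rewrite eq; congr bfun.
have qt := spectral_commute mX eq.
have qtq : t * q = 0.
  have -> : t * q = q * t * q by rewrite qt -mulrA pq.2.
  apply: sa_quad_eq; [by rewrite !adjM st pq.1 mulrA|exact: adj0|move=> y].
  rewrite b0E rip0l !bME -{1}pq.1 adj_rip.
  have qqy : q (q y) = q y by rewrite -bME pq.2.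
  have [mu [h1 h2 h3 ->]] := spectral_int mX eq qqy.
  have -> : \int[mu]_(z in [set 0]) z = \int[mu]_(z in [set 0]) cst (0 : R) z.
    by apply: eq_Rintegral => z; rewrite inE => ->.
  by rewrite /cst Rintegral_cst // mul0r.
apply: ker_proj_unique => // y; split=> [<-|ty]; first by rewrite -bME qtq.
have van X p : measurable X -> E X = p ->
    (forall z : R, X z -> z < 0) \/ (forall z : R, X z -> 0 < z) -> p y = 0.
  move=> mX' ep s; have [r er [sr rr]] := spectral_proj mX'.
  rewrite -ep er; have rt := spectral_commute mX' er.
  apply: (spectral_strict mX' er _ s); first by rewrite -bME rr.
  by rewrite -!bME -rt bME ty bop0 rip0l.
have [mu [h1 h2 _]] := spectral_scalar y.
have mN : measurable (`]-oo, 0%R[%classic : set R) by exact: measurable_itv.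
have mP : measurable (`]0%R, +oo[%classic : set R) by exact: measurable_itv.
have mC := measurableC mX; have [q' eq' pq'] := spectral_proj mC.
have q'E := spectral_C mX eq eq'.
suff : q' y = 0 by rewrite q'E bBE b1E => /subr0_eq.
have CE : ~` [set 0] = `]-oo, 0%R[%classic `|` `]0%R, +oo[%classic :> set R.
  apply/seteqP; split=> z /=; rewrite !in_itv /= andbT.
    by move=> /eqP; rewrite neq_lt => /orP.
  by move=> [] h e; move: h; rewrite e ltxx.
have := h1 _ mC; rewrite eq' {1}CE.
have d : `]-oo, 0%R[%classic `&` `]0%R, +oo[%classic = set0 :> set R.
  apply/seteqP; split=> z //=; rewrite !in_itv /= andbT => -[a b].
  by move: (lt_trans a b); rewrite ltxx.
have -> : mu (`]-oo, 0%R[%classic `|` `]0%R, +oo[%classic) =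
    (mu `]-oo, 0%R[%classic + mu `]0%R, +oo[%classic)%E by exact: measureU.
rewrite !h1 //.
have -> : E `]-oo, 0%R[%classic y = 0.
  by apply: (van _ _ mN erefl); left => z; rewrite /= in_itv.
have -> : E `]0%R, +oo[%classic y = 0.
  by apply: (van _ _ mP erefl); right => z; rewrite /= in_itv /= andbT.
rewrite nr0 expr0n -EFinD addr0 => -[] /esym/eqP; rewrite sqrf_eq0 => /eqP.
exact: nr_eq0.
Qed.

End Uniqueness.

(** The half-line and the origin are the only Borel sets that enter [Xi], and
    there the values of all spectral measures are functions of the sign. *)
Lemma XiE {R : realType} {HH : hilbertType R} (t : bop HH) : adj t = t ->
  Xi t = neg_proj t + (2^-1 : R[i]) *: ker_proj t :> (HH -> HH).
Proof.
move=> st; have [E0 hE0] := spectral_exists st.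
have hE : is_spectral_measure t (spectral_measure t).
  by rewrite /spectral_measure; case: xgetP => [//|/(_ E0)].
by rewrite /Xi (spectral_neg st hE) (spectral_ker st hE).
Qed.

(** * Integrals of continuous functions on an interval *)

Section Calculus.
Context {R : realType}.
Implicit Types (f g F : R -> R) (a b l m s : R).

(** Continuity and differentiability on a segment, in the [e-d] form in which
    they pass to operator-valued functions. *)
Definition contab a b f := forall l, a <= l <= b -> forall e, 0 < e ->
  exists2 d, 0 < d & forall m, a <= m <= b -> `|m - l| < d -> `|f m - f l| <= e.

Definition derab a b F f := forall l, a <= l <= b -> forall e, 0 < e ->
  exists2 d, 0 < d & forall m, a <= m <= b -> `|m - l| < d ->
    `|F m - F l - f l * (m - l)| <= e * `|m - l|.

Lemma contabE a b f : {within `[a, b], continuous f} <-> contab a b f.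
Proof.
split=> [/subspace_continuousP h l lab e e0|h].
  have := h l; rewrite /= in_itv /= lab => /(_ isT) /cvgrPdist_le /(_ _ e0).
  rewrite /prop_near1 /within /= => -[d /= d0 hd]; exists d => // m mab ml.
  by rewrite distrC; apply: hd; rewrite /= ?in_itv //= distrC.
apply/subspace_continuousP => l /=; rewrite in_itv /= => lab.
apply/cvgrPdist_le => e e0; have [d d0 hd] := h _ lab _ e0.
exists d => //= m /= ml; rewrite in_itv /= => mab.
by rewrite distrC; apply: hd => //; rewrite distrC.
Qed.

Lemma derab_cont a b F f : derab a b F f -> contab a b F.
Proof.
move=> h l lab e e0; have [d d0 hd] := h l lab 1 ltr01.
have c0 : 0 < 1 + `|f l| by rewrite ltr_pwDl.
exists (Num.min d (e / (1 + `|f l|))) => [|m mab].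
  by rewrite lt_min d0 divr_gt0.
rewrite lt_min => /andP[/(hd _ mab) h1]; rewrite ltr_pdivlMr // => h2.
rewrite -(subrK (f l * (m - l)) (F m - F l)); apply: le_trans (ler_normD _ _) _.
rewrite normrM; move: h1 h2; set u := `|m - l|; set v := `|f l|; set w := `|_|.
lra.
Qed.

Lemma sub_contab a b l m f : a <= l -> m <= b -> contab a b f -> contab l m f.
Proof.
move=> al mb h x /andP[lx xm] e e0.
have [|d d0 hd] := h x _ e e0; first by rewrite (le_trans al lx) (le_trans xm mb).
exists d => // y /andP[ly ym]; apply: hd.
by rewrite (le_trans al ly) (le_trans ym mb).
Qed.

Lemma deriv0_const a b F : a <= b -> derab a b F (fun=> 0) -> F a = F b.
Proof.
rewrite le_eqVlt => /predU1P[->//|ab] h.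
have dF x : x \in `]a, b[ -> is_derive x 1 F 0.
  rewrite in_itv /= => /andP[ax xb].
  have xab : a <= x <= b by rewrite !ltW.
  have cv : (h^-1 *: ((F \o pseudometric_normed_Zmodule.shift x) (h *: 1) - F x)
      @[h --> 0^']) --> (0 : R).
    apply/cvgrPdist_le => e e0; have [d d0 hd] := h _ xab _ e0.
    pose r := Num.min d (Num.min (x - a) (b - x)).
    have r0 : 0 < r by rewrite !lt_min d0 !subr_gt0 ax.
    exists r => //= k /=; rewrite sub0r normrN !lt_min => /and3P[k1 k2 k3] k0.
    rewrite sub0r normrN normrM normfV ler_pdivrMl ?normr_gt0 // mulrC.
    have := hd (k + x); rewrite mul0r subr0 addrK scaler1 => hk; apply: hk => //.
    move: k2 k3; rewrite !ltr_norml => /andP[p1 p2] /andP[p3 p4].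
    by apply/andP; split; lra.
  by apply: DeriveDef; [exact: cvgP cv|exact: cvg_lim cv].
have cF : {within `[a, b], continuous F} by apply/contabE; exact: derab_cont h.
have [c _] := MVT ab dF cF; rewrite mul0r => /eqP; rewrite subr_eq0 => /eqP.
by move->.
Qed.

Notation mu := (@lebesgue_measure R).

Definition intab a b f : R := \int[mu]_(z in `[a, b]) f z.

Lemma contab_int a b f : contab a b f -> mu.-integrable `[a, b] (EFin \o f).
Proof.
by move=> /contabE h; apply: continuous_compact_integrable => //; exact: segment_compact.
Qed.

Lemma contabD a b f g : contab a b f -> contab a b g -> contab a b (fun z => f z + g z).
Proof.
move=> hf hg l lab e e0; have e2 : 0 < e / 2 by rewrite divr_gt0.
have [d d0 hd] := hf _ lab _ e2; have [c c0 hc] := hg _ lab _ e2.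
exists (Num.min d c) => [|m mab]; first by rewrite lt_min d0.
rewrite lt_min => /andP[/(hd _ mab) h1 /(hc _ mab) h2].
by rewrite opprD addrACA; apply: le_trans (ler_normD _ _) _; lra.
Qed.

Lemma contabZ a b f k : contab a b f -> contab a b (fun z => k * f z).
Proof.
move=> hf l lab e e0; have k0 : 0 < `|k| + 1 by rewrite ltr_wpDl.
have [d d0 hd] := hf _ lab _ (divr_gt0 e0 k0); exists d => // m mab /(hd _ mab).
rewrite ler_pdivlMr // -mulrBr normrM => h; apply: le_trans h.
by rewrite mulrC ler_wpM2l // lerDl.
Qed.

Lemma contabN a b f : contab a b f -> contab a b (fun z => - f z).
Proof.
by move=> hf l lab e /(hf _ lab)[d d0 hd]; exists d => // m mab /(hd _ mab); rewrite -opprD normrN.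
Qed.

Lemma contabB a b f g : contab a b f -> contab a b g -> contab a b (fun z => f z - g z).
Proof. by move=> hf /contabN; exact: contabD. Qed.

Lemma contab_cst a b k : contab a b (fun=> k).
Proof. by move=> l _ e e0; exists 1 => // m _ _; rewrite subrr normr0 ltW. Qed.

Lemma contab_lip a b f K : (forall l m, a <= l <= b -> a <= m <= b -> `|f m - f l| <= K * `|m - l|) ->
  contab a b f.
Proof.
move=> h l lab e e0; have k0 : 0 < `|K| + 1 by rewrite ltr_wpDl.
exists (e / (`|K| + 1)) => [|m mab]; first by rewrite divr_gt0.
rewrite ltr_pdivlMr // => h1; apply: le_trans (h _ _ lab mab) _.
rewrite mulrC; apply: le_trans (ltW h1); rewrite ler_wpM2l //.
by have := ler_norm K; lra.
Qed.

Lemma contab_ext a b f g : (forall z, a <= z <= b -> f z = g z) -> contab a b f -> contab a b g.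
Proof.
move=> fg hf l lab e /(hf _ lab)[d d0 hd]; exists d => // m mab /(hd _ mab).
by rewrite !fg.
Qed.

Lemma intab_ext a b f g : (forall z, a <= z <= b -> f z = g z) -> intab a b f = intab a b g.
Proof. by move=> h; apply: eq_Rintegral => z; rewrite inE /= in_itv /= => /h. Qed.

Lemma intabB a b f g : contab a b f -> contab a b g ->
  intab a b (fun z => f z - g z) = intab a b f - intab a b g.
Proof. by move=> hf hg; apply: RintegralB => //; exact: contab_int. Qed.

Lemma intabZ a b f k : contab a b f -> intab a b (fun z => k * f z) = k * intab a b f.
Proof. by move=> hf; apply: RintegralZl => //; exact: contab_int. Qed.

Lemma intab_cst a b k : a <= b -> intab a b (fun=> k) = k * (b - a).
Proof.
move=> ab; rewrite /intab Rintegral_cst //; congr (_ * _).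
have := @lebesgue_measure_itv R `[a, b]; rewrite /= lte_fin -EFinB => h.
transitivity (fine (if a < b then (b - a)%:E else 0%E)); first by congr fine; exact: h.
by case: ltgtP ab => // -> _; rewrite subrr.
Qed.

Lemma intab_le a b f g : contab a b f -> contab a b g ->
  (forall z, a <= z <= b -> f z <= g z) -> intab a b f <= intab a b g.
Proof.
move=> hf hg h; apply: le_Rintegral => //; try exact: contab_int.
Qed.

Lemma intab_norm a b f K : a <= b -> contab a b f ->
  (forall z, a <= z <= b -> `|f z| <= K) -> `|intab a b f| <= K * (b - a).
Proof.
move=> ab hf h; rewrite ler_norml -mulNr -!intab_cst //.
apply/andP; split; apply: intab_le => //; try exact: contab_cst.
  by move=> z /h; rewrite ler_norml => /andP[].
by move=> z /h; rewrite ler_norml => /andP[].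
Qed.

Lemma intab_cat a b s f : a <= s -> s <= b -> contab a b f ->
  intab a b f = intab a s f + intab s b f.
Proof.
move=> as_ sb hf; have hi := contab_int hf.
have := @Rintegral_itvB R f (BLeft a) (BRight b) s hi.
rewrite !bnd_simp => /(_ as_ sb) e; rewrite /intab.
rewrite -(@Rintegral_itv_obnd_cbnd R s (BRight b) f); first by rewrite -e addrC subrK.
apply: integrableS hi => // z /=; rewrite !in_itv /= => /andP[h1 ->].
by rewrite (le_trans as_ (ltW h1)).
Qed.

Lemma intab1 a f : intab a a f = 0.
Proof. by rewrite /intab set_itv1 Rintegral_set1. Qed.

(** The fundamental theorem of calculus in both directions. *)
Lemma intab_der a b f : contab a b f -> derab a b (fun s => intab a s f) f.
Proof.
move=> hf; have key l m e d : a <= l <= b -> a <= m <= b ->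
    (forall z, a <= z <= b -> `|z - l| < d -> `|f z - f l| <= e) -> `|m - l| < d ->
    `|intab a m f - intab a l f - f l * (m - l)| <= e * `|m - l|.
  move=> /andP[al lb] /andP[am mb] h ml.
  have H u v : a <= u -> u <= v -> v <= b -> (forall z, u <= z <= v -> `|z - l| < d) ->
      `|intab a v f - intab a u f - f l * (v - u)| <= e * (v - u).
    move=> au uv vb hz.
    have cuv : contab u v f by apply: sub_contab hf.
    rewrite (@intab_cat a v u) //; last by apply: sub_contab hf.
    rewrite [intab a u f + _]addrC addrK -intab_cst // -intabB //; last exact: contab_cst.
    apply: intab_norm => //; first by apply: contabB => //; exact: contab_cst.
    move=> z /andP[uz zv]; apply: h; first by rewrite (le_trans au uz) (le_trans zv vb).
    by apply: hz; rewrite uz.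
  case: (leP l m) => lm.
    rewrite [in X in _ <= X]ger0_norm ?subr_ge0 //; apply: H => // z /andP[lz zm].
    by apply: le_lt_trans ml; rewrite !ger0_norm ?subr_ge0 // lerD2r.
  rewrite -normrN [in X in _ <= X]distrC [in X in _ <= X]gtr0_norm ?subr_gt0 //.
  have -> : - (intab a m f - intab a l f - f l * (m - l)) =
     intab a l f - intab a m f - f l * (l - m) by ring.
  apply: H => //; first exact: ltW.
  move=> z /andP[mz zl]; apply: le_lt_trans ml.
  rewrite ler0_norm ?subr_le0 // ltr0_norm ?subr_lt0 // !opprB.
  by rewrite lerD2l lerN2.
move=> l lab e e0; have [d d0 hd] := hf _ lab _ e0; exists d => // m mab ml.
exact: key ml.
Qed.

Lemma derab_sub a b F G f g : derab a b F f -> derab a b G g ->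
  derab a b (fun z => F z - G z) (fun z => f z - g z).
Proof.
move=> hF hG l lab e e0; have e2 : 0 < e / 2 by rewrite divr_gt0.
have [d d0 hd] := hF _ lab _ e2; have [c c0 hc] := hG _ lab _ e2.
exists (Num.min d c) => [|m mab]; first by rewrite lt_min d0.
rewrite lt_min => /andP[/(hd _ mab) h1 /(hc _ mab) h2].
have -> : F m - G m - (F l - G l) - (f l - g l) * (m - l) =
  (F m - F l - f l * (m - l)) - (G m - G l - g l * (m - l)) by ring.
by apply: le_trans (ler_normB _ _) _; lra.
Qed.

Lemma derab_ext a b F f g : (forall z, a <= z <= b -> f z = g z) ->
  derab a b F f -> derab a b F g.
Proof. by move=> fg h l lab e /(h _ lab)[d d0 hd]; exists d => // m; rewrite -fg //; exact: hd. Qed.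

Lemma derab_unique a b F G f : a <= b -> derab a b F f -> derab a b G f ->
  F b - F a = G b - G a.
Proof.
move=> ab hF hG; have := @deriv0_const a b (fun z => F z - G z) ab.
have h : derab a b (fun z => F z - G z) (fun=> 0).
  by apply: derab_ext (derab_sub hF hG) => z _; rewrite subrr.
by move=> /(_ h); lra.
Qed.

Lemma FTC a b F f : a <= b -> contab a b f -> derab a b F f -> intab a b f = F b - F a.
Proof.
move=> ab hf hF; rewrite -(derab_unique ab (intab_der hf) hF) intab1 subr0 //.
Qed.

Lemma derab_quad a b F f K :
  (forall l m, a <= l <= b -> a <= m <= b -> `|F m - F l - f l * (m - l)| <= K * (m - l) ^+ 2) ->
  derab a b F f.
Proof.
move=> h l lab e e0; have k0 : 0 < `|K| + 1 by rewrite ltr_wpDl.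
exists (e / (`|K| + 1)) => [|m mab]; first by rewrite divr_gt0.
rewrite ltr_pdivlMr // => h1; apply: le_trans (h _ _ lab mab) _.
rewrite -[(m - l) ^+ 2]ger0_norm ?sqr_ge0 // normrX expr2 mulrA ler_wpM2r //.
apply: le_trans (ltW h1); rewrite mulrC ler_wpM2l //.
by have := ler_norm K; lra.
Qed.

(** Green's formula on the unit square, for the one-form with components [p]
    and [q] and with [r = d_t p = d_s q]: differentiation under the integral
    sign shows that both sides have the same derivative.  The derivatives are
    given by second-order estimates with a common constant, which is what the
    resolvent identity provides. *)
Lemma green (q p r : R -> R -> R) (K : R) :
  (forall s l m, 0 <= s <= 1 -> 0 <= l <= 1 -> 0 <= m <= 1 ->
     [/\ `|q m s - q l s - r l s * (m - l)| <= K * (m - l) ^+ 2,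
         `|p s m - p s l - r s l * (m - l)| <= K * (m - l) ^+ 2,
         `|q s m - q s l| <= K * `|m - l|, `|r s m - r s l| <= K * `|m - l|
       & `|r m s - r l s| <= K * `|m - l|]) ->
  intab 0 1 (q 1) - intab 0 1 (q 0) = intab 0 1 (fun s => p s 1 - p s 0).
Proof.
move=> h.
have i0 : 0 <= (0 : R) <= 1 by rewrite lexx ler01.
have i1 : 0 <= (1 : R) <= 1 by rewrite lexx ler01.
have cq s : 0 <= s <= 1 -> contab 0 1 (q s).
  by move=> hs; apply: (@contab_lip _ _ _ K) => l m hl hm; have [] := h s l m hs hl hm.
have cr s : 0 <= s <= 1 -> contab 0 1 (r s).
  by move=> hs; apply: (@contab_lip _ _ _ K) => l m hl hm; have [] := h s l m hs hl hm.
have ip s : 0 <= s <= 1 -> intab 0 1 (r s) = p s 1 - p s 0.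
  move=> hs; apply: FTC; [exact: ler01|exact: cr|].
  by apply: (@derab_quad _ _ _ _ K) => l m hl hm; have [] := h s l m hs hl hm.
have dW : derab 0 1 (fun s => intab 0 1 (q s)) (fun s => p s 1 - p s 0).
  apply: (@derab_quad _ _ _ _ K) => l m hl hm; have c1 := cr l hl; have c2 := contabZ (m - l) c1.
  rewrite -ip // mulrC -intabZ //.
  have c3 := contabB (cq m hm) (cq l hl).
  rewrite -(intabB (cq m hm) (cq l hl)) -(intabB c3 c2).
  rewrite -[X in _ <= X]mulr1 -[X in _ * X](subr0 1).
  apply: intab_norm => //.
    exact: contabB.
  by move=> s hs; rewrite [(m - l) * _]mulrC; have [] := h s l m hs hl hm.
symmetry; apply: (@FTC 0 1 (fun s => intab 0 1 (q s))) => //.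
have cR : contab 0 1 (fun s => p s 1 - p s 0).
  apply: (@contab_ext _ _ (fun s => intab 0 1 (r s))); first by move=> s /ip.
  apply: (@contab_lip _ _ _ K) => l m hl hm; rewrite -intabB; try exact: cr.
  rewrite -[X in _ <= X]mulr1 -[X in _ * X](subr0 1).
  apply: intab_norm => //; first by apply: contabB; exact: cr.
  by move=> s hs; have [] := h s l m hs hl hm.
exact: cR.
Qed.

End Calculus.

(** * Operators of a von Neumann algebra *)

Section Algebra.
Context {R : realType} {HH : hilbertType R}.
Implicit Types (a b c d : bop HH) (t : R).
Variables (M : set (HH -> HH)) (M_vN : von_neumann_algebra M).

Definition inM a : Prop := M a.

Lemma M_bounded A : M A -> bounded_operator A.
Proof. by case: M_vN => _ <- [bA _]. Qed.

Definition inM' b := forall c, inM c -> b * c = c * b.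

(** The bicommutant property in terms of bounded operators, from which all
    closure properties of [M] follow by commutation. *)
Lemma inM_commP a : inM a <-> forall b, inM' b -> a * b = b * a.
Proof.
have [_ MM] := M_vN; split=> [Ma b Mb|h]; first by rewrite Mb.
rewrite /inM -MM; split=> [|B [bB hB]]; first exact: bopP.
have Mb : inM' (Bop bB).
  move=> c Mc; apply: bop_ext => x; rewrite !bME.
  by have := congr1 (fun f => f x) (hB c Mc) => /= ->.
by apply/funext => x; have := congr1 (fun o : bop HH => o x) (h _ Mb); rewrite !bME => /= ->.
Qed.

Lemma inM1 : inM 1. Proof. by apply/inM_commP => b _; rewrite mulr1 mul1r. Qed.
Lemma inM0 : inM 0. Proof. by apply/inM_commP => b _; rewrite mulr0 mul0r. Qed.
Lemma inMM a b : inM a -> inM b -> inM (a * b).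
Proof.
move=> /inM_commP ha /inM_commP hb; apply/inM_commP => c hc.
by rewrite -mulrA hb // mulrA ha // mulrA.
Qed.
Lemma inMD a b : inM a -> inM b -> inM (a + b).
Proof.
move=> /inM_commP ha /inM_commP hb; apply/inM_commP => c hc.
by rewrite mulrDl mulrDr ha // hb.
Qed.
Lemma inMZ k a : inM a -> inM (k *: a).
Proof.
by move=> /inM_commP ha; apply/inM_commP => c hc; rewrite bscaleAl bscaleAr ha.
Qed.
Lemma inMN a : inM a -> inM (- a).
Proof. by rewrite -scaleN1r; exact: inMZ. Qed.
Lemma inMB a b : inM a -> inM b -> inM (a - b).
Proof. by move=> ha /inMN; exact: inMD. Qed.
Lemma inM_adj a : inM a -> inM (adj a).
Proof. by move=> ha; rewrite /inM -adjointE; apply: M_vN.1. Qed.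
Lemma inM_inv a : unitb a -> inM a -> inM (binv a).
Proof.
move=> ua /inM_commP ha; apply/inM_commP => c hc.
by rewrite -[LHS]mulr1 -(mulbV ua) mulrA -[_ * c * a]mulrA -(ha _ hc) !mulrA mulVb // mul1r.
Qed.
Lemma inM_bicomm a c : inM a -> (forall b, b * a = a * b -> b * c = c * b) -> inM c.
Proof.
by move=> /inM_commP ha h; apply/inM_commP => b hb; rewrite h // ha.
Qed.

(** * Real tracial functionals *)

(** The real and the imaginary part of a trace both qualify, so that every
    integral below is a real one. *)
Definition tracial (sg : bop HH -> R) := [/\
  forall a b, inM a -> inM b -> sg (a + b) = sg a + sg b,
  forall (r : R) a, inM a -> sg (r%:C *: a) = r * sg a,
  forall a b, inM a -> inM b -> sg (a * b) = sg (b * a) &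
  forall a, inM a -> `|sg a| <= on a].

Lemma resolvent a b : unitb a -> unitb b -> binv a - binv b = binv a * (b - a) * binv b.
Proof.
move=> ua ub; rewrite mulrBr mulrBl mulVb // mul1r -mulrA mulbV // mulr1 //.
Qed.

Definition seg a b (t : R) : bop HH := a + t%:C *: (b - a).

Lemma seg0 a b : seg a b 0 = a. Proof. by rewrite /seg scale0r addr0. Qed.
Lemma seg1 a b : seg a b 1 = b. Proof. by rewrite /seg scale1r addrC subrK. Qed.
Lemma inM_seg a b t : inM a -> inM b -> inM (seg a b t).
Proof. by move=> ha hb; apply: inMD => //; apply/inMZ/inMB. Qed.
Lemma segB a b l m : seg a b m - seg a b l = (m - l)%:C *: (b - a).
Proof. by rewrite /seg opprD addrACA subrr add0r -scalerBl rmorphB. Qed.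

Section Tracial.
Variables (sg : bop HH -> R) (sgT : tracial sg).

Lemma sgD a b : inM a -> inM b -> sg (a + b) = sg a + sg b. Proof. by case: sgT => h _ _ _; exact: h. Qed.
Lemma sgZ (r : R) a : inM a -> sg (r%:C *: a) = r * sg a. Proof. by case: sgT => _ h _ _; exact: h. Qed.
Lemma sgC a b : inM a -> inM b -> sg (a * b) = sg (b * a). Proof. by case: sgT => _ _ h _; exact: h. Qed.
Lemma sgb a : inM a -> `|sg a| <= on a. Proof. by case: sgT => _ _ _ h; exact: h. Qed.
Lemma sgN a : inM a -> sg (- a) = - sg a.
Proof. by move=> ha; have := sgZ (-1) ha; rewrite rmorphN1 scaleN1r mulN1r. Qed.
Lemma sgB a b : inM a -> inM b -> sg (a - b) = sg a - sg b.
Proof. by move=> ha hb; rewrite sgD ?sgN //; exact: inMN. Qed.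
Lemma sg0 : sg 0 = 0. Proof. by rewrite -(subrr 1) sgB ?subrr //; exact: inM1. Qed.

(** The integral of the logarithmic derivative [sg (dG G^-1)] along the segment
    from [a] to [b]. *)
Definition logint a b : R := intab 0 1 (fun t => sg ((b - a) * binv (seg a b t))).

(** The resolvent identity under [sg], inside arbitrary factors: all difference
    quotients of the integrands reduce to it. *)
Lemma sg_resolvent a b (x y : bop HH) (r : R) d : inM a -> inM b -> inM x -> inM y -> unitb x -> unitb y ->
  y - x = r%:C *: d -> inM d ->
  sg (a * binv y * b) = sg (a * binv x * b) - r * sg (a * binv y * d * binv x * b).
Proof.
move=> ha hb hx hy ux uy e hd.
have ix := inM_inv ux hx; have iy := inM_inv uy hy.
rewrite -sgZ; last by do !apply: inMM.
rewrite -sgB; [congr sg|by do !apply: inMM|by apply: inMZ; do !apply: inMM].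
have := resolvent ux uy; rewrite e => h.
have {}h : binv y = binv x - r%:C *: (binv x * d * binv y).
  by rewrite -bscaleAl -bscaleAr -h opprB addrC subrK.
have e' : x - y = - (r%:C *: d) by rewrite -opprB e.
have h' := resolvent uy ux; rewrite e' in h'.
have {}h' : binv y = binv x - r%:C *: (binv y * d * binv x).
  rewrite -bscaleAl -bscaleAr; apply/eqP; rewrite -subr_eq0 opprB addrCA.
  by rewrite h' mulrN mulNr subrr.
rewrite {1}h' mulrBr mulrBl; congr (_ - _).
by rewrite bscaleAr bscaleAl !mulrA.
Qed.

Lemma logint_cont a b K : inM a -> inM b ->
  (forall t, 0 <= t <= 1 -> unitb (seg a b t) /\ on (binv (seg a b t)) <= K) ->
  contab 0 1 (fun t => sg ((b - a) * binv (seg a b t))).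
Proof.
move=> Ma Mb h; have MD : inM (b - a) by exact: inMB.
have K0 : 0 <= K.
  have i0 : 0 <= (0 : R) <= 1 by rewrite lexx ler01.
  by have [_] := h _ i0; apply: le_trans; exact: on_ge0.
apply: (@contab_lip _ _ _ _ (on (b - a) * K * (on (b - a) * K))) => l m hl hm.
have [ul bl] := h l hl; have [um bm] := h m hm.
have Ml : inM (seg a b l) by exact: inM_seg.
have Mm : inM (seg a b m) by exact: inM_seg.
have := sg_resolvent MD inM1 Ml Mm ul um (segB a b l m) MD; rewrite !mulr1 => ->.
rewrite addrAC subrr sub0r normrN normrM mulrC ler_wpM2r //.
have il := inM_inv ul Ml; have im := inM_inv um Mm.
apply: le_trans (sgb _) _; first by do !apply: inMM.
rewrite -mulrA; apply: le_trans (onM _ _) _; apply: ler_pM; rewrite ?on_ge0 //.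
  by apply: le_trans (onM _ _) _; rewrite ler_wpM2l ?on_ge0.
by apply: le_trans (onM _ _) _; rewrite ler_wpM2l ?on_ge0.
Qed.

Section Triangle.
Variables (a b c : bop HH) (K : R).
Hypotheses (Ma : inM a) (Mb : inM b) (Mc : inM c).
Hypothesis hK : forall s t : R, 0 <= s <= 1 -> 0 <= t <= 1 ->
  unitb (seg a (seg b c t) s) /\ on (binv (seg a (seg b c t) s)) <= K.

Let D := c - b.
Let Y (t : R) := seg b c t - a.
Let Z (s t : R) := seg a (seg b c t) s.
Let U (s t : R) := binv (Z s t).

Let k : R := 1 + K + on D + (on (b - a) + on D).

(* words of length at most 6 in D, Y, U *)
Let wb (n : nat) (w : bop HH) := inM w /\ on w <= k ^+ n.

Let K0 : 0 <= K.
Proof.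
have i0 : 0 <= (0 : R) <= 1 by rewrite lexx ler01.
by have [_] := hK i0 i0; apply: le_trans; exact: on_ge0.
Qed.

Let k1 : 1 <= k.
Proof. by rewrite /k; have := on_ge0 D; have := on_ge0 (b - a); have := K0; lra. Qed.

Let wbM n m v w : wb n v -> wb m w -> wb (n + m) (v * w).
Proof.
move=> [v1 v2] [w1 w2]; split; first exact: inMM.
by apply: le_trans (onM _ _) _; rewrite exprD ler_pM ?on_ge0.
Qed.

Let wbS n v w : wb n v -> wb 1 w -> wb n.+1 (v * w).
Proof. by move=> hv hw; rewrite -addn1; exact: wbM. Qed.

Let wbD : wb 1 D.
Proof.
split; first exact: inMB.
by rewrite expr1 /k; have := on_ge0 D; have := on_ge0 (b - a); have := K0; lra.
Qed.

Let wbY t : 0 <= t <= 1 -> wb 1 (Y t).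
Proof.
move=> /andP[t0 t1]; split; first by apply: inMB => //; exact: inM_seg.
have -> : Y t = (b - a) + t%:C *: D by rewrite /Y /seg addrAC.
apply: le_trans (onD _ _) _; have := onZr t D; rewrite ger0_norm // expr1 /k.
have := on_ge0 D; have := K0.
have : t * on D <= on D by rewrite ler_piMl ?on_ge0.
lra.
Qed.

Let wbU s t : 0 <= s <= 1 -> 0 <= t <= 1 -> wb 1 (U s t).
Proof.
move=> hs ht; have [u1 u2] := hK hs ht; split.
  by apply: inM_inv => //; apply: inM_seg => //; exact: inM_seg.
apply: le_trans u2 _; rewrite expr1 /k.
by have := on_ge0 D; have := on_ge0 (b - a); have := K0; lra.
Qed.

Let wb_sg n w : wb n w -> (n <= 6)%N -> `|sg w| <= k ^+ 6.
Proof.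
move=> [w1 w2] n6; apply: le_trans (sgb w1) (le_trans w2 _).
by rewrite ler_weXn2l.
Qed.

Let inZ s t : inM (Z s t). Proof. by apply: inM_seg => //; exact: inM_seg. Qed.

Let Zs s s' t : Z s' t - Z s t = (s' - s)%:C *: Y t.
Proof. exact: segB. Qed.

Let Zt s t t' : Z s t' - Z s t = ((t' - t) * s)%:C *: D.
Proof.
transitivity (s%:C *: (seg b c t' - seg b c t)); last by rewrite segB scalerA -rmorphM mulrC.
rewrite /Z ![seg a _ _]/seg opprD addrACA subrr add0r -scalerBr; congr (_ *: _).
by rewrite opprB addrA subrK.
Qed.

Let YE l m : Y l + (m - l)%:C *: D = Y m.
Proof. rewrite -(segB b c l m) /Y; ncring_in (bop HH). Qed.

Let mul01 (s x : R) : 0 <= s <= 1 -> `|x| <= k ^+ 6 -> `|s * x| <= k ^+ 6.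
Proof.
move=> /andP[s0 s1] h; rewrite normrM ger0_norm //; apply: le_trans h.
by rewrite ler_piMl.
Qed.

Ltac wbt n := apply: (@wb_sg n) => //; do ?apply: wbS; first [exact: wbD|exact: wbY|exact: wbU].

(** With [Z s t = a + s (b + t (c - b) - a)], a parametrization of the triangle,
    the one-form [sg (dZ Z^-1)] is closed by cyclicity of the trace, and
    [green] turns its integral over the boundary of the square into the sum
    over the three edges, the fourth edge being the single point [a]. *)
Lemma triangle : logint a c = logint a b + logint b c.
Proof.
have i0 : 0 <= (0 : R) <= 1 by rewrite lexx ler01.
have i1 : 0 <= (1 : R) <= 1 by rewrite lexx ler01.
pose q s t := s * sg (D * U s t).
pose p s t := sg (Y t * U s t).
pose r s t := sg (D * U s t) - s * sg (D * U s t * Y t * U s t).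
have := @green R q p r (4 * k ^+ 6).
have res u v (s t s' t' x : R) d : 0 <= s <= 1 -> 0 <= t <= 1 -> 0 <= s' <= 1 -> 0 <= t' <= 1 ->
    inM u -> inM v -> inM d -> Z s' t' - Z s t = x%:C *: d ->
    sg (u * U s' t' * v) = sg (u * U s t * v) - x * sg (u * U s' t' * d * U s t * v).
  move=> hs ht hs' ht' hu hv hd e.
  have [u1 _] := hK hs ht; have [u2 _] := hK hs' ht'.
  exact: sg_resolvent.
have N0 : 0 <= k ^+ 6 by rewrite exprn_ge0 //; have := k1; lra.
have MD : inM D by case: wbD.
have MY t : inM (Y t) by apply: inMB => //; exact: inM_seg.
have MU s t : 0 <= s <= 1 -> 0 <= t <= 1 -> inM (U s t) by move=> hs ht; case: (wbU hs ht).
have M1 := inM1.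
move=> G; have {}G : intab 0 1 (q 1) - intab 0 1 (q 0) = intab 0 1 (fun s => p s 1 - p s 0).
  apply: G => s l m hs hl hm; rewrite /q /p /r.
  have [/andP[s0 s1] /andP[l0 l1] /andP[m0 m1]] := And3 hs hl hm.
  have sq (x : R) : `|x| <= 4 * k ^+ 6 -> `|x * (m - l) ^+ 2| <= 4 * k ^+ 6 * (m - l) ^+ 2.
    by move=> h; rewrite normrM [`|_ ^+ 2|]ger0_norm ?sqr_ge0 // ler_wpM2r ?sqr_ge0.
  have li (x : R) : `|x| <= 4 * k ^+ 6 -> `|x * (m - l)| <= 4 * k ^+ 6 * `|m - l|.
    by move=> h; rewrite normrM ler_wpM2r.
  split.
  - have e1 := res D 1 l s m s (m - l) (Y s) hl hs hm hs MD M1 (MY s) (Zs _ _ _).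
    have e2 := res D (Y s * U l s) l s m s (m - l) (Y s) hl hs hm hs MD (inMM (MY s) (MU _ _ hl hs)) (MY s) (Zs _ _ _).
    rewrite !mulr1 ?mulrA in e1 e2; rewrite e1 e2.
    set A := sg (D * U l s); set B := sg (D * U l s * Y s * U l s); set C := sg _.
    have hB : `|B| <= k ^+ 6.
      by wbt 4%N.
    have hC : `|C| <= k ^+ 6.
      by wbt 6%N.
    have -> : m * (A - (m - l) * (B - (m - l) * C)) - l * A - (A - l * B) * (m - l) =
      (m * C - B) * (m - l) ^+ 2 by ring.
    apply: sq; have := mul01 hm hC; move: hB; rewrite !ler_norml => /andP[b1 b2] /andP[c1 c2].
    apply/andP; split; lra.
  - have eY : sg (Y m * U s m) = sg (Y l * U s m) + (m - l) * sg (D * U s m).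
      have h1 := inMM MD (MU _ _ hs hm); have h2 := inMM (MY l) (MU _ _ hs hm).
      by rewrite -sgZ // -sgD //; [rewrite -bscaleAl -mulrDl YE|exact: inMZ].
    have e1 := res (Y l) 1 s l s m _ _ hs hl hs hm (MY l) M1 MD (Zt _ _ _).
    have e2 := res D 1 s l s m _ _ hs hl hs hm MD M1 MD (Zt _ _ _).
    have MDU := inMM (inMM MD (MU _ _ hs hl)) (MY l).
    have e3 := res (D * U s l * Y l) 1 s l s m _ _ hs hl hs hm MDU M1 MD (Zt _ _ _).
    have e4 : sg (Y l * U s m * D * U s l) = sg (D * U s l * Y l * U s m).
      rewrite -mulrA sgC ?mulrA //; [exact: inMM (MY _) (MU _ _ hs hm)|exact: inMM MD (MU _ _ hs hl)].
    rewrite !mulr1 ?mulrA in e1 e2 e3; rewrite eY e1 e2 e4 e3.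
    set A := sg (D * U s l); set X := sg (D * U s l * Y l * U s l).
    set W := sg (D * U s l * Y l * U s m * D * U s l); set V := sg (D * U s m * D * U s l).
    have hW : `|W| <= k ^+ 6 by wbt 6%N.
    have hV : `|V| <= k ^+ 6 by wbt 4%N.
    rewrite [X in `|X|](_ : _ = (s * (s * W) - s * V) * (m - l) ^+ 2); last by ring.
    have := mul01 hs (mul01 hs hW); have := mul01 hs hV.
    move=> h1 h2; apply: sq; move: h1 h2; rewrite !ler_norml => /andP[b1 b2] /andP[c1 c2].
    apply/andP; split; lra.
  - have e2 := res D 1 s l s m _ _ hs hl hs hm MD M1 MD (Zt _ _ _).
    rewrite !mulr1 in e2; rewrite e2; set V := sg (D * U s m * D * U s l).
    have hV : `|V| <= k ^+ 6 by wbt 4%N.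
    rewrite [X in `|X|](_ : _ = (- (s * (s * V))) * (m - l)); last by ring.
    have h1 := mul01 hs (mul01 hs hV); apply: li; move: h1.
    rewrite !ler_norml => /andP[b1 b2]; apply/andP; split; lra.
  - have e2 := res D 1 s l s m _ _ hs hl hs hm MD M1 MD (Zt _ _ _).
    have MYU := inMM (MY m) (MU _ _ hs hm).
    have e5 := res D (Y m * U s m) s l s m _ _ hs hl hs hm MD MYU MD (Zt _ _ _).
    have MDU := inMM (inMM MD (MU _ _ hs hl)) (MY l).
    have e3 := res (D * U s l * Y l) 1 s l s m _ _ hs hl hs hm MDU M1 MD (Zt _ _ _).
    have e6 : sg (D * U s l * Y m * U s m) = sg (D * U s l * Y l * U s m) + (m - l) * sg (D * U s l * D * U s m).
      have h0 := inMM MD (MU _ _ hs hl); have h1 := inMM (inMM h0 MD) (MU _ _ hs hm).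
      have h2 := inMM (inMM h0 (MY l)) (MU _ _ hs hm).
      rewrite -sgZ // -sgD //; [|exact: inMZ].
      by rewrite -bscaleAl -mulrDl -bscaleAr -mulrDr YE.
    rewrite !mulr1 ?mulrA in e2 e3 e5; rewrite e2 e5 e6 e3.
    set A := sg (D * U s l); set X := sg (D * U s l * Y l * U s l).
    set W := sg (D * U s l * Y l * U s m * D * U s l); set V := sg (D * U s m * D * U s l).
    set P := sg (D * U s m * D * U s l * Y m * U s m); set Q := sg (D * U s l * D * U s m).
    have hW : `|W| <= k ^+ 6 by wbt 6%N.
    have hV : `|V| <= k ^+ 6 by wbt 4%N.
    have hP : `|P| <= k ^+ 6 by wbt 6%N.
    have hQ : `|Q| <= k ^+ 6 by wbt 4%N.
    rewrite [X in `|X|](_ : _ = (- (s * V) + s * (s * P) - s * Q + s * (s * W)) * (m - l)); last by ring.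
    have h1 := mul01 hs (mul01 hs hW); have h2 := mul01 hs hV.
    have h3 := mul01 hs (mul01 hs hP); have h4 := mul01 hs hQ.
    apply: li; move: h1 h2 h3 h4; rewrite !ler_norml => /andP[? ?] /andP[? ?] /andP[? ?] /andP[? ?].
    apply/andP; split; lra.
  - have MYU := inMM (MY s) (MU _ _ hm hs).
    have MDU := inMM (inMM MD (MU _ _ hl hs)) (MY s).
    have e1 := res D 1 l s m s _ _ hl hs hm hs MD M1 (MY s) (Zs _ _ _).
    have e2 := res D (Y s * U m s) l s m s _ _ hl hs hm hs MD MYU (MY s) (Zs _ _ _).
    have e3 := res (D * U l s * Y s) 1 l s m s _ _ hl hs hm hs MDU M1 (MY s) (Zs _ _ _).
    rewrite !mulr1 ?mulrA in e1 e2 e3; rewrite e1 e2 e3.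
    set A := sg (D * U l s); set X := sg (D * U l s * Y s * U l s).
    set B := sg (D * U m s * Y s * U l s).
    set E1 := sg (D * U m s * Y s * U l s * Y s * U m s).
    set E2 := sg (D * U l s * Y s * U m s * Y s * U l s).
    have hX : `|X| <= k ^+ 6 by wbt 4%N.
    have hB : `|B| <= k ^+ 6 by wbt 4%N.
    have h1 : `|E1| <= k ^+ 6 by wbt 6%N.
    have h2 : `|E2| <= k ^+ 6 by wbt 6%N.
    rewrite [X in `|X|](_ : _ = (- B - X + m * E1 + m * E2) * (m - l)); last by ring.
    apply: li; move: hX hB (mul01 hm h1) (mul01 hm h2).
    rewrite !ler_norml => /andP[? ?] /andP[? ?] /andP[? ?] /andP[? ?].
    apply/andP; split; lra.
have q0 : intab 0 1 (q 0) = 0.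
  by rewrite (@intab_ext _ _ _ _ (fun=> 0)) ?intab_cst ?mul0r // => t _; rewrite /q mul0r.
have q1 : intab 0 1 (q 1) = logint b c.
  by apply: intab_ext => t _; rewrite /q mul1r /U /Z seg1.
move: G; rewrite q0 q1 subr0 => ->.
rewrite intabB.
- have -> : intab 0 1 (p^~ 1) = logint a c.
    by apply: intab_ext => t _; rewrite /p /Y /U /Z seg1.
  have -> : intab 0 1 (p^~ 0) = logint a b.
    by apply: intab_ext => t _; rewrite /p /Y /U /Z seg0.
  by rewrite addrC subrK.
- have -> : p^~ 1 = fun t => sg ((c - a) * binv (seg a c t)).
    by apply/funext => t; rewrite /p /Y /U /Z !seg1.
  by apply: logint_cont Ma Mc _ => t ht; have := hK ht i1; rewrite seg1; exact.
- have -> : p^~ 0 = fun t => sg ((b - a) * binv (seg a b t)).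
    by apply/funext => t; rewrite /p /Y /U /Z !seg0.
  by apply: logint_cont Ma Mb _ => t ht; have := hK ht i0; rewrite seg0; exact.
Qed.

End Triangle.
End Tracial.
End Algebra.

(** * Invertible paths and homotopies *)

Section Calculus.
Context {R : realType} {HH : hilbertType R}.
Implicit Types (a b c : bop HH) (g D : R -> bop HH).

Definition contb (u v : R) g := forall l, u <= l <= v -> forall e, 0 < e ->
  exists2 d, 0 < d & forall m, u <= m <= v -> `|m - l| < d -> on (g m - g l) <= e.

Definition derb (u v : R) g D := forall l, u <= l <= v -> forall e, 0 < e ->
  exists2 d, 0 < d & forall m, u <= m <= v -> `|m - l| < d ->
    on (g m - g l - (m - l)%:C *: D l) <= e * `|m - l|.

Lemma sub_contb u v l m g : u <= l -> m <= v -> contb u v g -> contb l m g.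
Proof.
move=> al mb h x /andP[lx xm] e e0.
have [|d d0 hd] := h x _ e e0; first by rewrite (le_trans al lx) (le_trans xm mb).
exists d => // y /andP[ly ym]; apply: hd.
by rewrite (le_trans al ly) (le_trans ym mb).
Qed.

Lemma sub_derb u v l m g D : u <= l -> m <= v -> derb u v g D -> derb l m g D.
Proof.
move=> al mb h x /andP[lx xm] e e0.
have [|d d0 hd] := h x _ e e0; first by rewrite (le_trans al lx) (le_trans xm mb).
exists d => // y /andP[ly ym]; apply: hd.
by rewrite (le_trans al ly) (le_trans ym mb).
Qed.

Lemma derb_cont u v g D : derb u v g D -> contb u v g.
Proof.
move=> h l lab e e0; have [d d0 hd] := h l lab 1 ltr01.
have c0 : 0 < 1 + on (D l) by rewrite ltr_pwDl ?on_ge0.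
exists (Num.min d (e / (1 + on (D l)))) => [|m mab].
  by rewrite lt_min d0 divr_gt0.
rewrite lt_min => /andP[/(hd _ mab) h1]; rewrite ltr_pdivlMr // => h2.
have -> : g m - g l = (g m - g l - (m - l)%:C *: D l) + (m - l)%:C *: D l by rewrite subrK.
apply: le_trans (onD _ _) _; have := onZr (m - l) (D l).
by move: h1 h2; rewrite mulrDr; lra.
Qed.

End Calculus.

Section Paths.
Context {R : realType} {HH : hilbertType R}.
Implicit Types (a b c d o : bop HH) (t : R).
Variables (M : set (HH -> HH)) (M_vN : von_neumann_algebra M).
Variables (sg : bop HH -> R) (sgT : tracial M sg).
Local Notation inM := (inM M).
Local Notation logint := (logint sg).

Lemma logintaa a : logint a a = 0.
Proof.
rewrite /logint (@intab_ext _ _ _ _ (fun=> 0)) ?intab_cst ?mul0r // => t _.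
by rewrite subrr mul0r (sg0 M_vN sgT).
Qed.

(** Near the diagonal [logint a b] is [sg ((b - a) a^-1)] up to second order. *)
Lemma logint_est a b K : inM a -> inM b ->
  (forall t, 0 <= t <= 1 -> unitb (seg a b t) /\ on (binv (seg a b t)) <= K) ->
  `|logint a b - sg ((b - a) * binv a)| <= (K * on (b - a)) ^+ 2.
Proof.
move=> Ma Mb h; have MD : inM (b - a) by exact: inMB.
have i0 : 0 <= (0 : R) <= 1 by rewrite lexx ler01.
have cf := logint_cont M_vN sgT Ma Mb h.
have [u0 b0] := h _ i0; rewrite seg0 in u0 b0.
have -> : logint a b - sg ((b - a) * binv a) =
   intab 0 1 (fun t => sg ((b - a) * binv (seg a b t)) - sg ((b - a) * binv a)).
  by rewrite intabB //; [rewrite intab_cst // subr0 mulr1|exact: contab_cst].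
rewrite -[leRHS]mulr1 -{2}(subr0 1); apply: intab_norm => // [|t ht].
  by apply: contabB => //; exact: contab_cst.
have [ut bt] := h t ht; have Mt : inM (seg a b t) by exact: inM_seg.
have e : seg a b t - a = t%:C *: (b - a) by rewrite -[X in _ - X](seg0 a b) segB subr0.
have := sg_resolvent M_vN sgT MD (inM1 M_vN) Ma Mt u0 ut e MD; rewrite !mulr1 => ->.
rewrite addrAC subrr sub0r normrN normrM.
have [t0 t1] := andP ht; rewrite ger0_norm //.
have n1 := on_ge0 (b - a); have n2 := on_ge0 (binv a); have n3 := on_ge0 (binv (seg a b t)).
have it := inM_inv M_vN ut Mt; have ia := inM_inv M_vN u0 Ma.
apply: (@le_trans _ _ (on ((b - a) * binv (seg a b t) * (b - a) * binv a))).
  apply: (@le_trans _ _ `|sg ((b - a) * binv (seg a b t) * (b - a) * binv a)|).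
    by rewrite ler_piMl.
  by apply: (sgb sgT); do !apply: (inMM M_vN).
rewrite -mulrA expr2; apply: le_trans (onM _ _) _; apply: ler_pM; rewrite ?on_ge0 //.
  by apply: le_trans (onM _ _) _; rewrite mulrC ler_wpM2r.
by apply: le_trans (onM _ _) _; rewrite mulrC ler_wpM2r.
Qed.

(** Balls of invertible elements: a convex set on which inverses are uniformly
    bounded. *)
Definition near_unit o b := inM b /\ 2 * on (binv o) * on (b - o) <= 1.

Lemma near_unitb o b : unitb o -> near_unit o b -> unitb b /\ on (binv b) <= 2 * on (binv o).
Proof. by move=> uo [_]; exact: unit_perturb. Qed.

Lemma near_seg o a b t : near_unit o a -> near_unit o b -> 0 <= t <= 1 -> near_unit o (seg a b t).
Proof.
move=> [Ma ha] [Mb hb] /andP[t0 t1]; split; first exact: inM_seg.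
have -> : seg a b t - o = (1 - t)%:C *: (a - o) + t%:C *: (b - o).
  rewrite /seg rmorphB rmorph1 scalerBl scale1r !scalerBr; ncring_in (bop HH).
have := onD ((1 - t)%:C *: (a - o)) (t%:C *: (b - o)).
have := onZr (1 - t) (a - o); have := onZr t (b - o).
rewrite !ger0_norm ?subr_ge0 //; set k := 2 * _ in ha hb *.
have k0 : 0 <= k by rewrite mulr_ge0 ?on_ge0.
move=> h1 h2 h3.
apply: (@le_trans _ _ (k * ((1 - t) * on (a - o) + t * on (b - o)))).
  by rewrite ler_wpM2l //; lra.
have g1 := ler_wpM2l t0 hb.
have t1' : 0 <= 1 - t by rewrite subr_ge0.
have g2 := ler_wpM2l t1' ha.
by move: g1 g2; rewrite mulrDr; lra.
Qed.

Lemma near_triangle o a b c : unitb o -> near_unit o a -> near_unit o b -> near_unit o c ->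
  logint a c = logint a b + logint b c.
Proof.
move=> uo ha hb hc; apply: (@triangle _ _ _ M_vN _ sgT _ _ _ (2 * on (binv o))).
- by case: ha.
- by case: hb.
- by case: hc.
by move=> s t hs ht; apply: near_unitb => //; apply: near_seg => //; exact: near_seg.
Qed.

Lemma path_cont (g D : R -> bop HH) u v :
  (forall t, u <= t <= v -> unitb (g t)) -> (forall t, u <= t <= v -> inM (g t)) ->
  (forall t, u <= t <= v -> inM (D t)) -> derb u v g D -> contb u v D ->
  contab u v (fun t => sg (D t * binv (g t))).
Proof.
move=> ug Mg MD /derb_cont cg cD.
move=> l hl e e0; have ul := ug l hl; set K := 2 * on (binv (g l)).
have K0 : 0 <= K by rewrite mulr_ge0 ?on_ge0.
have K1 : 0 < K + 1 by rewrite ltr_wpDl.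
have bl : on (binv (g l)) <= K by rewrite /K; have := on_ge0 (binv (g l)); lra.
have Dl0 := on_ge0 (D l); set k1 := on (D l) in Dl0.
have p1 : 0 < (K + 1) * (1 + (k1 + 1) * (K + 1)) by rewrite mulr_gt0 // ltr_wpDr // mulr_ge0 //; lra.
set e' := e / ((K + 1) * (1 + (k1 + 1) * (K + 1))).
have e'0 : 0 < e' by rewrite divr_gt0.
have [d1 d10 h1] := cg l hl e' e'0; have [d2 d20 h2] := cD l hl e' e'0.
have i0 : 0 < (K + 1)^-1 by rewrite invr_gt0.
have [d3 d30 h3] := cg l hl _ i0.
exists (Num.min d1 (Num.min d2 d3)) => [|m hm]; first by rewrite !lt_min d10 d20.
rewrite !lt_min => /and3P[/(h1 _ hm) {}h1 /(h2 _ hm) {}h2 /(h3 _ hm) {}h3].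
have [um bm] : unitb (g m) /\ on (binv (g m)) <= K.
  apply: unit_perturb => //; apply: le_trans (ler_wpM2l K0 h3) _.
  by rewrite ler_pdivrMr // mul1r lerDl.
have im := inM_inv M_vN um (Mg _ hm); have il := inM_inv M_vN ul (Mg _ hl).
have Mm := MD _ hm; have Ml := MD _ hl.
rewrite -(sgB M_vN sgT); [|exact: inMM|exact: inMM].
have -> : D m * binv (g m) - D l * binv (g l) =
    (D m - D l) * binv (g m) + D l * (binv (g m) * (g l - g m) * binv (g l)).
  rewrite -(resolvent um ul); ncring_in (bop HH).
apply: le_trans (sgb sgT _) _.
  by apply: (inMD M_vN); do !apply: (inMM M_vN) => //; apply: inMB => //; exact: Mg.
apply: le_trans (onD _ _) _; apply: le_trans (lerD (onM _ _) (onM _ _)) _.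
have n1 := on_ge0 (D m - D l); have n2 := on_ge0 (g l - g m).
have n3 := on_ge0 (binv (g m)); have n4 := on_ge0 (binv (g l)).
have s1 : on (D m - D l) * on (binv (g m)) <= e' * (K + 1) by apply: ler_pM => //; lra.
have s2 : on (binv (g m) * (g l - g m) * binv (g l)) <= (K + 1) * e' * (K + 1).
  apply: le_trans (onM _ _) _; apply: ler_pM; rewrite ?on_ge0 //; last lra.
  apply: le_trans (onM _ _) _; apply: ler_pM => //; first lra.
  by rewrite onBC.
have s3 : k1 * on (binv (g m) * (g l - g m) * binv (g l)) <= (k1 + 1) * ((K + 1) * e' * (K + 1)).
  by apply: ler_pM; rewrite ?on_ge0 //; lra.
have -> : e = e' * ((K + 1) * (1 + (k1 + 1) * (K + 1))) by rewrite /e' divfK // gt_eqF.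
by apply: le_trans (lerD s1 s3) _; rewrite le_eqVlt; apply/orP; left; apply/eqP; ring.
Qed.

(** Inside a ball the logarithmic derivative of a path has the primitive
    [logint (g u) (g t)]. *)
Lemma near_path o (g D : R -> bop HH) u v : u <= v -> unitb o ->
  (forall t, u <= t <= v -> near_unit o (g t) /\ inM (D t)) ->
  derb u v g D -> contb u v D ->
  contab u v (fun t => sg (D t * binv (g t))) /\
  intab u v (fun t => sg (D t * binv (g t))) = logint (g u) (g v).
Proof.
move=> uv uo hg dg cD; set K := 2 * on (binv o).
have K0 : 0 <= K by rewrite mulr_ge0 ?on_ge0.
have K1 : 0 < K + 1 by rewrite ltr_wpDl.
have Mg t : u <= t <= v -> inM (g t) by move=> /hg[[]].
have MD t : u <= t <= v -> inM (D t) by move=> /hg[].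
have ub t : u <= t <= v -> unitb (g t) /\ on (binv (g t)) <= K.
  by move=> /hg[h _]; exact: near_unitb.
have cf := path_cont (fun t ht => (ub t ht).1) Mg MD dg cD.
split=> //.
have ng t : u <= t <= v -> near_unit o (g t) by move=> /hg[].
have iu : u <= u <= v by rewrite lexx.
have iv : u <= v <= v by rewrite uv lexx.
rewrite (@FTC _ u v (fun t => logint (g u) (g t))) ?logintaa ?subr0 //.
move=> l hl e e0; have [ul bl] := ub l hl.
set k1 := on (D l); have k10 : 0 <= k1 by exact: on_ge0.
have [d1 d10 h1] := dg l hl 1 ltr01.
have [d2 d20 h2] := dg l hl (e / (2 * (K + 1))) (divr_gt0 e0 (mulr_gt0 (ltr0Sn _ _) K1)).
have p2 : 0 < 2 * ((K + 1) * (1 + k1)) ^+ 2 by rewrite mulr_gt0 // exprn_gt0 // mulr_gt0 // ltr_pwDl.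
exists (Num.min d1 (Num.min d2 (e / (2 * ((K + 1) * (1 + k1)) ^+ 2)))) => [|m hm].
  by rewrite !lt_min d10 d20 divr_gt0.
rewrite !lt_min => /and3P[/(h1 _ hm) {}h1 /(h2 _ hm) {}h2]; rewrite ltr_pdivlMr // => h3.
have [um bm] := ub m hm.
have tri := near_triangle uo (ng _ iu) (ng _ hl) (ng _ hm).
rewrite [X in `|X|](_ : _ = logint (g l) (g m) - sg (D l * binv (g l)) * (m - l)); last first.
  by rewrite tri; ring.
have il := inM_inv M_vN ul (Mg _ hl); have Ml := MD _ hl.
have Mlm : inM (g m - g l) by apply: inMB => //; exact: Mg.
have est := @logint_est (g l) (g m) K (Mg _ hl) (Mg _ hm) _.
have {}est : `|logint (g l) (g m) - sg ((g m - g l) * binv (g l))| <= (K * on (g m - g l)) ^+ 2.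
  by apply: est => t ht; apply: near_unitb => //; apply: near_seg => //; exact: ng.
have est2 : `|sg ((g m - g l) * binv (g l)) - sg (D l * binv (g l)) * (m - l)| <= e / 2 * `|m - l|.
  have M1 := inMM M_vN Mlm il; have M2 := inMM M_vN Ml il.
  rewrite [_ * (m - l)]mulrC -(sgZ sgT) // -(sgB M_vN sgT) //; last exact: inMZ.
  rewrite -bscaleAl -mulrBl; apply: le_trans (sgb sgT _) _.
    by apply: (inMM M_vN) => //; apply: (inMB M_vN) => //; exact: inMZ.
  apply: le_trans (onM _ _) _.
  apply: (@le_trans _ _ (e / (2 * (K + 1)) * `|m - l| * (K + 1))).
    by apply: ler_pM; rewrite ?on_ge0 //; lra.
  rewrite le_eqVlt; apply/orP; left; apply/eqP; field.
  by rewrite gt_eqF.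
have est3 : (K * on (g m - g l)) ^+ 2 <= e / 2 * `|m - l|.
  have b1 : on (g m - g l) <= (1 + k1) * `|m - l|.
    have -> : g m - g l = (g m - g l - (m - l)%:C *: D l) + (m - l)%:C *: D l by rewrite subrK.
    apply: le_trans (onD _ _) _; have := onZr (m - l) (D l).
    by move: h1; rewrite /k1; lra.
  apply: (@le_trans _ _ (((K + 1) * ((1 + k1) * `|m - l|)) ^+ 2)).
    rewrite ler_sqr ?nnegrE ?mulr_ge0 ?on_ge0 //; try lra.
    by apply: ler_pM; rewrite ?on_ge0 //; lra.
  rewrite mulrA exprMn [`|_| ^+ 2]expr2 mulrA ler_wpM2r //.
  by rewrite ler_pdivlMr // mulrAC; move: h3; rewrite mulrC => h3; apply: ltW; lra.
have -> : logint (g l) (g m) - sg (D l * binv (g l)) * (m - l) =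
  (logint (g l) (g m) - sg ((g m - g l) * binv (g l))) +
  (sg ((g m - g l) * binv (g l)) - sg (D l * binv (g l)) * (m - l)) by rewrite addrA subrK.
apply: le_trans (ler_normD _ _) _; lra.
Qed.

End Paths.

Section Homotopy.
Context {R : realType} {HH : hilbertType R}.
Variables (M : set (HH -> HH)) (M_vN : von_neumann_algebra M).
Variables (sg : bop HH -> R) (sgT : tracial M sg).
Local Notation inM := (inM M).
Local Notation logint := (logint sg).
Local Notation I01 x := (0 <= (x : R) <= 1).

Variable F : R -> R -> bop HH.
Hypothesis uF : forall s t, I01 s -> I01 t -> unitb (F s t) /\ inM (F s t).
Hypothesis cF : forall s t, I01 s -> I01 t -> forall e, 0 < e ->
  exists2 d, 0 < d & forall s' t', I01 s' -> I01 t' -> `|s' - s| < d -> `|t' - t| < d ->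
    on (F s' t' - F s t) <= e.

(** Compactness of the square: there is a mesh for which each value of [F] has
    a ball of invertibles containing all the neighbouring values. *)
Lemma uniform_near : exists n : nat, forall s t s' t', I01 s -> I01 t -> I01 s' -> I01 t' ->
  `|s' - s| <= n.+1%:R^-1 -> `|t' - t| <= n.+1%:R^-1 -> near_unit M (F s t) (F s' t').
Proof.
have cpt : compact (`[(0:R), 1] `*` `[(0:R), 1]).
  by apply: compact_setX; exact: segment_compact.
pose P (n : nat) (p : R * R) := I01 p.1 -> I01 p.2 -> forall s' t', I01 s' -> I01 t' ->
  `|s' - p.1| <= n.+1%:R^-1 -> `|t' - p.2| <= n.+1%:R^-1 -> near_unit M (F p.1 p.2) (F s' t').
have := (compact_near_coveringP _).1 cpt nat eventually P _.
case=> [[s t] /= []|N _ hN].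
  rewrite !in_itv /= => hs ht; have [u0 M0] := uF hs ht.
  set k := on (binv (F s t)); have k0 : 0 <= k by exact: on_ge0.
  have e0 : 0 < (8 * (k + 1))^-1 by rewrite invr_gt0 mulr_gt0 // ltr_wpDl.
  have [d d0 hd] := cF hs ht e0.
  have [N hN] : exists N : nat, forall n, (N <= n)%N -> n.+1%:R^-1 < d / 2.
    have [N hN] := @invS_small R (d / 2) (divr_gt0 d0 (ltr0Sn _ _)).
    by exists N.
  exists (ball (s, t) (d / 2), [set n | (N <= n)%N]).
    split=> /=; first by apply: nbhsx_ballx; rewrite divr_gt0.
    by exists N.
  move=> [[a b] n] /= [[/= ba bb] nN] ha hb s' t' hs' ht' h1 h2.
  rewrite /ball /= in ba bb.
  have d2 := hN _ nN; rewrite distrC in ba; rewrite distrC in bb.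
  move: h1 h2 d2; rewrite /=; set x := n.+1%:R^-1; clearbody x => h1 h2 d2.
  have c1 : on (F a b - F s t) <= (8 * (k + 1))^-1 by apply: hd => //; lra.
  have c2 : on (F s' t' - F s t) <= (8 * (k + 1))^-1.
    apply: hd => //.
      have := ler_normD (s' - a) (a - s); rewrite addrA subrK; lra.
    have := ler_normD (t' - b) (b - t); rewrite addrA subrK; lra.
  have [u1 b1] : unitb (F a b) /\ on (binv (F a b)) <= 2 * k.
    apply: unit_perturb => //; rewrite -/k.
    apply: le_trans (ler_wpM2l _ c1) _; first by rewrite mulr_ge0.
    by rewrite ler_pdivrMr ?mulr_gt0 ?ltr_wpDl // mul1r; lra.
  split; first by case: (uF hs' ht').
  have c3 : on (F s' t' - F a b) <= 2 * (8 * (k + 1))^-1.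
    have -> : F s' t' - F a b = (F s' t' - F s t) - (F a b - F s t) by rewrite opprB addrA subrK.
    by apply: le_trans (onB _ _) _; lra.
  apply: (@le_trans _ _ (2 * (2 * k) * (2 * (8 * (k + 1))^-1))).
    by apply: ler_pM; rewrite ?mulr_ge0 ?on_ge0 //; lra.
  by rewrite !mulrA ler_pdivrMr ?mulr_gt0 ?ltr_wpDl // mul1r; lra.
exists N => s t s' t' hs ht hs' ht'; apply: (hN N _ (s, t)) => //=.
Qed.

Lemma mesh_unit (n k : nat) : (k <= n.+1)%N -> I01 (k%:R / n.+1%:R).
Proof.
move=> kn; rewrite divr_ge0 ?ler0n //= ler_pdivrMr ?ltr0Sn // mul1r ler_nat //.
Qed.

Lemma mesh_step (n k : nat) : k.+1%:R / n.+1%:R = k%:R / n.+1%:R + n.+1%:R^-1 :> R.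
Proof. by rewrite -[k.+1%:R]natr1 mulrDl mul1r. Qed.

(** Each piece of the path lies in a ball, where [near_path] applies. *)
Lemma mesh_polygon n (g D : R -> bop HH) :
  (forall t t', I01 t -> I01 t' -> `|t' - t| <= n.+1%:R^-1 -> near_unit M (g t) (g t')) ->
  (forall t, I01 t -> unitb (g t)) -> (forall t, I01 t -> inM (D t)) ->
  derb 0 1 g D -> contb 0 1 D ->
  intab 0 1 (fun t => sg (D t * binv (g t))) =
  \sum_(j < n.+1) logint (g (j%:R / n.+1%:R)) (g (j.+1%:R / n.+1%:R)).
Proof.
move=> near ug MD dg cD.
have Mg t : I01 t -> inM (g t).
  by move=> ht; case: (near t t ht ht) => //; rewrite subrr normr0 invr_ge0.
have cf := path_cont M_vN sgT ug Mg MD dg cD.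
suff H k : (k <= n.+1)%N -> intab 0 (k%:R / n.+1%:R) (fun t => sg (D t * binv (g t))) =
    \sum_(j < k) logint (g (j%:R / n.+1%:R)) (g (j.+1%:R / n.+1%:R)).
  by rewrite -H // divff.
elim: k => [|k IH] kn; first by rewrite big_ord0 mul0r intab1.
have hk := mesh_unit (ltnW kn); have hk1 := mesh_unit kn.
have st := mesh_step n k; have n0 : 0 <= n.+1%:R^-1 :> R by rewrite invr_ge0.
rewrite (@intab_cat _ _ _ (k%:R / n.+1%:R)); last first.
- by apply: sub_contab cf => //; case/andP: hk1.
- by rewrite st lerDl.
- by case/andP: hk.
rewrite IH ?(ltnW kn) // big_ord_recr /=; congr (_ + _).
move: st hk hk1; set x := k%:R / _; set y := k.+1%:R / _ => st hk hk1.
have xy : x <= y by rewrite st lerDl.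
have [x0 x1] := andP hk; have [y0 y1] := andP hk1.
have sub t : x <= t <= y -> I01 t by move=> /andP[xt ty]; rewrite (le_trans x0 xt) (le_trans ty y1).
have := @near_path _ _ _ M_vN _ sgT (g x) g D x y xy (ug _ hk) _ (sub_derb x0 y1 dg) (sub_contb x0 y1 cD).
case=> // t ht; split; last exact/MD/sub.
apply: near => //; first exact: sub.
have /andP[xt ty] := ht; rewrite ger0_norm ?subr_ge0 //.
by rewrite lerBlDl -st.
Qed.

Variables g D g' D' : R -> bop HH.
Hypothesis F0 : forall t, I01 t -> F 0 t = g t.
Hypothesis F1 : forall t, I01 t -> F 1 t = g' t.
Hypothesis Fl : forall s, I01 s -> F s 0 = F 0 0.
Hypothesis Fr : forall s, I01 s -> F s 1 = F 0 1.
Hypotheses (MD : forall t, I01 t -> inM (D t)) (MD' : forall t, I01 t -> inM (D' t)).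
Hypotheses (dg : derb 0 1 g D) (cD : contb 0 1 D).
Hypotheses (dg' : derb 0 1 g' D') (cD' : contb 0 1 D').

(** Passing from one row of the mesh to the next changes each edge by two
    triangles; the transversal edges telescope and the outer ones are
    constant. *)
Lemma homotopy_invariance :
  intab 0 1 (fun t => sg (D t * binv (g t))) = intab 0 1 (fun t => sg (D' t * binv (g' t))).
Proof.
have [n hn] := uniform_near.
have i0 : I01 0 by rewrite lexx ler01.
have i1 : I01 1 by rewrite ler01 lexx.
have n0 : 0 <= n.+1%:R^-1 :> R by rewrite invr_ge0.
have d0 (x : R) : `|x - x| <= n.+1%:R^-1 by rewrite subrr normr0.
rewrite (@mesh_polygon n) //; last 2 first.
- by move=> t t' ht ht' h; rewrite -!F0 //; exact: hn.
- by move=> t ht; rewrite -F0 //; case: (uF i0 ht).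
rewrite (@mesh_polygon n) //; last 2 first.
- by move=> t t' ht ht' h; rewrite -!F1 //; exact: hn.
- by move=> t ht; rewrite -F1 //; case: (uF i1 ht).
pose x (k : nat) : R := k%:R / n.+1%:R.
pose row s := \sum_(j < n.+1) logint (F s (x j)) (F s (x j.+1)).
have x0 : x 0%N = 0 by rewrite /x mul0r.
have xn : x n.+1 = 1 by rewrite /x divff.
have st k : `|x k.+1 - x k| <= n.+1%:R^-1.
  by rewrite /x mesh_step addrAC subrr add0r ger0_norm.
have rowE k : (k < n.+1)%N -> row (x k) = row (x k.+1).
  move=> kn; have hk := mesh_unit (ltnW kn); have hk1 := mesh_unit kn.
  suff H j : (j <= n.+1)%N -> \sum_(i < j) logint (F (x k) (x i)) (F (x k) (x i.+1))
      + logint (F (x k) (x j)) (F (x k.+1) (x j)) =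
      \sum_(i < j) logint (F (x k.+1) (x i)) (F (x k.+1) (x i.+1)).
    have := H n.+1 (leqnn _); rewrite xn !(Fr hk) (Fr hk1) (logintaa M_vN sgT) addr0 //.
  elim: j => [|j IH] jn.
    by rewrite !big_ord0 x0 (Fl hk) (Fl hk1) (logintaa M_vN sgT) addr0.
  rewrite !big_ord_recr /= -(IH (ltnW jn)) -!addrA; congr (_ + _).
  have hj := mesh_unit (ltnW jn); have hj1 := mesh_unit jn.
  have [u0 _] := uF hk hj.
  have na := hn _ _ _ _ hk hj hk hj (d0 _) (d0 _).
  have nb := hn _ _ _ _ hk hj hk hj1 (d0 _) (st _).
  have nc := hn _ _ _ _ hk hj hk1 hj1 (st _) (st _).
  have nd := hn _ _ _ _ hk hj hk1 hj (st _) (d0 _).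
  by rewrite -(near_triangle M_vN sgT u0 na nb nc) -(near_triangle M_vN sgT u0 na nd nc).
have rows k : (k <= n.+1)%N -> row 0 = row (x k).
  by elim: k => [|k IH] kn; [rewrite x0|rewrite -rowE // IH // ltnW].
have := rows n.+1 (leqnn _); rewrite xn /row => e.
transitivity (row 0); [|rewrite (rows n.+1) // xn].
  by apply: eq_bigr => j _; rewrite !F0 //; apply: mesh_unit => //; exact: ltnW.
by apply: eq_bigr => j _; rewrite !F1 //; apply: mesh_unit => //; exact: ltnW.
Qed.

End Homotopy.

(** * The trace *)

Section RealImag.
Context {R : realType} {HH : hilbertType R}.
Implicit Types (a b : bop HH).

Definition re_part a : bop HH := (2^-1 : R)%:C *: (a + adj a).
Definition im_part a : bop HH := (- 2^-1 : R)%:C *: ('i *: (a - adj a)).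

Lemma re_part_sa a : adj (re_part a) = re_part a.
Proof. by rewrite adjZr adjD adjK addrC. Qed.

Lemma im_part_sa a : adj (im_part a) = im_part a.
Proof. by rewrite adjZr adj_i adjB adjK -scalerN opprB. Qed.

Lemma half_C : (2^-1 : R)%:C = 2^-1 :> R[i].
Proof. by rewrite fmorphV rmorph_nat. Qed.

Lemma on_half a b : on b <= on a -> on ((2^-1 : R)%:C *: (a + b)) <= on a.
Proof.
move=> h; apply: le_trans (onZr _ _) _; rewrite ger0_norm ?invr_ge0 //.
rewrite mulrC ler_pdivrMr //; apply: le_trans (onD _ _) _; lra.
Qed.

Lemma on_re_part a : on (re_part a) <= on a.
Proof. by apply: on_half; rewrite on_adj. Qed.

Lemma on_im_part a : on (im_part a) <= on a.
Proof.
rewrite /im_part rmorphN scaleNr onN scalerA mulrC -scalerA.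
by apply: le_trans (on_i _) _; apply: on_half; rewrite onN on_adj.
Qed.

Lemma re_imE a : a = re_part a + 'i *: im_part a.
Proof.
rewrite /re_part /im_part !scalerA.
have -> : 'i * (- 2^-1 : R)%:C * 'i = (2^-1 : R)%:C.
  by rewrite mulrAC -expr2 sqrCi rmorphN mulrN mulN1r opprK.
by rewrite -scalerDr addrACA addrN addr0 half_scale.
Qed.

Lemma op_reE a : op_re a = re_part a :> (HH -> HH).
Proof. by rewrite /op_re /re_part adjointE half_C. Qed.

Lemma op_imE a : op_im a = im_part a :> (HH -> HH).
Proof.
rewrite /op_im adjointE /im_part scalerA.
have -> // : (2 * 'i : R[i])^-1 = (- 2^-1 : R)%:C * 'i.
have -> : (- 2^-1 : R)%:C = - 2^-1 :> R[i] by rewrite -half_C; apply/eqP; rewrite eq_complex /= oppr0 !eqxx.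
  by rewrite invfM invCi mulrN mulNr.
by apply/funext => x; rewrite !bZE bBE.
Qed.

Lemma inner_re_im (z : R[i]) : 0 <= z <-> 0 <= complex.Re z /\ complex.Im z = 0.
Proof. by rewrite lecE /=; split=> [/andP[/eqP <- ->]|[-> ->]]; rewrite ?eqxx. Qed.

Lemma sa_im0 a x : adj a = a -> complex.Im (inner (a x) x) = 0.
Proof.
move=> sa; rewrite innerE /=; have := rip_adj a x ('i *: x).
have := rip_i x (a x); rewrite sa bopZ [rip ('i *: x) _]ripC => -> e; lra.
Qed.

Lemma pos_op_ge0 a : pos a -> op_ge0 a.
Proof. by move=> [sa h] x; apply/inner_re_im; split; [exact: h|exact: sa_im0]. Qed.

Lemma op_ge0_pos a : op_ge0 a -> pos a.
Proof.
move=> h; split=> [|x]; last by have /inner_re_im[] := h x.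
have im0 x : complex.Im (inner (a x) x) = 0 by have /inner_re_im[] := h x.
suff e : im_part a = 0.
  have := re_imE a; rewrite e scaler0 addr0 => ->; exact: re_part_sa.
apply: sa_quad_eq (im_part_sa a) (@adj0 _ _) _ => x.
rewrite b0E rip0l /im_part bZE ripZl bZE bBE scalerBr ripBl.
have := im0 x; rewrite innerE /= => e.
have z : rip ('i *: a x) x = 0 by rewrite rip_i e oppr0.
by rewrite -[adj_fun a x]/(adj a x) z rip_i adj_rip bopZ ripC z oppr0 subrr mulr0.
Qed.

End RealImag.

Section Trace.
Context {R : realType} {HH : hilbertType R}.
Variables (M : set (HH -> HH)) (M_vN : von_neumann_algebra M).
Implicit Types (a b c x y : bop HH).
Local Notation inM := (inM M).

(** A positive, adjoint-invariant normalized trace: the real part of a tracial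
    state. *)
Definition ptrace (s : bop HH -> R) := [/\ tracial M s,
  forall a, inM a -> pos a -> 0 <= s a,
  forall a, inM a -> s (adj a) = s a & s 1 = 1].

Variables (tau : (HH -> HH) -> R[i]) (tauP : normal_tracial_state M tau).

Definition retau a : R := complex.Re (tau a).
Definition imtau a : R := complex.Im (tau a).

Lemma tauDZ (k : R[i]) a b : inM a -> inM b -> tau (k *: a + b) = k * tau a + tau b.
Proof. by case: tauP => h _ _ _ _; apply: h. Qed.

Lemma tau0 : tau (0 : bop HH) = 0.
Proof.
have := tauDZ 1 (inM0 M_vN) (inM0 M_vN); rewrite scale1r addr0 mul1r => /eqP.
by rewrite -subr_eq subrr => /eqP.
Qed.

Lemma tauD a b : inM a -> inM b -> tau (a + b : bop HH) = tau a + tau b.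
Proof. by move=> ha hb; rewrite -{1}[a]scale1r tauDZ // mul1r. Qed.

Lemma tauZ (k : R[i]) a : inM a -> tau (k *: a : bop HH) = k * tau a.
Proof. by move=> ha; rewrite -[k *: a]addr0 tauDZ ?tau0 ?addr0 //; exact: inM0. Qed.

Lemma tau1 : tau (1 : bop HH) = 1.
Proof. by case: tauP => _ _ h _ _; exact: h. Qed.

Lemma tau_pos a : inM a -> pos a -> 0 <= tau a.
Proof. by move=> ha /pos_op_ge0; case: tauP => _ h _ _ _; exact: h. Qed.

Lemma tauC a b : inM a -> inM b -> tau (a * b : bop HH) = tau (b * a : bop HH).
Proof. by case: tauP => _ _ _ h _; exact: h. Qed.

(** [|a| +- a >= 0] gives both reality and the norm bound. *)
Lemma tau_sa_bound a : inM a -> adj a = a -> imtau a = 0 /\ `|retau a| <= on a.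
Proof.
move=> ha sa; have M1 := inM1 M_vN.
have p b : inM b -> adj b = b -> on b <= on a ->
    0 <= on a + retau b /\ imtau b = 0.
  move=> hb sb ba; have sNb : adj (- b) = - b by rewrite adjN sb.
  have h : pos ((on a)%:C *: (1 : bop HH) - - b).
    by apply: pos_norm_sub => //; rewrite onN.
  have := tau_pos _ h; rewrite opprK tauDZ // tau1 mulr1 => /(_ (inMD M_vN (inMZ M_vN _ M1) hb)).
  by move=> /inner_re_im; rewrite /retau /imtau; case: (tau b) => u v /=; rewrite add0r.
have [h1 h2] := p a ha sa (lexx _).
have [h3 _] := p (- a) (inMN M_vN ha) (ltac:(by rewrite adjN sa)) (ltac:(by rewrite onN)).
split=> //; rewrite ler_norml; apply/andP; split; first lra.
move: h3; rewrite /retau -scaleN1r tauZ // mulN1r; case: (tau a) => u v /=; lra.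
Qed.

Lemma inM_re_part a : inM a -> inM (re_part a).
Proof. by move=> ha; apply: inMZ => //; apply: inMD => //; exact: inM_adj. Qed.

Lemma inM_im_part a : inM a -> inM (im_part a).
Proof. by move=> ha; do 2 apply: inMZ => //; apply: inMB => //; exact: inM_adj. Qed.

Lemma tau_reim a : inM a -> tau a = (retau (re_part a)) +i* (retau (im_part a)).
Proof.
move=> ha; have h1 := inM_re_part ha; have h2 := inM_im_part ha.
have [i1 _] := tau_sa_bound h1 (re_part_sa a); have [i2 _] := tau_sa_bound h2 (im_part_sa a).
rewrite {1}(re_imE a) addrC tauDZ //; move: i1 i2; rewrite /retau /imtau.
case: (tau (re_part a)) => u v /= ->; case: (tau (im_part a)) => u' v' /= ->.
by rewrite -complexiE; apply/eqP; rewrite eq_complex /=; apply/andP; split; apply/eqP; ring.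
Qed.

Lemma retau_re a : inM a -> retau a = retau (re_part a).
Proof. by move=> ha; rewrite {1}/retau tau_reim. Qed.

Lemma imtau_re a : inM a -> imtau a = retau (- ('i *: a)).
Proof.
by move=> ha; rewrite /imtau /retau -scaleNr tauZ // -complexiE; case: (tau a) => u v /=; ring.
Qed.

Lemma retau_tracial : tracial M retau.
Proof.
split.
- by move=> a b ha hb; rewrite /retau tauD // raddfD.
- by move=> r a ha; rewrite /retau tauZ // ReM_real.
- by move=> a b ha hb; rewrite /retau tauC.
move=> a ha; rewrite retau_re //; apply: le_trans (on_re_part a).
by case: (tau_sa_bound (inM_re_part ha) (re_part_sa a)).
Qed.

Lemma retau_ptrace : ptrace retau.
Proof.
split; first exact: retau_tracial.
- by move=> a ha /(tau_pos ha)/inner_re_im[].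
- move=> a ha; rewrite (retau_re ha) (retau_re (inM_adj M_vN ha)); congr retau.
  by rewrite /re_part adjK addrC.
- by rewrite /retau tau1.
Qed.

Lemma imtau_tracial : tracial M imtau.
Proof.
split.
- by move=> a b ha hb; rewrite /imtau tauD // raddfD.
- move=> r a ha; rewrite /imtau tauZ //; case: (tau a) => u v /=; ring.
- by move=> a b ha hb; rewrite /imtau tauC.
move=> a ha; rewrite /imtau tau_reim //=; apply: le_trans (on_im_part a).
by case: (tau_sa_bound (inM_im_part ha) (im_part_sa a)).
Qed.

End Trace.

Section Vanishing.
Context {R : realType} {HH : hilbertType R}.
Variables (M : set (HH -> HH)) (M_vN : von_neumann_algebra M).
Implicit Types (a b c x y : bop HH).
Local Notation inM := (inM M).
Variables (s : bop HH -> R) (sP : ptrace M s).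

Lemma ptrace_tracial : tracial M s. Proof. by case: sP. Qed.
Let sT := ptrace_tracial.
Lemma s_ge0 a : inM a -> pos a -> 0 <= s a. Proof. by case: sP => _ h _ _; exact: h. Qed.
Lemma s_adj a : inM a -> s (adj a) = s a. Proof. by case: sP => _ _ h _; exact: h. Qed.
Lemma s_1 : s 1 = 1. Proof. by case: sP. Qed.

Lemma s_le a b : inM a -> inM b -> pos (b - a) -> s a <= s b.
Proof. by move=> ha hb h; rewrite -subr_ge0 -(sgB M_vN sT) //; apply: s_ge0 => //; exact: inMB. Qed.

Lemma pos_sqr_le a : pos a -> pos ((on a)%:C *: a - a * a).
Proof.
move=> pa; have sa := pos_sa pa; split=> [|x]; first by rewrite adjB adjZr adjM sa.
rewrite bBE bZE bME ripBl ripZl subr_ge0 -{1}sa adj_rip rip_nr; exact: pos_nr.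
Qed.

(** A positive operator of trace zero is annihilated by the trace after any
    multiplication, by the Cauchy-Schwarz inequality for [s (x^* y)]. *)
Lemma trace0_mul a x : inM a -> pos a -> s a = 0 -> inM x -> s (a * x) = 0.
Proof.
move=> ha pa s0 hx; have sa := pos_sa pa; have hx' := inM_adj M_vN hx.
have aa : s (a * a) = 0.
  apply/eqP; rewrite eq_le; apply/andP; split.
    have := s_le (inMM M_vN ha ha) (inMZ M_vN _ ha) (pos_sqr_le pa).
    by rewrite (sgZ sT) // s0 mulr0.
  by apply: s_ge0; [exact: inMM|exact: pos_sqr].
apply: (@quad_ge0 _ (s (adj x * x))) => t.
have ht : inM (t%:C *: x) by exact: inMZ.
have := s_ge0 _ (pos_adjM (a + t%:C *: x)).
have -> : adj (a + t%:C *: x) * (a + t%:C *: x) =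
    (a * a + t%:C *: (a * x + adj (a * x))) + (t * t)%:C *: (adj x * x).
  rewrite adjD adjZr adjM sa mulrDl !mulrDr !bscaleAl !bscaleAr scalerA -rmorphM.
  by rewrite scalerDr !addrA.
have hax := inMM M_vN ha hx; have hax' := inM_adj M_vN hax.
have haa := inMM M_vN ha ha; have hxx := inMM M_vN hx' hx.
have h1 := inMD M_vN hax hax'; have h2 := inMZ M_vN t%:C h1.
rewrite !(sgD sT) ?(sgZ sT) ?(sgD sT) ?(s_adj hax) // ?aa; try exact: inMD; try exact: inMZ.
move=> /(_ (inMD M_vN (inMD M_vN haa h2) (inMZ M_vN _ hxx))).
rewrite expr2; lra.
Qed.

End Vanishing.

(** * Boundary values of resolvents *)

Section Resolvents.
Context {R : realType} {HH : hilbertType R}.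
Implicit Types (x y : HH) (a b c h : bop HH) (e d : R).

Definition ib : bop HH := 'i *: (1 : bop HH).

Lemma ibE a : 'i *: a = ib * a. Proof. by rewrite /ib bscaleAl mul1r. Qed.
Lemma ibC a : a * ib = ib * a. Proof. by rewrite /ib bscaleAl bscaleAr mulr1 mul1r. Qed.
Lemma ib2 : ib * ib = -1.
Proof. by rewrite -ibE /ib scalerA -expr2 sqrCi scaleN1r. Qed.
Lemma adj_ib : adj ib = - ib. Proof. by rewrite /ib adj_i adj1. Qed.

Lemma binvM a b : unitb a -> unitb b -> binv (a * b) = binv b * binv a.
Proof.
move=> ua ub; apply: binv_eq; split.
  by rewrite mulrA -[a * b * _]mulrA mulbV // mulr1 mulbV.
by rewrite -mulrA [binv a * _]mulrA mulVb // mul1r mulVb.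
Qed.

Lemma binv_comm a b : unitb a -> a * b = b * a -> binv a * b = b * binv a.
Proof.
move=> ua ab; rewrite -[LHS]mulr1 -(mulbV ua) mulrA -[_ * b * a]mulrA -ab !mulrA.
by rewrite mulVb // mul1r.
Qed.

Lemma adj_binv a : unitb a -> adj (binv a) = binv (adj a).
Proof. by move=> ua; symmetry; apply: binv_eq; apply: invb_adj; exact: binvP. Qed.

Lemma unitb_adj a : unitb a -> unitb (adj a).
Proof. by move=> ua; exists (adj (binv a)); apply: invb_adj; exact: binvP. Qed.

Lemma im_part_rip a x : rip (im_part a x) x = rip (a x) ('i *: x).
Proof.
rewrite /im_part bZE ripZl bZE rip_i bBE ripBl adj_rip bopZ ripC rip_i ripC.
lra.
Qed.

(** The quadratic form of [Im a] is at least [k], since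
    [rip (a x) (i x)] is the imaginary part of [inner (a x) x]. *)
Definition dissip (k : R) a := forall x, k * nr x ^+ 2 <= rip (a x) ('i *: x).

(** [|Im <a x, x>| <= |a x| |x|], and the same for the adjoint. *)
Lemma dissip_unit k a : 0 < k -> dissip k a -> unitb a /\ on (binv a) <= k^-1.
Proof.
have low (y x : HH) : 0 < k -> k * nr x ^+ 2 <= `|rip y ('i *: x)| -> k * nr x <= nr y.
  move=> k0; have [->|x0] := eqVneq (nr x) 0; first by rewrite mulr0 nr_ge0.
  have xp : 0 < nr x by rewrite lt_neqAle eq_sym x0 nr_ge0.
  move=> h; rewrite -(ler_pM2r xp) -mulrA -expr2; apply: le_trans h _.
  by apply: le_trans (rip_CS _ _) _; rewrite nr_i.
move=> k0 h; apply: lower_bound_inv => // x; apply: low => //.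
  exact: le_trans (h x) (ler_norm _).
rewrite adj_rip bopZ ripC rip_i normrN; exact: le_trans (h x) (ler_norm _).
Qed.

Lemma dissip_sa a x : adj a = a -> rip (a x) ('i *: x) = 0.
Proof. by move=> sa; have := sa_im0 x sa; rewrite innerE. Qed.

Definition sh h e : bop HH := h + e%:C *: ib.

Lemma shE h e : h + ('i * e%:C) *: (1 : bop HH) = sh h e.
Proof. by rewrite /sh /ib scalerA mulrC. Qed.

Lemma sh_rip h e x : rip (sh h e x) ('i *: x) = rip (h x) ('i *: x) + e * nr x ^+ 2.
Proof.
by rewrite bDE bZE /ib bZE b1E ripDl ripZl rip_nr nr_i.
Qed.

Lemma sh_dissip h e k : dissip k h -> dissip (k + e) (sh h e).
Proof. by move=> hk x; rewrite sh_rip mulrDl lerD2r. Qed.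

Lemma sa_dissip h : adj h = h -> dissip 0 h.
Proof. by move=> sa x; rewrite dissip_sa // mul0r. Qed.

Lemma adj_sh h e : adj (sh h e) = sh (adj h) (- e).
Proof. by rewrite adjD adjZr adj_ib /sh rmorphN scaleNr scalerN. Qed.

Lemma sh_comm h a e : a * h = h * a -> a * sh h e = sh h e * a.
Proof. by move=> ah; rewrite /sh mulrDr mulrDl ah bscaleAl bscaleAr ibC. Qed.

Section SelfAdjoint.
Variables (h : bop HH) (sah : adj h = h).

Definition res e : bop HH := binv (sh h e).
Definition rsq e : bop HH := binv (h * h + (e ^+ 2)%:C *: (1 : bop HH)).

Lemma sh_unit_pos e : 0 < e -> unitb (sh h e) /\ on (res e) <= e^-1.
Proof. by move=> e0; apply: dissip_unit => //; rewrite -[X in dissip X]add0r; apply/sh_dissip/sa_dissip. Qed.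

Lemma sh_unit e : e != 0 -> unitb (sh h e).
Proof.
case: ltgtP => // e0 _; last by case: (sh_unit_pos e0).
have e0' : 0 < - e by rewrite oppr_gt0.
by have [/unitb_adj + _] := sh_unit_pos e0'; rewrite adj_sh sah opprK.
Qed.

Lemma adj_res e : e != 0 -> adj (res e) = res (- e).
Proof. by move=> e0; rewrite /res adj_binv; [rewrite adj_sh sah|exact: sh_unit]. Qed.

Lemma res_commute a e : e != 0 -> a * h = h * a -> a * res e = res e * a.
Proof. by move=> e0 ah; symmetry; apply: binv_comm; [exact: sh_unit|rewrite sh_comm]. Qed.

Lemma res_comm e d : e != 0 -> d != 0 -> res e * res d = res d * res e.
Proof. by move=> e0 d0; apply: res_commute => //; rewrite -res_commute. Qed.

Lemma sh_mul e : sh h e * sh h (- e) = h * h + (e ^+ 2)%:C *: (1 : bop HH).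
Proof.
rewrite /sh rmorphN scaleNr; set E := e%:C *: ib.
have cE : E * h = h * E by rewrite /E bscaleAl bscaleAr ibC.
have EE : E * E = - ((e ^+ 2)%:C *: (1 : bop HH)).
  by rewrite /E bscaleAl bscaleAr ib2 !scalerN scalerA -rmorphM.
transitivity (h * h - E * E + (E * h - h * E)); first by ncring_in (bop HH).
by rewrite cE subrr addr0 EE opprK.
Qed.

Lemma rsqE e : e != 0 -> rsq e = res e * res (- e).
Proof.
move=> e0; have ne0 : - e != 0 by rewrite oppr_eq0.
rewrite /rsq -sh_mul binvM; [exact: res_comm|exact: sh_unit|exact: sh_unit].
Qed.

Lemma rsq_unit e : e != 0 -> unitb (h * h + (e ^+ 2)%:C *: (1 : bop HH)).
Proof. by move=> e0; rewrite -sh_mul; apply: unitM; apply: sh_unit; rewrite ?oppr_eq0. Qed.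

Lemma rsq_adj e : e != 0 -> rsq e = res e * adj (res e).
Proof. by move=> e0; rewrite adj_res // rsqE. Qed.

Lemma rsq_pos e : e != 0 -> pos (rsq e).
Proof. by move=> e0; rewrite rsq_adj // -{1}(adjK (res e)); exact: pos_adjM. Qed.

Lemma rsq_commute a e : e != 0 -> a * h = h * a -> a * rsq e = rsq e * a.
Proof.
move=> e0 ah; have ne0 : - e != 0 by rewrite oppr_eq0.
by rewrite rsqE // mulrA (res_commute e0 ah) -mulrA (res_commute ne0 ah) mulrA.
Qed.

Lemma rsq_comm e d : e != 0 -> d != 0 -> rsq e * rsq d = rsq d * rsq e.
Proof. by move=> e0 d0; apply: rsq_commute => //; rewrite -rsq_commute. Qed.

Lemma rsqB e d : e != 0 -> d != 0 -> rsq e - rsq d = (d ^+ 2 - e ^+ 2)%:C *: (rsq e * rsq d).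
Proof.
move=> e0 d0; rewrite resolvent; [|exact: rsq_unit|exact: rsq_unit].
by rewrite opprD addrACA subrr add0r -scalerBl -rmorphB bscaleAr mulr1 bscaleAl.
Qed.

Lemma mul_rsq e : e != 0 -> h * h * rsq e = 1 - (e ^+ 2)%:C *: rsq e.
Proof.
move=> e0; rewrite -[X in X - _](mulbV (rsq_unit e0)) mulrDl bscaleAl mul1r addrK //.
Qed.

Lemma im_res (k : bop HH) e : e != 0 ->
  im_part (k * res e * adj k) = - (e%:C *: (k * rsq e * adj k)).
Proof.
move=> e0; have ne0 : - e != 0 by rewrite oppr_eq0.
rewrite /im_part !adjM adjK adj_res // mulrA -mulrBl -mulrBr resolvent; [|exact: sh_unit|exact: sh_unit].
have -> : sh h (- e) - sh h e = (- (2 * e))%:C *: ib.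
  rewrite /sh opprD addrACA subrr add0r -scalerBl -rmorphB; congr (_%:C *: _); ring.
have -> : res e * ((- (2 * e))%:C *: ib) * binv (sh h (- e)) = (- (2 * e))%:C *: (ib * rsq e).
  by rewrite rsqE // bscaleAr bscaleAl ibC -mulrA.
rewrite bscaleAr bscaleAl [k * _]mulrA ibC -!mulrA !scalerA mulrAC -scalerA ibE mulrA ib2.
rewrite mulN1r scalerN -rmorphM; congr (- (_%:C *: _)); by field.
Qed.

End SelfAdjoint.
End Resolvents.

Section BoundaryTrace.
Context {R : realType} {HH : hilbertType R}.
Variables (M : set (HH -> HH)) (M_vN : von_neumann_algebra M).
Implicit Types (x y : HH) (a b c z : bop HH) (e d : R).
Local Notation inM := (inM M).
Variables (s : bop HH -> R) (sP : ptrace M s).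
Let sT := ptrace_tracial sP.

Lemma on_sq a : on a ^+ 2 <= on (a * adj a).
Proof.
have n0 := on_ge0 (a * adj a).
rewrite -(sqr_sqrtr n0) ler_sqr ?nnegrE ?on_ge0 ?sqrtr_ge0 // -on_adj.
apply: on_le => [|x]; first exact: sqrtr_ge0.
rewrite -(ler_pXn2r (n := 2)) ?nnegrE ?mulr_ge0 ?nr_ge0 ?sqrtr_ge0 //.
rewrite exprMn sqr_sqrtr // -rip_nr adj_rip ripC -bME.
exact: pos_le_on.
Qed.

(** [a^* a <= |a|^2], conjugated by [z]. *)
Lemma conj_le a z : inM a -> inM z ->
  s (adj z * adj a * a * z) <= on a ^+ 2 * s (adj z * z).
Proof.
move=> ha hz; have ha' := inM_adj M_vN ha; have hz' := inM_adj M_vN hz.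
rewrite -(sgZ sT); last exact: inMM.
apply: (s_le M_vN sP); [by do !apply: inMM|by apply: inMZ => //; exact: inMM|].
have -> : (on a ^+ 2)%:C *: (adj z * z) - adj z * adj a * a * z =
    adj z * ((on a ^+ 2)%:C *: (1 : bop HH) - adj a * a) * z.
  by rewrite mulrBr mulrBl bscaleAr bscaleAl mulr1 !mulrA.
apply: pos_conj; split=> [|x]; first by rewrite adjB adjZr adj1 adjM adjK.
rewrite bBE bZE b1E bME ripBl ripZl adj_rip !rip_nr subr_ge0 -exprMn.
by rewrite ler_sqr ?nnegrE ?mulr_ge0 ?on_ge0 ?nr_ge0 // nr_on.
Qed.

Variables (h k L : bop HH).
Hypotheses (hM : inM h) (sah : adj h = h) (kM : inM k) (LM : inM L).
Hypothesis limL : forall eta, 0 < eta -> exists2 d, 0 < d &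
  forall e, 0 < e -> e < d -> on (k * res h e * adj k - L) <= eta.

Let inMres e : e != 0 -> inM (res h e).
Proof.
move=> e0; apply: inM_inv => //; first exact: sh_unit.
by apply: inMD => //; do 2 apply: inMZ => //; exact: inM1.
Qed.

Let inMrsq e : e != 0 -> inM (rsq h e).
Proof. by move=> e0; rewrite rsqE //; apply: inMM => //; apply: inMres; rewrite ?oppr_eq0. Qed.

Let q e : bop HH := e%:C *: (k * rsq h e * adj k).
Let f e : R := e ^+ 2 * s (rsq h e).

Let kM' : inM (adj k). Proof. exact: inM_adj. Qed.
Let qM e : e != 0 -> inM (q e).
Proof. by move=> e0; apply: inMZ => //; do 2 apply: inMM => //; exact: inMrsq. Qed.

Let q_pos e : 0 < e -> pos (q e).
Proof.
move=> e0; apply: posZ; first exact: ltW.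
by rewrite -{1}(adjK k); apply: pos_conj; apply: (rsq_pos sah); rewrite gt_eqF.
Qed.

Lemma mul_swap a b c z : b * c = c * b -> b * z = z * b -> a * b * (c * z) = a * c * (z * b).
Proof. by move=> bc bz; rewrite -mulrA [b * (c * z)]mulrA bc -[c * b * z]mulrA bz !mulrA. Qed.

Lemma trace_rsq_le e d : 0 < e -> 0 < d ->
  s (k * (rsq h e * rsq h d) * adj k) <= (e^-1) ^+ 2 * s (k * rsq h d * adj k).
Proof.
move=> e0 d0; have en : e != 0 by rewrite gt_eqF. have dn : d != 0 by rewrite gt_eqF.
have [_ re] := sh_unit_pos sah e0.
have nd : - d != 0 by rewrite oppr_eq0. have ne : - e != 0 by rewrite oppr_eq0.
pose z := res h (- d) * adj k.
have hz : inM z by apply: inMM => //; exact: inMres.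
have az : adj z = k * res h d by rewrite /z adjM adjK adj_res // opprK.
have E1 : k * rsq h d * adj k = adj z * z by rewrite az /z rsqE // !mulrA.
have E2 : k * (rsq h e * rsq h d) * adj k = adj z * adj (res h (- e)) * res h (- e) * z.
  rewrite az /z adj_res // opprK !rsqE // -!mulrA; congr (_ * _).
  rewrite [res h (- e) * (res h d * _)]mulrA (res_comm sah ne dn) !mulrA.
  by rewrite (res_comm sah en dn).
rewrite E1 E2; apply: le_trans (conj_le (inMres ne) hz) _.
apply: ler_wpM2r; first by apply: (s_ge0 sP); [apply: inMM => //; exact: inM_adj|exact: pos_adjM].
have i0 : 0 <= e^-1 by rewrite invr_ge0 ltW.
by rewrite ler_sqr ?nnegrE ?on_ge0 // -(adj_res sah en) on_adj.
Qed.

(** With [q e = k e (h^2 + e^2)^-1 k^*] and [f e = s (e^2 (h^2 + e^2)^-1)], the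
    left-hand side is the trace of
    [3 e^3 k (h^2 + e^2)^-1 (h^2 + 4 e^2)^-1 k^*].  Here
    [4 e^2 (h^2 + 4 e^2)^-1 - d^2 (h^2 + d^2)^-1] is a multiple of [z z^*], and
    by cyclicity the trace becomes one of [z^* x z] with [|x| <= |q e| / e];
    what remains is the trace of [q d] with a factor [d]. *)
Lemma trace_gap e d : 0 < e -> 0 < d -> d < e ->
  s (q e) - 2^-1 * s (q (2 * e)) <=
  3 / 4 * on (q e) * (f (2 * e) - f d) + 3 / 4 * (d / e) * s (q d).
Proof.
move=> e0 d0 de; have en : e != 0 by rewrite gt_eqF. have dn : d != 0 by rewrite gt_eqF.
have e20 : 0 < 2 * e by rewrite mulr_gt0. have e2n : 2 * e != 0 by rewrite gt_eqF.
have nd : - d != 0 by rewrite oppr_eq0. have ne2 : - (2 * e) != 0 by rewrite oppr_eq0.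
have ne : - e != 0 by rewrite oppr_eq0.
pose w a : bop HH := k * a * adj k.
have wM a : inM a -> inM (w a) by move=> ha; do 2 apply: inMM => //.
have hr := inMrsq en; have hr2 := inMrsq e2n; have hrd := inMrsq dn.
have h12 := inMM M_vN hr hr2; have h1d := inMM M_vN hr hrd.
have wB a b : w (a - b) = w a - w b by rewrite /w mulrBr mulrBl.
have wZ (x : R) a : w (x%:C *: a) = x%:C *: w a by rewrite /w bscaleAr bscaleAl.
have qs (x : R) : x != 0 -> s (q x) = x * s (w (rsq h x)).
  by move=> xn; rewrite (sgZ sT) //; apply/wM/inMrsq.
have lhs : s (q e) - 2^-1 * s (q (2 * e)) = 3 * e ^+ 3 * s (w (rsq h e * rsq h (2 * e))).
  have E := congr1 s (congr1 w (rsqB sah en e2n)).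
  rewrite wB wZ (sgB M_vN sT) ?(sgZ sT) in E; try exact: wM.
  rewrite !qs //.
  have -> : e * s (w (rsq h e)) - 2^-1 * (2 * e * s (w (rsq h (2 * e)))) =
     e * (s (w (rsq h e)) - s (w (rsq h (2 * e)))) by field.
  by rewrite E; ring.
pose c : R := 4 * e ^+ 2 - d ^+ 2.
have c0 : 0 < c by rewrite /c; nra.
pose z := h * res h (2 * e) * res h d.
have hz : inM z by exact: (inMM M_vN (inMM M_vN hM (inMres e2n)) (inMres dn)).
have hz' := inM_adj M_vN hz.
have zz : z * adj z = h * h * (rsq h (2 * e) * rsq h d).
  rewrite /z !adjM sah !adj_res // !rsqE //.
  have C1 := res_comm sah dn nd; have C2 := res_comm sah dn ne2.
  have ch := res_commute sah ne2 (erefl (h * h)). 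
  have c1 : res h (- (2 * e)) * h = h * res h (- (2 * e)) by rewrite (res_commute sah ne2).
  have c2 : res h (- d) * h = h * res h (- d) by rewrite (res_commute sah nd).
  have c3 : res h d * h = h * res h d by rewrite (res_commute sah dn).
  have c4 : res h (2 * e) * h = h * res h (2 * e) by rewrite (res_commute sah e2n).
  have c5 := res_comm sah nd ne2.
  rewrite -!mulrA c1 [res h (- d) * (h * _)]mulrA c2 -!mulrA [res h d * (h * _)]mulrA c3 -!mulrA.
  rewrite [res h (2 * e) * (h * _)]mulrA c4 -!mulrA; do 3 congr (_ * _).
  by rewrite c5 !mulrA C2.
have phi : c%:C *: (z * adj z) = (4 * e ^+ 2)%:C *: rsq h (2 * e) - (d ^+ 2)%:C *: rsq h d.
  have B : c%:C *: (rsq h (2 * e) * rsq h d) = rsq h d - rsq h (2 * e).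
    rewrite (rsqB sah dn e2n) (rsq_comm sah e2n dn); congr (_%:C *: _); rewrite /c; ring.
  rewrite zz mulrA (mul_rsq sah e2n) mulrBl mul1r bscaleAl scalerBr scalerA mulrC -scalerA B.
  have -> : (2 * e) ^+ 2 = 4 * e ^+ 2 by ring.
  rewrite scalerBr opprB addrCA; congr (_ + _).
  rewrite -scalerBl -rmorphB (_ : c - 4 * e ^+ 2 = - d ^+ 2); last by rewrite /c; ring.
  by rewrite rmorphN scaleNr.
have hzz := inMM M_vN hz hz'; have hrz := inMM M_vN hr hzz.
have wD a b : w (a + b) = w a + w b by rewrite /w mulrDr mulrDl.
have key : (4 * e ^+ 2) * s (w (rsq h e * rsq h (2 * e))) =
   c * s (w (rsq h e * (z * adj z))) + d ^+ 2 * s (w (rsq h e * rsq h d)).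
  have m1 := wM _ h12; have m2 := wM _ hrz; have m3 := wM _ h1d.
  rewrite -!(sgZ sT) // -(sgD sT); [|exact: inMZ|exact: inMZ].
  have := congr1 (fun b => w (rsq h e * b)) phi.
  by rewrite mulrBr !bscaleAr wB !wZ => ->; rewrite subrK.
have first : c * s (w (rsq h e * (z * adj z))) <= on (q e) / e * (f (2 * e) - f d).
  pose a := k * res h e; have ha : inM a by exact: (inMM M_vN kM (inMres en)).
  have ha' := inM_adj M_vN ha.
  have cz (y : R) : y != 0 -> res h y * z = z * res h y.
    move=> yn; have c1 : res h y * h = h * res h y by rewrite (res_commute sah yn).
    rewrite /z !mulrA c1 -[h * res h y * _]mulrA (res_comm sah yn e2n) mulrA -mulrA.
    by rewrite (res_comm sah yn dn) mulrA.
  have cz' (y : R) : y != 0 -> res h y * adj z = adj z * res h y.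
    move=> yn; have ny : - y != 0 by rewrite oppr_eq0.
    have := congr1 (@adj _ _) (cz _ ny); rewrite !adjM !(adj_res sah ny) opprK.
    by move=> ->.
  have -> : w (rsq h e * (z * adj z)) = a * z * (adj z * adj a).
    by rewrite /a adjM (adj_res sah en) (rsqE sah en) /w (mul_swap _ (cz _ ne) (cz' _ ne)) !mulrA.
  rewrite (sgC sT); [|exact: inMM|exact: inMM].
  rewrite mulrA; apply: le_trans (ler_wpM2l (ltW c0) (conj_le ha hz)) _.
  have -> : f (2 * e) - f d = c * s (adj z * z).
    rewrite -(sgC sT) // -(sgZ sT) // phi (sgB M_vN sT) ?(sgZ sT) //; try exact: inMZ.
    by rewrite /f; congr (_ * _ - _); ring.
  have zz0 : 0 <= s (adj z * z) by apply: (s_ge0 sP); [exact: inMM|exact: pos_adjM].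
  rewrite mulrCA; apply: ler_wpM2r; first by rewrite mulr_ge0 // ltW.
  apply: le_trans (on_sq _) _.
  have -> : a * adj a = (e^-1)%:C *: q e.
    rewrite /q scalerA -rmorphM mulVf // scale1r /a adjM (rsqE sah en) (adj_res sah en).
    by rewrite !mulrA.
  by apply: le_trans (onZr _ _) _; rewrite ger0_norm ?invr_ge0 ?(ltW e0) // mulrC.
have second : d ^+ 2 * s (w (rsq h e * rsq h d)) <= d / e ^+ 2 * s (q d).
  have := trace_rsq_le e0 d0; rewrite -/(w _) -/(w _) => le2.
  apply: le_trans (ler_wpM2l (sqr_ge0 d) le2) _.
  by rewrite qs // le_eqVlt; apply/orP; left; apply/eqP; field.
rewrite lhs.
have -> : 3 * e ^+ 3 * s (w (rsq h e * rsq h (2 * e))) =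
  3 / 4 * e * ((4 * e ^+ 2) * s (w (rsq h e * rsq h (2 * e)))) by field.
rewrite key mulrDr; apply: lerD.
  have -> : 3 / 4 * on (q e) * (f (2 * e) - f d) = 3 / 4 * e * (on (q e) / e * (f (2 * e) - f d)) by field.
  by apply: ler_wpM2l first; rewrite mulr_ge0 ?ltW.
have -> : 3 / 4 * (d / e) * s (q d) = 3 / 4 * e * (d / e ^+ 2 * s (q d)) by field.
by apply: ler_wpM2l second; rewrite mulr_ge0 ?ltW.
Qed.

Let B : bop HH := - im_part L.

Lemma im_partD a b : im_part (a + b) = im_part a + im_part b.
Proof. by rewrite /im_part adjD opprD addrACA !scalerDr. Qed.

Lemma im_partN a : im_part (- a) = - im_part a.
Proof. by rewrite /im_part adjN -opprD !scalerN. Qed.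

Let limB eta : 0 < eta -> exists2 d, 0 < d & forall e, 0 < e -> e < d -> on (q e - B) <= eta.
Proof.
move=> /limL[d d0 hd]; exists d => // e e0 ed.
have en : e != 0 by rewrite gt_eqF.
have -> : q e - B = - im_part (k * res h e * adj k - L).
  by rewrite im_partD im_partN (im_res sah k en) opprD opprK /B !opprK.
by rewrite onN; apply: le_trans (on_im_part _) _; exact: hd.
Qed.

Lemma neg_im_limit_pos : pos B.
Proof.
split=> [|x]; first by rewrite /B adjN im_part_sa.
apply/ler_addgt0Pr => eta eta0.
have n0 : 0 < nr x ^+ 2 + 1 by rewrite ltr_wpDl ?sqr_ge0.
have [d d0 hd] := limB (divr_gt0 eta0 n0).
have e0 : 0 < d / 2 by rewrite divr_gt0.
have ed : d / 2 < d by lra.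
have := hd _ e0 ed; have [_ /(_ x) p] := q_pos e0.
have := ler_norm (rip ((q (d / 2) - B) x) x); have := rip_CS ((q (d / 2) - B) x) x.
have := nr_on (q (d / 2) - B) x; set D := q _ - B => h1 h2 h3 h4.
have : rip (D x) x <= eta.
  apply: le_trans h3 (le_trans h2 _).
  apply: (@le_trans _ _ (on D * nr x * nr x)); first by rewrite ler_wpM2r ?nr_ge0.
  rewrite -mulrA -expr2.
  apply: (@le_trans _ _ (eta / (nr x ^+ 2 + 1) * nr x ^+ 2)); first by rewrite ler_wpM2r ?sqr_ge0.
  rewrite mulrAC ler_pdivrMr //; have := sqr_ge0 (nr x); nra.
by rewrite /D bBE ripBl; lra.
Qed.

(** The boundary value of [k (h + i e)^-1 k^*] has imaginary part of trace
    zero: with [q e = - Im (k (h + i e)^-1 k^* )] the difference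
    [q e - q (2 e) / 2] has limit [B / 2], while by [trace_gap] its trace is
    controlled by the oscillation of [f], which has an infimum. *)
Lemma im_limit_trace0 : s B = 0.
Proof.
have pB := neg_im_limit_pos; have BM : inM B by apply: (inMN M_vN); exact: inM_im_part.
have b0 := s_ge0 sP BM pB; set b := s B in b0 *.
apply/eqP; rewrite eq_le b0 andbT leNgt; apply/negP => bp.
have b8 : 0 < b / 8 by rewrite divr_gt0.
have [d0 d00 hd] := limB b8.
have [d1 d10 hd1] := limB ltr01.
have sq e : 0 < e -> e < d0 -> `|s (q e) - b| <= b / 8.
  move=> e0 ed; have en : e != 0 by rewrite gt_eqF.
  rewrite -(sgB M_vN sT) //; last exact: qM.
  by apply: le_trans (sgb sT _) (hd _ e0 ed); apply: inMB => //; exact: qM.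
pose m := Num.min d0 d1; have m0 : 0 < m by rewrite lt_min d00.
have k0 : 0 < on B + 1 by rewrite ltr_wpDl ?on_ge0.
pose c := b / (8 * (on B + 1)); have c0 : 0 < c by rewrite divr_gt0 // mulr_gt0.
pose A := [set f (2 * e) | e in [set e : R | 0 < e /\ 2 * e < m]].
have f0 e : 0 < e -> 0 <= f e.
  move=> e0; rewrite /f mulr_ge0 ?sqr_ge0 //; apply: (s_ge0 sP).
    by apply: inMrsq; rewrite gt_eqF.
  by apply: (rsq_pos sah); rewrite gt_eqF.
have hA : has_inf A.
  split; first by exists (f (2 * (m / 4))), (m / 4) => //=; split; lra.
  by exists 0 => _ [e [e0 _] <-]; apply: f0; rewrite mulr_gt0.
have [_ [e [e0 em] <-] fe] := inf_adherent c0 hA.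
have [ed0 ed1] : 2 * e < d0 /\ 2 * e < d1 by move: em; rewrite lt_min => /andP[].
have qe : on (q e) <= on B + 1.
  have -> : q e = B + (q e - B) by rewrite addrC subrK.
  apply: le_trans (onD _ _) _; rewrite lerD2l; apply: hd1 => //; lra.
pose d := Num.min (e / 2) (e / 16).
have dp : 0 < d by rewrite lt_min !divr_gt0.
have de : d <= e / 16 by rewrite /d ge_min lexx orbT.
have fd : inf A <= f d.
  apply: ge_inf => //; first by case: hA.
  exists (d / 2) => /=; last by congr f; field.
  split; [lra|].
  have -> : 2 * (d / 2) = d by field.
  by apply: le_lt_trans em; lra.
have := @trace_gap e d e0 dp (ltac:(lra)).
have g1 : `|s (q e) - b| <= b / 8 by apply: sq => //; lra.
have g2 : `|s (q (2 * e)) - b| <= b / 8 by apply: sq => //; lra.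
have g3 : `|s (q d) - b| <= b / 8 by apply: sq => //; lra.
move: g1 g2 g3; rewrite !ler_norml => /andP[? ?] /andP[? ?] /andP[? ?].
have p1 : 3 / 4 * on (q e) * (f (2 * e) - f d) <= 3 / 4 * (b / 8).
  rewrite -mulrA ler_wpM2l //.
  have -> : b / 8 = (on B + 1) * c by rewrite /c; field; rewrite gt_eqF.
  apply: (@le_trans _ _ (on (q e) * c)); first by rewrite ler_wpM2l ?on_ge0 //; lra.
  by rewrite ler_wpM2r // ltW.
have p2 : 3 / 4 * (d / e) * s (q d) <= 3 / 4 * (16^-1) * (9 / 8 * b).
  apply: ler_pM; try lra.
    by rewrite mulr_ge0 // divr_ge0 // ltW.
  by rewrite ler_wpM2l // ler_pdivrMr // mulrC.
lra.
Qed.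

End BoundaryTrace.

Section PushThrough.
Context {R : realType} {HH : hilbertType R}.
Implicit Types (x y : HH) (a b c k n u : bop HH).

(** The Woodbury formula, and the identity by which the resolvent of the
    compressed operator [n - k a^-1 k'] is traded for the one of
    [a - k' n^-1 k]. *)
Lemma push_through a n k k' : unitb a -> unitb n -> unitb (a - k' * binv n * k) ->
  let u := binv (a - k' * binv n * k) in
  [/\ unitb (n - k * binv a * k'),
      binv (n - k * binv a * k') = binv n + binv n * k * u * k' * binv n &
      binv a * k' * binv (n - k * binv a * k') = u * k' * binv n].
Proof.
move=> ua un uu u.
have u1 : a * u = 1 + k' * binv n * k * u.
  by have := mulbV uu; rewrite -/u mulrBl => /(congr1 (fun w => w + k' * binv n * k * u)); rewrite subrK.
have u2 : u * a = 1 + u * (k' * binv n * k).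
  by have := mulVb uu; rewrite -/u mulrBr => /(congr1 (fun w => w + u * (k' * binv n * k))); rewrite subrK.
have e1 : binv a * (1 + k' * binv n * k * u) = u by rewrite -u1 mulrA mulVb // mul1r.
have e2 : (1 + u * (k' * binv n * k)) * binv a = u by rewrite -u2 -mulrA mulbV // mulr1.
pose v := binv n + binv n * k * u * k' * binv n.
have f1 : binv a * k' * v = u * k' * binv n.
  rewrite -[in RHS]e1 /v; ncring_in (bop HH).
have f2 : v * (k * binv a * k') = binv n * k * u * k'.
  rewrite -[in RHS]e2 /v; ncring_in (bop HH).
have iv : invb (n - k * binv a * k') v.
  split.
    by rewrite mulrBl -!(mulrA k) f1 /v mulrDr !mulrA mulbV // mul1r addrK.
  rewrite mulrBr f2 /v mulrDl -!mulrA mulVb // mulr1 addrK //.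
by split; [exists v|exact: binv_eq|rewrite (binv_eq iv)].
Qed.

(** With [y = (a + i s b) x], the imaginary part of the inner product of [y]
    and [x] gives [|s b x|^2 <= |b| |y| |x|]; this is absorbed in the lower
    bound [c |x| <= |a x| <= |y| + |s b x|], which makes [a + i s b] bounded
    below, uniformly in [s]; so is its adjoint. *)
Lemma sa_im_unit a b : adj a = a -> unitb a -> pos b -> exists2 K : R, 0 <= K &
  forall s : R, -1 <= s <= 1 -> unitb (a + s%:C *: (ib * b)) /\ on (binv (a + s%:C *: (ib * b))) <= K.
Proof.
move=> sa ua pb; have sb := pos_sa pb.
pose c' := on (binv a) + 1; have c'0 : 0 < c' by rewrite ltr_wpDl ?on_ge0.
pose c := c'^-1; have c0 : 0 < c by rewrite invr_gt0.
pose k := c / 2 / (1 + on b / (2 * c)).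
have d0 : 0 < 1 + on b / (2 * c) by rewrite ltr_pwDl // divr_ge0 ?on_ge0 // mulr_ge0 // ltW.
have k0 : 0 < k by rewrite !divr_gt0.
have low (s : R) (x : HH) : -1 <= s <= 1 -> k * nr x <= nr ((a + s%:C *: (ib * b)) x).
  move=> /andP[s0 s1]; set y := (a + s%:C *: (ib * b)) x.
  have ax : c * nr x <= nr (a x).
    rewrite mulrC ler_pdivrMr // mulrC; apply: le_trans (inv_lower x ua) _.
    by rewrite ler_wpM2r ?nr_ge0 // lerDl.
  have yE : y = a x + s%:C *: ('i *: b x) by rewrite /y bDE bZE bME /ib bZE b1E.
  have im : s * rip (b x) x = rip y ('i *: x).
    rewrite yE ripDl dissip_sa // add0r ripZl rip_i; congr (_ * _).
    by rewrite scalerA -expr2 sqrCi scaleN1r ripNr opprK.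
  have bx0 : 0 <= rip (b x) x by exact: pb.2.
  have n1 := nr_ge0 y; have n2 := nr_ge0 x; have n3 := nr_ge0 (b x); have nb := on_ge0 b.
  have q1 : (`|s| * nr (b x)) ^+ 2 <= on b * (nr y * nr x).
    rewrite exprMn; have := pos_nr x pb => h1.
    have h2 : `|s| * rip (b x) x <= nr y * nr x.
      rewrite -[rip (b x) x]ger0_norm // -normrM im -(nr_i x); exact: rip_CS.
    have s2 : `|s| <= 1 by rewrite ler_norml s0.
    apply: (@le_trans _ _ (`|s| * (`|s| * (on b * rip (b x) x)))).
      by rewrite expr2 -mulrA; do 2 apply: ler_wpM2l => //.
    apply: (@le_trans _ _ (1 * (on b * (`|s| * rip (b x) x)))).
      by rewrite mulrCA [`|s| * (on b * _)]mulrCA; apply: ler_wpM2r => //; rewrite !mulr_ge0.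
    by rewrite mul1r ler_wpM2l.
  have q2 : `|s| * nr (b x) <= (c * nr x + on b / c * nr y) / 2.
    have p0 : 0 <= (c * nr x + on b / c * nr y) / 2.
      by rewrite divr_ge0 // addr_ge0 // !mulr_ge0 // ?invr_ge0 ltW.
    have s0' : 0 <= `|s| * nr (b x) by rewrite mulr_ge0.
    rewrite -(ler_pXn2r (n := 2)) ?nnegrE //; apply: le_trans q1 _.
    rewrite -subr_ge0 (_ : _ - _ = ((c * nr x - on b / c * nr y) / 2) ^+ 2) ?sqr_ge0 //.
    by field; rewrite gt_eqF.
  have tri : nr (a x) <= nr y + `|s| * nr (b x).
    have -> : a x = y - s%:C *: ('i *: b x) by rewrite yE addrK.
    by apply: le_trans (nrB _ _) _; rewrite nrZr nr_i.
  have fin : c / 2 * nr x <= (1 + on b / (2 * c)) * nr y.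
    have e : on b / (2 * c) * nr y = (on b / c * nr y) / 2 by field; rewrite gt_eqF.
    rewrite mulrDl mul1r e; lra.
  by rewrite /k mulrAC ler_pdivrMr // [nr y * _]mulrC.
exists k^-1; first by rewrite invr_ge0 ltW.
move=> s hs; apply: lower_bound_inv => // x; first exact: low.
have -> : adj (a + s%:C *: (ib * b)) = a + (- s)%:C *: (ib * b).
  by rewrite adjD sa adjZr adjM sb adj_ib mulrN ibC rmorphN scaleNr scalerN.
by apply: low; case/andP: hs => ? ?; apply/andP; split; lra.
Qed.

End PushThrough.

Section LogInt.
Context {R : realType} {HH : hilbertType R}.
Variables (M : set (HH -> HH)) (M_vN : von_neumann_algebra M).
Implicit Types (x y : HH) (a b c k n : bop HH) (t : R).
Local Notation inM := (inM M).
Variables (sg : bop HH -> R) (sT : tracial M sg).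
Local Notation logint := (logint sg).

(** By [push_through] and cyclicity the two integrands agree pointwise. *)
Lemma logint_push a n k k' : inM a -> inM n -> inM k -> inM k' -> unitb a -> unitb n ->
  (forall t, 0 <= t <= 1 -> unitb (seg a (a - k' * binv n * k) t)) ->
  logint a (a - k' * binv n * k) = logint n (n - k * binv a * k').
Proof.
move=> ha hn hk hk' ua un hu.
have ia := inM_inv M_vN ua ha; have iN := inM_inv M_vN un hn.
apply: intab_ext => t ht.
have e1 : seg a (a - k' * binv n * k) t = a - k' * binv n * (t%:C *: k).
  by rewrite /seg addrAC subrr add0r scalerN bscaleAr.
have e2 : seg n (n - k * binv a * k') t = n - (t%:C *: k) * binv a * k'.
  by rewrite /seg addrAC subrr add0r scalerN !bscaleAl.
have := hu t ht; rewrite e1 => ut; have [_ _] := push_through ua un ut.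
rewrite e2; set u := binv (a - _); set v := binv (n - _) => E.
have uM : inM u.
  apply: inM_inv => //; apply: (inMB M_vN) => //; apply: (inMM M_vN); first exact: inMM.
  exact: inMZ.
have -> : a - k' * binv n * k - a = - (k' * binv n * k) by rewrite addrAC subrr add0r.
have -> : n - k * binv a * k' - n = - (k * binv a * k') by rewrite addrAC subrr add0r.
have m1 := inMM M_vN hk' iN; have m2 := inMM M_vN hk uM.
rewrite !mulNr -!(mulrA k) [binv a * _ * v]E.
have -> : k * (u * k' * binv n) = (k * u) * (k' * binv n) by rewrite !mulrA.
have -> : k' * binv n * k * u = (k' * binv n) * (k * u) by rewrite !mulrA.
by rewrite !(sgN sT); [rewrite (sgC sT)|exact: inMM|exact: inMM].
Qed.

Lemma logint_perturb a b K : inM a -> inM b -> 0 <= K ->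
  (forall t, 0 <= t <= 1 -> unitb (seg a b t) /\ on (binv (seg a b t)) <= K) ->
  forall a' b' e, inM a' -> inM b' -> 2 * K * e <= 1 -> on (a' - a) <= e -> on (b' - b) <= e ->
  (forall t, 0 <= t <= 1 -> unitb (seg a' b' t) /\ on (binv (seg a' b' t)) <= 2 * K) /\
  `|logint a' b' - logint a b| <= e * (4 * K + 2 * K ^+ 2 * on (b - a)).
Proof.
move=> ha hb K0 hK a' b' e ha' hb' Ke ea eb.
have e0 : 0 <= e by apply: le_trans ea; exact: on_ge0.
have d t : 0 <= t <= 1 -> on (seg a' b' t - seg a b t) <= e.
  move=> /andP[t0 t1]; have -> : seg a' b' t - seg a b t = (1 - t)%:C *: (a' - a) + t%:C *: (b' - b).
    rewrite /seg rmorphB rmorph1 scalerBl scale1r !scalerBr; ncring_in (bop HH).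
  apply: le_trans (onD _ _) _.
  have := onZr (1 - t) (a' - a); have := onZr t (b' - b).
  rewrite !ger0_norm ?subr_ge0 //; nra.
have h t : 0 <= t <= 1 -> unitb (seg a' b' t) /\ on (binv (seg a' b' t)) <= 2 * K.
  move=> ht; have [u1 b1] := hK t ht; have n0 := on_ge0 (binv (seg a b t)).
  have [|u2 b2] := @unit_perturb _ _ _ (seg a' b' t) u1.
    apply: le_trans Ke; apply: ler_pM; rewrite ?mulr_ge0 ?on_ge0 ?d //.
    by rewrite ler_wpM2l.
  by split=> //; apply: le_trans b2 _; rewrite ler_wpM2l.
split=> //.
have c1 := logint_cont M_vN sT ha hb hK; have c2 := logint_cont M_vN sT ha' hb' h.
rewrite /logint -intabB // -[leRHS]mulr1 -[X in _ <= _ * X]subr0.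
apply: intab_norm => // [|t ht]; first exact: contabB.
have [u1 b1] := hK t ht; have [u2 b2] := h t ht.
have m1 : inM (seg a b t) by exact: inM_seg. have m2 : inM (seg a' b' t) by exact: inM_seg.
have i1 := inM_inv M_vN u1 m1; have i2 := inM_inv M_vN u2 m2.
have md : inM (b - a) by exact: inMB. have md' : inM (b' - a') by exact: inMB.
rewrite -(sgB M_vN sT); [|exact: inMM|exact: inMM].
apply: le_trans (sgb sT _) _; first by apply: (inMB M_vN); exact: inMM.
have -> : (b' - a') * binv (seg a' b' t) - (b - a) * binv (seg a b t) =
  ((b' - b) - (a' - a)) * binv (seg a' b' t) +
  (b - a) * (binv (seg a' b' t) * (seg a b t - seg a' b' t) * binv (seg a b t)).
  rewrite -(resolvent u2 u1); ncring_in (bop HH).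
apply: le_trans (onD _ _) _; apply: le_trans (lerD (onM _ _) (onM _ _)) _.
have n1 := on_ge0 (binv (seg a b t)); have n2 := on_ge0 (binv (seg a' b' t)).
have n3 := on_ge0 (b - a).
have s1 : on (b' - b - (a' - a)) * on (binv (seg a' b' t)) <= (e + e) * (2 * K).
  apply: ler_pM; rewrite ?on_ge0 //; apply: le_trans (onB _ _) _; exact: lerD.
have s2 : on (binv (seg a' b' t) * (seg a b t - seg a' b' t) * binv (seg a b t)) <= 2 * K * e * K.
  apply: le_trans (onM _ _) _; apply: ler_pM; rewrite ?on_ge0 //.
  apply: le_trans (onM _ _) _; apply: ler_pM; rewrite ?on_ge0 //.
  by rewrite onBC d.
have s3 := ler_wpM2l n3 s2.
apply: le_trans (lerD s1 s3) _; rewrite le_eqVlt; apply/orP; left; apply/eqP; ring.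
Qed.

Lemma dissip_seg (k : R) a b t : 0 <= t <= 1 -> dissip k a -> dissip k b -> dissip k (seg a b t).
Proof.
move=> /andP[t0 t1] da db x.
have -> : seg a b t x = (1 - t)%:C *: a x + t%:C *: b x.
  by rewrite /seg bDE bZE bBE scalerBr rmorphB scalerBl rmorph1 scale1r addrA addrAC.
rewrite ripDl !ripZl; have := da x; have := db x; move: t0 t1.
set X := nr x ^+ 2; move=> t0 t1 h1 h2.
have t1' : 0 <= 1 - t by rewrite subr_ge0.
by have := ler_wpM2l t0 h1; have := ler_wpM2l t1' h2; lra.
Qed.

Lemma dissip_triangle (k : R) a b c : 0 < k -> inM a -> inM b -> inM c ->
  dissip k a -> dissip k b -> dissip k c -> logint a c = logint a b + logint b c.
Proof.
move=> k0 ha hb hc da db dc; apply: (@triangle _ _ _ M_vN _ sT _ _ _ k^-1) => // s t hs ht.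
by apply: dissip_unit => //; apply: dissip_seg => //; exact: dissip_seg.
Qed.

End LogInt.

(** * The Lorentz kernel *)

Section Lorentz.
Context {R : realType}.
Implicit Types (m c e t : R).

Lemma derab_is_derive (F f : R -> R) (a b : R) :
  (forall x : R, is_derive x 1 F (f x)) -> derab a b F f.
Proof.
move=> dF l _ e e0; have [dl] := dF l => e1.
have /cvgrPdist_le/(_ _ e0) :
    (h^-1 *: ((F \o pseudometric_normed_Zmodule.shift l) (h *: 1) - F l)) @[h --> 0^'] --> f l.
  by move: dl; rewrite /derivable -e1 => /cvgP; exact.
rewrite /prop_near1 /= => -[d /= d0 hd]; exists d => // m _ ml.
have [->|ne] := eqVneq m l; first by rewrite !subrr mulr0 subr0 normr0 mulr0.
have h0 : m - l != 0 by rewrite subr_eq0.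
have := hd (m - l); rewrite /= sub0r normrN => /(_ ml h0).
rewrite [(m - l) *: 1]scaler1 subrK => h.
have -> : F m - F l - f l * (m - l) = - (f l - (m - l)^-1 * (F m - F l)) * (m - l) by field.
by rewrite normrM normrN ler_wpM2r.
Qed.

Lemma lorentz_integral m c : 0 < m -> 0 < c ->
  let f t := m * c / (m ^+ 2 * t ^+ 2 + c ^+ 2) in
  contab 0 1 f /\ intab 0 1 f = atan (m / c).
Proof.
move=> m0 c0 f.
have dF : derab 0 1 (fun t => atan (m / c * t)) f.
  apply: derab_is_derive => x.
  have h1 : is_derive x 1 (fun t : R => m / c * t) (m / c).
    have := @is_deriveZ R R R id (m / c) x 1 1 (is_derive_id x 1).
    by rewrite [m / c *: 1]mulr1; exact.
  have := @is_derive1_comp R atan _ x _ _ (is_derive1_atan _) h1.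
  move=> h; apply: is_derive_eq h _; rewrite /f.
  have n1 : m ^+ 2 * x ^+ 2 + c ^+ 2 != 0 by rewrite gt_eqF // ltr_wpDl ?exprn_gt0 // mulr_ge0 ?sqr_ge0.
  have n2 : c != 0 by rewrite gt_eqF.
  have -> : 1 + (m / c * x) ^+ 2 = (m ^+ 2 * x ^+ 2 + c ^+ 2) / c ^+ 2 by field.
  by move: n1; set y := _ + _; clearbody y => n1; field; rewrite n1 n2.
have cf : contab 0 1 f.
  apply: (@contab_lip _ _ _ _ (2 * m ^+ 3 / c ^+ 3)) => l x /andP[l0 l1] /andP[x0 x1].
  have q (y : R) : c ^+ 2 <= m ^+ 2 * y ^+ 2 + c ^+ 2 by rewrite lerDr mulr_ge0 ?sqr_ge0.
  have c2 : 0 < c ^+ 2 by rewrite exprn_gt0.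
  have qp (y : R) : 0 < m ^+ 2 * y ^+ 2 + c ^+ 2 by apply: lt_le_trans (q y).
  have -> : f x - f l = m ^+ 3 * c * (l + x) / ((m ^+ 2 * x ^+ 2 + c ^+ 2) * (m ^+ 2 * l ^+ 2 + c ^+ 2)) * (l - x).
    have fr (y z : R) : y != 0 -> z != 0 -> m * c / y - m * c / z = m * c * (z - y) / (y * z).
      by move=> y0 z0; field; rewrite y0 z0.
    rewrite /f fr ?gt_eqF // [in RHS]mulrAC; congr (_ * _); ring.
  have m3 : 0 <= m ^+ 3 by rewrite exprn_ge0 // ltW.
  have cp : 0 <= c by exact: ltW.
  have lx : 0 <= l + x by rewrite addr_ge0.
  have yx : 0 <= m ^+ 2 * x ^+ 2 + c ^+ 2 by exact: ltW.
  have yl : 0 <= m ^+ 2 * l ^+ 2 + c ^+ 2 by exact: ltW.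
  have A0 : 0 <= m ^+ 3 * c * (l + x) / ((m ^+ 2 * x ^+ 2 + c ^+ 2) * (m ^+ 2 * l ^+ 2 + c ^+ 2)).
    by apply: divr_ge0; [apply: mulr_ge0 => //; exact: mulr_ge0|exact: mulr_ge0].
  rewrite normrM (ger0_norm A0) [`|l - x|]distrC; apply: ler_wpM2r => //.
  rewrite ler_pdivrMr ?mulr_gt0 //.
  apply: (@le_trans _ _ (2 * m ^+ 3 / c ^+ 3 * (c ^+ 2 * c ^+ 2))).
    rewrite (_ : 2 * _ / _ * _ = m ^+ 3 * c * 2); last by field; rewrite gt_eqF.
    by rewrite ler_wpM2l ?mulr_ge0 //; lra.
  have k0 : 0 <= 2 * m ^+ 3 / c ^+ 3 by rewrite divr_ge0 ?exprn_ge0 // mulr_ge0.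
  by rewrite ler_wpM2l // ler_pM // ltW.
split=> //; by rewrite (FTC ler01 cf dF) mulr1 mulr0 atan0 subr0.
Qed.

Lemma atan_near_pihalf eta : 0 < eta -> exists2 X : R, 0 < X & forall x, X <= x -> pi / 2 - eta <= atan x <= pi / 2.
Proof.
move=> eta0; have /cvgrPdist_le/(_ _ eta0) := @cvgy_atan R.
case=> X [Xr hX]; exists (Num.max 1 (X + 1)) => [|x]; first by rewrite lt_max ltr01.
rewrite ge_max => /andP[_ Xx]; have := hX x; rewrite ler_norml => /(_ _)/andP[].
  by apply: lt_le_trans Xx; rewrite ltrDl.
move=> h1 h2; have := atan_ltpi2 x => h3; apply/andP; split; lra.
Qed.

End Lorentz.

(** * Resolvent traces along the path to the sign *)

Section SignPath.
Context {R : realType} {HH : hilbertType R}.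
Implicit Types (x y : HH) (a b c : bop HH) (t e : R).
Variables (M : set (HH -> HH)) (M_vN : von_neumann_algebra M).
Local Notation inM := (inM M).
Variables (s : bop HH -> R) (sP : ptrace M s).
Let sT := ptrace_tracial sP.

Lemma comm_scale (k : R[i]) a b : GRing.comm a b -> GRing.comm a (k *: b).
Proof. by rewrite /GRing.comm bscaleAl bscaleAr => ->. Qed.

Lemma comm_rsq a b e : adj b = b -> e != 0 -> GRing.comm a b -> GRing.comm a (rsq b e).
Proof. by move=> sb e0; exact: rsq_commute. Qed.

(* a polar decomposition [S A] of a self-adjoint operator *)
Variables (S A : bop HH) (SM : inM S) (AM : inM A) (saS : adj S = S) (S3 : S * S * S = S).
Variables (pA : pos A) (AS : GRing.comm A S) (PA : S * S * A = A).
Variables (m : R) (m0 : 0 < m) (Am : on A <= m).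

Local Notation P := (S * S).
Local Notation m1 := (m%:C *: (1 : bop HH)).
Local Notation E := (m1 - A).
(** [Gpath] is the modulus of the path [Tpath] from [S A] to [m S]. *)
Definition Gpath t : bop HH := (1 - t)%:C *: A + (t * m)%:C *: (1 : bop HH).
Definition Tpath t : bop HH := S * Gpath t.
Local Notation G := Gpath.
Local Notation T := Tpath.

Ltac cm := repeat first [exact: commr_refl | exact: commr1 | exact: AS | exact: (commr_sym AS) | assumption
  | apply: commrD | apply: commrB | apply: comm_scale | apply: commrM
  | (apply: commr_sym; first [apply: commrD | apply: commrB | apply: comm_scale | apply: commrM | exact: commr1])].

Let E_pos : pos E. Proof. by apply: pos_norm_sub => //; exact: pos_sa. Qed.
Let P_pos : pos P. Proof. exact: pos_sqr. Qed.
Let G_pos t : 0 <= t <= 1 -> pos (G t).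
Proof.
move=> /andP[t0 t1]; apply: posD; apply: posZ => //; rewrite ?subr_ge0 //; last exact: pos1.
by rewrite mulr_ge0 // ltW.
Qed.
Let AG t : GRing.comm A (G t). Proof. by rewrite /Gpath; cm. Qed.
Let SG t : GRing.comm S (G t). Proof. by rewrite /Gpath; cm. Qed.

Lemma Tpath_sa t : 0 <= t <= 1 -> adj (T t) = T t.
Proof. by move=> ht; rewrite /Tpath adjM saS (pos_sa (G_pos ht)) SG. Qed.

Lemma Tpath_sqr t : T t * T t = P * (G t * G t).
Proof. by rewrite /Tpath -mulrA [G t * (S * _)]mulrA -SG !mulrA. Qed.

Lemma Tpath0 : T 0 = S * A.
Proof. by rewrite /Tpath /Gpath subr0 mul0r scale1r scale0r addr0. Qed.

Lemma Tpath_seg t : T t = seg (S * A) (m%:C *: S) t.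
Proof.
rewrite /Tpath /Gpath /seg mulrDr !bscaleAr mulr1 rmorphB rmorph1 scalerBl scale1r scalerBr.
by rewrite scalerA -rmorphM addrAC addrA.
Qed.

Lemma Tpath_inM t : inM (T t).
Proof. by apply: inMM => //; apply: (inMD M_vN); apply: inMZ => //; exact: inM1. Qed.

(** The path stays above its start ... *)
Lemma Tpath_ge0 t : 0 <= t <= 1 -> pos (T t * T t - T 0 * T 0).
Proof.
move=> ht; have [t0 t1] := andP ht; rewrite !Tpath_sqr -mulrBr.
have -> : G t * G t - G 0 * G 0 = t%:C *: (E * (G t + A)).
  have -> : G 0 = A by rewrite /Gpath subr0 mul0r scale1r scale0r addr0.
  have -> : G t * G t - A * A = (G t - A) * (G t + A) + (A * G t - G t * A) by ncring_in (bop HH).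
  rewrite AG subrr addr0 -bscaleAl; congr (_ * _).
  by rewrite /Gpath rmorphB rmorph1 scalerBl scale1r scalerBr scalerA -rmorphM addrAC addrAC addrC addrA addKr addrC.
apply: pos_mul => //; last by rewrite /GRing.comm; change (GRing.comm P (t%:C *: (E * (G t + A)))); cm.
apply: posZ => //; apply: pos_mul => //; first by apply: posD => //; exact: G_pos.
by change (GRing.comm E (G t + A)); cm.
Qed.

(** ... and grows at least like [m t] on the range of the sign. *)
Lemma Tpath_ge1 t : 0 <= t <= 1 -> pos (T t * T t - ((t * m) ^+ 2)%:C *: P).
Proof.
move=> ht; have [t0 t1] := andP ht; rewrite Tpath_sqr.
set k := t * m; have k0 : 0 <= k by rewrite mulr_ge0 // ltW.
have -> : P * (G t * G t) - (k ^+ 2)%:C *: P = P * ((1 - t)%:C *: (A * (G t + k%:C *: (1 : bop HH)))).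
  rewrite -[X in _ - _ *: X]mulr1 -bscaleAr -mulrBr; congr (_ * _).
  pose I : bop HH := k%:C *: (1 : bop HH); rewrite -/I.
  have -> : (k ^+ 2)%:C *: (1 : bop HH) = I * I by rewrite /I bscaleAl mul1r scalerA -rmorphM.
  rewrite -bscaleAl; have -> : (1 - t)%:C *: A = G t - I by rewrite /Gpath addrK.
  have -> : (G t - I) * (G t + I) = G t * G t - I * I + (G t * I - I * G t) by ncring_in (bop HH).
  by rewrite /I !bscaleAl !bscaleAr !mulr1 !mul1r subrr addr0.
have p1 : pos (k%:C *: (1 : bop HH)) by apply: posZ => //; exact: pos1.
apply: pos_mul => //; last by change (GRing.comm P ((1 - t)%:C *: (A * (G t + k%:C *: (1 : bop HH))))); cm.
apply: posZ; first by rewrite subr_ge0.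
apply: pos_mul => //; first by apply: posD => //; exact: G_pos.
by change (GRing.comm A (G t + k%:C *: (1 : bop HH))); cm.
Qed.

Section Bounds.
Variables (t e : R) (ht : 0 <= t <= 1) (e0 : 0 < e).
Local Notation r := (rsq (T t) e).
Let en : e != 0. Proof. by rewrite gt_eqF. Qed.
Let saT := Tpath_sa ht.
Let r_pos : pos r. Proof. exact: rsq_pos. Qed.
Let Sr : GRing.comm S r. Proof. by apply: comm_rsq => //; rewrite /Tpath; cm. Qed.
Let Ar : GRing.comm A r. Proof. by apply: comm_rsq => //; rewrite /Tpath; cm. Qed.
Let rM : inM r.
Proof.
apply: inM_inv => //; first exact: rsq_unit.
apply: (inMD M_vN); first by apply: (inMM M_vN); exact: Tpath_inM.
by apply: inMZ => //; exact: inM1.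
Qed.

(** Writing [m S - S A = S (m - A)], the bound follows from
    [- S^2 <= S <= S^2] and [0 <= m - A <= m]. *)
Lemma sign_diff_bound : `|s ((m%:C *: S - S * A) * r)| <= m * s (P * r).
Proof.
have hP := inMM M_vN SM SM; have M1 := inM1 M_vN.
have EM : inM E by apply: (inMB M_vN) => //; exact: inMZ.
have SE : m%:C *: S - S * A = S * E by rewrite mulrBr bscaleAr mulr1.
have PS : P * S = S by []. have SP : S * P = S by rewrite mulrA.
have PP : P * P = P by rewrite mulrA S3.
have hP1 : pos (P - S).
  rewrite -(half_scale (P - S)); apply: posZ; first by rewrite invr_ge0.
  have <- : (P - S) * (P - S) = P - S + (P - S).
    transitivity (P * P - P * S - S * P + S * S); first by ncring_in (bop HH).
    by rewrite PP PS SP; ncring_in (bop HH).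
  by apply: pos_sqr; rewrite adjB adjM saS.
have hP2 : pos (P + S).
  rewrite -(half_scale (P + S)); apply: posZ; first by rewrite invr_ge0.
  have <- : (P + S) * (P + S) = P + S + (P + S).
    transitivity (P * P + P * S + S * P + S * S); first by ncring_in (bop HH).
    by rewrite PP PS SP; ncring_in (bop HH).
  by apply: pos_sqr; rewrite adjD adjM saS.
have Er' : pos (E * r) by apply: pos_mul => //; change (GRing.comm E r); apply/commr_sym; cm; apply/commr_sym; cm.
have p1 : pos ((P - S) * (E * r)).
  by apply: pos_mul => //; change (GRing.comm (P - S) (E * r)); cm.
have p2 : pos ((P + S) * (E * r)).
  by apply: pos_mul => //; change (GRing.comm (P + S) (E * r)); cm.
have p3 : pos (A * r) by apply: pos_mul => //; exact: Ar.
have Er := inMM M_vN EM rM.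
have q1 := s_ge0 sP (inMM M_vN (inMB M_vN hP SM) Er) p1.
have q2 := s_ge0 sP (inMM M_vN (inMD M_vN hP SM) Er) p2.
have q3 := s_ge0 sP (inMM M_vN AM rM) p3.
rewrite mulrBl (sgB M_vN sT) in q1; [|exact: inMM|exact: inMM].
rewrite mulrDl (sgD sT) in q2; [|exact: inMM|exact: inMM].
have e3 : m * s (P * r) = s (P * (E * r)) + s (A * r).
  rewrite -(sgZ sT) -?(sgD sT); try by do ?apply: (inMM M_vN).
  congr s; rewrite -{2}PA -(mulrA P A) -mulrDr -mulrDl subrK bscaleAl mul1r bscaleAr //.
rewrite SE -mulrA ler_norml; apply/andP; split; lra.
Qed.

(** By [Tpath_ge0] the resolvents decrease along the path. *)
Lemma sign_path_mono : s (P * r) <= s (P * rsq (T 0) e).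
Proof.
have i0 : 0 <= (0 : R) <= 1 by rewrite lexx ler01.
have sa0 := Tpath_sa i0.
set r0 := rsq (T 0) e; have r0_pos : pos r0 by exact: rsq_pos.
have Sr0 : GRing.comm S r0 by apply: comm_rsq => //; rewrite /Tpath; cm.
have Ar0 : GRing.comm A r0 by apply: comm_rsq => //; rewrite /Tpath; cm.
have r0M : inM r0.
  apply: inM_inv => //; first exact: rsq_unit.
  apply: (inMD M_vN); first by apply: (inMM M_vN); exact: Tpath_inM.
  by apply: inMZ => //; exact: inM1.
have rr0 : GRing.comm r r0 by apply: comm_rsq => //; rewrite Tpath0; cm.
have hP := inMM M_vN SM SM.
apply: (s_le M_vN sP); [exact: inMM|exact: inMM|].
have -> : P * r0 - P * r = P * (r0 * (T t * T t - T 0 * T 0) * r).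
  rewrite -mulrBr; congr (_ * _); rewrite /r0 /rsq resolvent; [|exact: rsq_unit|exact: rsq_unit].
  by congr (_ * _ * _); ncring_in (bop HH).
have rT : GRing.comm r (T t * T t - T 0 * T 0) by rewrite Tpath0 /Tpath /Gpath; cm.
have r0T : GRing.comm r0 (T t * T t - T 0 * T 0) by rewrite Tpath0 /Tpath /Gpath; cm.
have ST : GRing.comm S (T t * T t - T 0 * T 0) by rewrite Tpath0 /Tpath /Gpath; cm.
have pT := Tpath_ge0 ht; set Q := _ - _ in rT r0T ST pT *.
apply: pos_mul => //; last by change (GRing.comm P (r0 * Q * r)); cm.
apply: pos_mul => //; last by change (GRing.comm (r0 * Q) r); cm.
exact: pos_mul.
Qed.

(** By [Tpath_ge1], [(t m)^2 S^2] is at most [T^2 + e^2]. *)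
Lemma sign_path_lorentz : (t * m) ^+ 2 * s (P * r) <= 1.
Proof.
have hP := inMM M_vN SM SM; have hPr := inMM M_vN hP rM.
rewrite -(sgZ sT) // -(s_1 sP); apply: (s_le M_vN sP); [exact: inMZ|exact: inM1|].
have -> : 1 - ((t * m) ^+ 2)%:C *: (P * r) =
   (T t * T t - ((t * m) ^+ 2)%:C *: P) * r + (e ^+ 2)%:C *: r.
  have e1 : (T t * T t + (e ^+ 2)%:C *: (1 : bop HH)) * r = 1 by exact: mulbV (rsq_unit saT en).
  by rewrite -[X in X - _]e1 mulrDl mulrBl !bscaleAl mul1r addrAC.
apply: posD; last by apply: posZ; [exact: sqr_ge0|exact: r_pos].
apply: pos_mul; [exact: Tpath_ge1|exact: r_pos|].
change (GRing.comm (T t * T t - ((t * m) ^+ 2)%:C *: P) r).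
by apply/commr_sym; rewrite /Tpath /Gpath; cm.
Qed.

End Bounds.
End SignPath.

Section SignLimit.
Context {R : realType} {HH : hilbertType R}.
Implicit Types (x y z : HH) (a b c D : bop HH) (t e : R).
Variables (M : set (HH -> HH)) (M_vN : von_neumann_algebra M).
Local Notation inM := (inM M).
Variables (tau : (HH -> HH) -> R[i]) (tauP : normal_tracial_state M tau).
Local Notation s := (retau tau).
Local Notation logi := (logint (imtau tau)).
Let sP := retau_ptrace M_vN tauP.
Let sT := ptrace_tracial sP.
Let iT := imtau_tracial M_vN tauP.

Lemma op_ge0_sub a b : pos (a - b) -> op_ge0 ((a : HH -> HH) - (b : HH -> HH)).
Proof.
move=> /pos_op_ge0 h x; have := h x; rewrite bBE.
by have -> : ((a : HH -> HH) - (b : HH -> HH)) x = a x - b x by [].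
Qed.

Lemma op_ge0_sub_pos a b : op_ge0 ((a : HH -> HH) - (b : HH -> HH)) -> pos (a - b).
Proof.
move=> h; apply: op_ge0_pos => x; rewrite bBE.
by have -> : a x - b x = ((a : HH -> HH) - (b : HH -> HH)) x by [].
Qed.

Lemma imtau_im_part a : inM a -> imtau tau a = s (im_part a).
Proof. by move=> ha; rewrite {1}/imtau (tau_reim M_vN tauP). Qed.

(** [D] commutes with [h], so the imaginary part of [D (h + i e)^-1] is
    [- e D (h^2 + e^2)^-1]. *)
Lemma imtau_mul_res h D e : adj h = h -> inM h -> adj D = D -> inM D -> D * h = h * D -> e != 0 ->
  imtau tau (D * res h e) = - (e * s (D * rsq h e)).
Proof.
move=> sah hM saD DM Dh e0; have ne0 : - e != 0 by rewrite oppr_eq0.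
have inMres d : d != 0 -> inM (res h d).
  move=> d0; apply: inM_inv => //; first exact: sh_unit.
  by apply: (inMD M_vN) => //; do 2 apply: inMZ => //; exact: inM1.
have rM : inM (rsq h e) by rewrite rsqE //; apply: inMM => //; exact: inMres.
have DrM : inM (D * res h e) by apply: (inMM M_vN) => //; exact: inMres.
rewrite imtau_im_part //.
have E : im_part (D * res h e) = - (e%:C *: (D * rsq h e)).
  have := im_res sah 1 e0; rewrite adj1 !mulr1 !mul1r => im.
  rewrite -bscaleAr -mulrN -im /im_part adjM saD (adj_res sah e0) -(res_commute sah ne0 Dh).
  by rewrite -mulrBr !bscaleAr.
rewrite E (sgN sT) ?(sgZ sT) //; first exact: inMM.
by apply: inMZ => //; exact: inMM.
Qed.

Let shift_diff (u v w p q r k : R) (tri : w = u + v) : v - p * (q - r) = (w - (p * q - k)) - (u - (p * r - k)).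
Proof. by rewrite tri; ring. Qed.

Section OneOperator.
Variables (h : bop HH) (sah : adj h = h) (hM : inM h).
Local Notation S := (sgn h).
Local Notation P := (sgn h * sgn h).

Lemma sgn_inM : inM S.
Proof. by apply: (inM_bicomm M_vN hM) => b bh; exact: (sgn_commute sah). Qed.
Let SM := sgn_inM.
Let saS : adj S = S := sgn_sa sah.
Let S3 : S * S * S = S := sgn3 sah.
Let Sh : S * h = h * S := sgn_t sah.

Lemma sgn_on : on S <= 1.
Proof.
have pr : proj P by split; [rewrite adjM saS|rewrite mulrA S3].
have := on_sq S; rewrite saS => h1.
have h2 : on S ^+ 2 <= 1 by apply: le_trans h1 (proj_on pr).
by rewrite -(ler_pXn2r (n := 2)) ?nnegrE ?on_ge0 // expr1n.
Qed.

Lemma sgn_range_mul : P * h = h.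
Proof. by rewrite -mulrA Sh mulrA Sh -mulrA (mul_sgn2 sah). Qed.

Definition Xib : bop HH := neg_proj h + (2^-1 : R)%:C *: ker_proj h.

Lemma inM_Xib : inM Xib.
Proof.
have M1 := inM1 M_vN; have PM := inMM M_vN SM SM.
by apply: (inMD M_vN); apply: inMZ => //; apply: inMB.
Qed.

Lemma trace_sgn : s S = 1 - 2 * s Xib.
Proof.
have M1 := inM1 M_vN; have PM := inMM M_vN SM SM.
have N1 : inM (neg_proj h) by apply: inMZ => //; exact: inMB.
have N2 : inM (ker_proj h) by exact: inMB.
have N2' : inM ((2^-1 : R)%:C *: ker_proj h) by exact: inMZ.
rewrite /Xib (sgD sT) // (sgZ sT) //.
have PS := inMB M_vN PM SM.
by rewrite /neg_proj /ker_proj (sgZ sT _ PS) !(sgB M_vN sT) // (s_1 sP); field.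
Qed.

(** Normality enters here: [1 - e^2 (h^2 + e^2)^-1] increases, as [e] decreases,
    to the range projection [S^2] of [h]. *)
Lemma range_resolvent_small eta : 0 < eta -> exists2 d, 0 < d &
  forall e, 0 < e -> e < d -> e ^+ 2 * s (P * rsq h e) <= eta.
Proof.
have PM := inMM M_vN SM SM; have M1 := inM1 M_vN.
have Pr : proj P by split; [rewrite adjM saS|rewrite mulrA S3].
pose g e : bop HH := 1 - (e ^+ 2)%:C *: rsq h e.
have rM e : e != 0 -> inM (rsq h e).
  move=> e0; apply: inM_inv => //; first exact: rsq_unit.
  by apply: (inMD M_vN); [exact: inMM|exact: inMZ].
have gM e : e != 0 -> inM (g e) by move=> e0; apply: inMB => //; apply: inMZ => //; exact: rM.
have ge e : e != 0 -> g e = h * h * rsq h e by move=> e0; rewrite mul_rsq.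
have PgE e : e != 0 -> P - g e = (e ^+ 2)%:C *: (P * rsq h e).
  move=> e0; have -> : g e = P * g e by rewrite ge // !mulrA sgn_range_mul.
  by rewrite /g mulrBr mulr1 bscaleAr opprB addrC subrK.
have sag e : e != 0 -> adj (g e) = g e.
  by move=> e0; rewrite adjB adj1 adjZr (pos_sa (rsq_pos sah e0)).
have Pr_pos e : e != 0 -> pos (P * rsq h e).
  move=> e0; apply: pos_mul; [exact: pos_sqr|exact: rsq_pos|].
  by apply: rsq_commute => //; rewrite sgn_range_mul mulrA -Sh -mulrA -Sh mulrA sgn_range_mul.
have g_mono e d : 0 < d -> d <= e -> pos (g d - g e).
  move=> d0 de; have e0 : 0 < e by apply: lt_le_trans de.
  have dn : d != 0 by rewrite gt_eqF. have en : e != 0 by rewrite gt_eqF.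
  have -> : g d - g e = (e ^+ 2 - d ^+ 2)%:C *: (h * h * (rsq h d * rsq h e)).
    by rewrite !ge // -mulrBr (rsqB sah dn en) bscaleAr.
  apply: posZ; first by rewrite subr_ge0 ler_sqr ?nnegrE // ltW.
  have c1 : h * h * rsq h d = rsq h d * (h * h) by apply: rsq_commute => //; rewrite mulrA.
  have c2 : h * h * rsq h e = rsq h e * (h * h) by apply: rsq_commute => //; rewrite mulrA.
  apply: pos_mul; [exact: pos_sqr| |].
    by apply: pos_mul; [exact: rsq_pos|exact: rsq_pos|exact: rsq_comm].
  by rewrite mulrA c1 -mulrA c2 mulrA.
pose Dset := [set A : HH -> HH | exists2 e, 0 < e & A = g e].
have dir : op_directed Dset.
  split; first by exists (g 1), 1.
  move=> _ _ [e e0 ->] [d d0 ->]; exists (g (Num.min e d)); split.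
  - by exists (Num.min e d) => //; rewrite lt_min e0.
  - by apply: op_ge0_sub; apply: g_mono; rewrite ?lt_min ?e0 // ge_min lexx.
  - by apply: op_ge0_sub; apply: g_mono; rewrite ?lt_min ?e0 // ge_min lexx orbT.
have weak x eta' : 0 < eta' -> exists2 e, 0 < e & rip (P x) x <= rip (g e x) x + eta'.
  move=> p0; have n1 : 0 < nr x + 1 by rewrite ltr_wpDl ?nr_ge0.
  have q0 : 0 < eta' / (2 * (nr x + 1)) by rewrite divr_gt0 // mulr_gt0.
  have [z hz] := sgn_range sah x q0.
  have z1 : 0 < nr z + 1 by rewrite ltr_wpDl ?nr_ge0.
  pose k := eta' / (4 * (nr x + 1) * (nr z + 1)).
  have k0 : 0 < k by rewrite divr_gt0 // !mulr_gt0.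
  pose e := Num.min 1 k; have e0 : 0 < e by rewrite lt_min ltr01.
  have en : e != 0 by rewrite gt_eqF. have ne : - e != 0 by rewrite oppr_eq0.
  have [e1 ek] : e <= 1 /\ e <= k by rewrite /e !ge_min !lexx orbT.
  exists e => //; rewrite -lerBlDl -ripBl -[P x - _]bBE PgE // bZE ripZl.
  have rle w : e ^+ 2 * nr (rsq h e w) <= nr w.
    rewrite rsqE // bME; have [_ re] := sh_unit_pos sah e0.
    have re' : on (res h (- e)) <= e^-1 by rewrite -(adj_res sah en) on_adj.
    have i0 : 0 <= e^-1 by rewrite invr_ge0 ltW.
    have h1 := le_trans (nr_on (res h (- e)) w) (ler_wpM2r (nr_ge0 w) re').
    have h2 := le_trans (nr_on (res h e) _) (ler_pM (on_ge0 _) (nr_ge0 _) re h1).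
    apply: le_trans (ler_wpM2l (sqr_ge0 e) h2) _.
    by rewrite le_eqVlt; apply/orP; left; apply/eqP; field.
  have gz : nr (g e z) <= 2 * nr z.
    rewrite /g bBE b1E bZE; apply: le_trans (nrB _ _) _.
    by rewrite nrZr ger0_norm ?sqr_ge0 //; have := rle z; lra.
  have Pr_comm : P * rsq h e = rsq h e * P.
    by apply: rsq_commute => //; rewrite sgn_range_mul mulrA -Sh -mulrA -Sh mulrA sgn_range_mul.
  have b1 : e ^+ 2 * nr (rsq h e (P x)) <= eta' / (2 * (nr x + 1)) + e ^+ 2 * (2 * nr z).
    have -> : P x = (P x - h (h z)) + h (h z) by rewrite subrK.
    rewrite bopD; apply: le_trans (ler_wpM2l (sqr_ge0 e) (nrD _ _)) _; rewrite mulrDr; apply: lerD.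
      by apply: le_trans (rle _) _; rewrite -bME in hz; exact: ltW.
    apply: ler_wpM2l; first exact: sqr_ge0.
    suff -> : rsq h e (h (h z)) = g e z by [].
    have hh : h * h * rsq h e = rsq h e * (h * h) by apply: rsq_commute => //; rewrite mulrA.
    by rewrite ge // hh !bME.
  rewrite Pr_comm bME; apply: le_trans (ler_norm _) _.
  rewrite normrM ger0_norm ?sqr_ge0 //.
  apply: le_trans (ler_wpM2l (sqr_ge0 e) (rip_CS _ _)) _; rewrite mulrA.
  apply: le_trans (ler_wpM2r (nr_ge0 x) b1) _.
  have e2 : e ^+ 2 <= k by rewrite expr2; apply: le_trans ek; rewrite ler_piMl // ltW.
  have n0 := nr_ge0 x; have nz := nr_ge0 z.
  have c1 : eta' / (2 * (nr x + 1)) * nr x <= eta' / 2.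
    rewrite mulrAC ler_pdivrMr ?mulr_gt0 //.
    rewrite (_ : eta' / 2 * _ = eta' * (nr x + 1)); last by field.
    by rewrite ler_pM2l // lerDl.
  have c2 : e ^+ 2 * (2 * nr z) * nr x <= eta' / 2.
    apply: (@le_trans _ _ (k * (2 * (nr z + 1)) * (nr x + 1))).
      have z2 : 0 <= 2 * nr z by rewrite mulr_ge0.
      have ee := sqr_ge0 e; apply: ler_pM => //; [exact: mulr_ge0| |lra].
      by apply: ler_pM => //; lra.
    rewrite le_eqVlt; apply/orP; left; apply/eqP; rewrite /k; field.
    by rewrite !gt_eqF.
  by rewrite mulrDl; lra.
have sup : op_supremum M Dset P.
  split=> //; first by rewrite adjointE Pr.1.
    move=> _ [e e0 ->]; apply: op_ge0_sub; rewrite PgE ?gt_eqF //.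
    by apply: posZ; [exact: sqr_ge0|apply: Pr_pos; rewrite gt_eqF].
  move=> T TM saT hT; have bT := M_bounded M_vN TM.
  have sab : adj (Bop bT) = Bop bT by apply: bop_inj; rewrite -adjointE.
  apply: (@op_ge0_sub (Bop bT) P); split; first by rewrite adjB sab Pr.1.
  move=> x; rewrite bBE ripBl subr_ge0; apply/ler_addgt0Pr => eta' p0.
  have [e e0 he] := weak x _ p0; apply: le_trans he _; rewrite lerD2r.
  have := hT (g e) (ex_intro2 _ _ e e0 erefl) => /(@op_ge0_sub_pos (Bop bT) (g e))[_ /(_ x)].
  by rewrite bBE ripBl subr_ge0.
have Dsub : Dset `<=` [set A | M A /\ adjoint A = A].
  by move=> _ [e e0 ->]; split; [apply: gM|rewrite adjointE sag]; rewrite ?gt_eqF.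
have [_ _ _ _ /(_ _ _ Dsub dir sup)] := tauP.
move=> [_ lb] eta0.
have [[e e0 he]|] := pselect (exists2 e, 0 < e & s P - s (g e) <= eta).
  exists e => // d d0 de; have dn : d != 0 by rewrite gt_eqF. have en : e != 0 by rewrite gt_eqF.
  have -> : d ^+ 2 * s (P * rsq h d) = s P - s (g d).
    rewrite -(sgB M_vN sT) //; last exact: gM.
    by rewrite PgE // (sgZ sT) //; apply: (inMM M_vN) => //; exact: rM.
  apply: le_trans he; rewrite lerD2l lerN2; apply: (s_le M_vN sP); [exact: gM|exact: gM|].
  exact: g_mono (ltW de).
move=> H; exfalso; have := lb (tau P - eta%:C).
have imP : imtau tau P = 0 by case: (tau_sa_bound M_vN tauP PM Pr.1).
have : ubound (tau @` Dset) (tau P - eta%:C).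
  move=> _ [_ [e e0 ->] <-]; have en : e != 0 by rewrite gt_eqF.
  have img : imtau tau (g e) = 0 by case: (tau_sa_bound M_vN tauP (gM _ en) (sag _ en)).
  have lt : eta < s P - s (g e) by rewrite ltNge; apply/negP => le; apply: H; exists e.
  move: imP img lt; rewrite lecE /retau /imtau; case: (tau P) => u v; case: (tau (g e)) => u' v' /=.
  by move=> -> -> lt; rewrite subr0 eqxx /=; lra.
move=> ub /(_ ub); rewrite lecE; case: (tau P) => u v /= /andP[_]; lra.
Qed.

Lemma seg_sh a b t e : seg (sh a e) (sh b e) t = sh (seg a b t) e.
Proof. by rewrite /seg /sh opprD addrACA subrr addr0 addrAC. Qed.

Lemma sh_sub a b e : sh b e - sh a e = b - a.
Proof. by rewrite /sh opprD addrACA subrr addr0. Qed.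

Let m : R := on h + 1.
Let m0 : 0 < m. Proof. by rewrite ltr_wpDl ?on_ge0. Qed.
Let J : bop HH := m%:C *: S.
Let JM : inM J. Proof. exact: inMZ. Qed.
Let saJ : adj J = J. Proof. by rewrite adjZr saS. Qed.
Let AM : inM (S * h). Proof. exact: inMM. Qed.
Let AS : GRing.comm (S * h) S. Proof. by rewrite /GRing.comm -mulrA Sh. Qed.
Let PA : P * (S * h) = S * h. Proof. by rewrite mulrA S3. Qed.
Let Am : on (S * h) <= m.
Proof.
apply: le_trans (onM _ _) _; apply: (@le_trans _ _ (1 * on h)); last by rewrite mul1r lerDl.
by apply: ler_wpM2r; [exact: on_ge0|exact: sgn_on].
Qed.
Let hE : S * (S * h) = h. Proof. by rewrite mulrA sgn_range_mul. Qed.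
Let shM a e : inM a -> inM (sh a e).
Proof. by move=> ha; apply: (inMD M_vN) => //; do 2 apply: inMZ => //; exact: inM1. Qed.

Let dis a e : adj a = a -> dissip e (sh a e).
Proof. by move=> sa; rewrite -[X in dissip X]add0r; apply/sh_dissip/sa_dissip. Qed.

Let logi_cont a b e : inM a -> inM b -> adj a = a -> adj b = b -> 0 < e ->
  contab 0 1 (fun t => imtau tau ((sh b e - sh a e) * binv (seg (sh a e) (sh b e) t))).
Proof.
move=> ha hb saa sab e0; apply: (logint_cont (K := e^-1) M_vN iT (shM _ ha) (shM _ hb)) => t ht.
by apply: dissip_unit => //; apply: dissip_seg => //; exact: dis.
Qed.

(** Along the path from [h] to [J] the integrand is at most
    [x = e m s (S^2 (T^2 + e^2)^-1)].  The bounds [x c^2 <= e m], with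
    [c = e / q], and [x (m t)^2 <= e m] together give a Lorentz kernel of
    width [c / m], whose integral is at most [pi q]. *)
Lemma logint_to_sign eta : 0 < eta -> exists2 d, 0 < d &
  forall e, 0 < e -> e < d -> `|logi (sh h e) (sh J e)| <= eta.
Proof.
move=> eta0; pose q := eta / pi; have q0 : 0 < q by rewrite divr_gt0 ?pi_gt0.
have [d d0 hd] := range_resolvent_small (exprn_gt0 2 q0).
exists d => // e e0 ed; have en : e != 0 by rewrite gt_eqF.
pose c := e / q; have c0 : 0 < c by rewrite divr_gt0.
have [cl il] := lorentz_integral m0 c0.
pose g t := 2 * q * (m * c / (m ^+ 2 * t ^+ 2 + c ^+ 2)).
have cg : contab 0 1 g := contabZ (2 * q) cl.
have bnd t : 0 <= t <= 1 ->
    `|imtau tau ((sh J e - sh h e) * binv (seg (sh h e) (sh J e) t))| <= g t.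
  move=> ht; rewrite sh_sub seg_sh -/(res _ e).
  have TE : seg h J t = Tpath S (S * h) m t by rewrite Tpath_seg hE.
  have saT := Tpath_sa saS (sgn_abs sah) AS m0 ht.
  have TM := Tpath_inM M_vN SM AM m t.
  have DT : (J - h) * Tpath S (S * h) m t = Tpath S (S * h) m t * (J - h).
    rewrite -TE; change (GRing.comm (J - h) (h + t%:C *: (J - h))).
    have hD : GRing.comm (J - h) h by rewrite /GRing.comm mulrBl mulrBr /J bscaleAl bscaleAr Sh.
    by apply: commrD => //; apply: comm_scale; exact: commr_refl.
  rewrite TE (imtau_mul_res saT TM _ _ DT en); [|by rewrite adjB saJ sah|exact: inMB].
  rewrite normrN normrM (gtr0_norm e0).
  have := sign_diff_bound M_vN sP SM AM saS S3 (sgn_abs sah) AS PA m0 Am ht e0; rewrite hE.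
  set X := s (P * _) => b1.
  have b2 : X <= s (P * rsq h e).
    have := sign_path_mono M_vN sP SM AM saS (sgn_abs sah) AS m0 Am ht e0.
    by rewrite [Tpath S (S * h) m 0]Tpath0 hE.
  have b3 : (t * m) ^+ 2 * X <= 1.
    exact: (sign_path_lorentz M_vN sP SM AM saS (sgn_abs sah) AS m0 ht e0).
  have b4 := hd e e0 ed.
  have mt : 0 < m ^+ 2 * t ^+ 2 + c ^+ 2 by rewrite ltr_wpDl ?exprn_gt0 // mulr_ge0 ?sqr_ge0.
  have -> : g t = 2 * m * e / (m ^+ 2 * t ^+ 2 + c ^+ 2).
    have cq : q * c = e by rewrite /c mulrC divfK // gt_eqF.
    by rewrite /g mulrA; congr (_ / _); rewrite mulrACA cq.
  apply: (@le_trans _ _ (e * (m * X))); first by apply: ler_wpM2l => //; exact: ltW.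
  rewrite ler_pdivlMr //.
  have c1 : X * c ^+ 2 <= 1.
    rewrite /c exprMn exprVn mulrA ler_pdivrMr ?exprn_gt0 // mul1r; apply: le_trans b4.
    by rewrite mulrC ler_wpM2l ?sqr_ge0.
  have c2 : X * (m ^+ 2 * t ^+ 2) <= 1.
    by rewrite (_ : X * _ = (t * m) ^+ 2 * X) //; ring.
  rewrite (_ : e * (m * X) * _ = m * e * (X * (m ^+ 2 * t ^+ 2) + X * c ^+ 2)); last by ring.
  rewrite (_ : 2 * m * e = m * e * 2); last by ring.
  by apply: ler_wpM2l; [rewrite mulr_ge0 ?ltW|lra].
have cf := logi_cont hM JM sah saJ e0.
have ig : intab 0 1 g <= eta.
  rewrite intabZ // il; have at1 := atan_ltpi2 (m / c).
  apply: (@le_trans _ _ (2 * q * (pi / 2))).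
    by apply: ler_wpM2l; [rewrite mulr_ge0 // ltW|exact: ltW].
  have half2 (x y : R) : 2 * x * (y / 2) = x * y by field.
  by rewrite half2 /q divfK // gt_eqF // pi_gt0.
rewrite ler_norml; apply/andP; split.
  apply: (@le_trans _ _ (intab 0 1 (fun t => - 1 * g t))).
    by rewrite intabZ // mulN1r lerN2.
  apply: intab_le => //; first exact: contabZ.
  by move=> t /bnd; rewrite ler_norml mulN1r => /andP[].
by apply: le_trans ig; apply: intab_le => // t /bnd; rewrite ler_norml => /andP[].
Qed.

(** The integrand is explicit because [S (k^2 S^2 + e^2)^-1] equals
    [S / (k^2 + e^2)]. *)
Lemma logint_sign e : 0 < e -> logi (sh 0 e) (sh J e) = - (atan (m / e) * s S).
Proof.
move=> e0; have en : e != 0 by rewrite gt_eqF.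
have [cl il] := lorentz_integral m0 e0.
rewrite -il mulrC -mulNr -intabZ //; apply: intab_ext => t ht.
rewrite sh_sub seg_sh -/(res _ e) subr0.
have -> : seg 0 J t = (t * m)%:C *: S by rewrite /seg subr0 add0r /J scalerA -rmorphM.
set k := t * m; have sak : adj (k%:C *: S) = k%:C *: S by rewrite adjZr saS.
have kM : inM (k%:C *: S) by exact: inMZ.
rewrite (imtau_mul_res sak kM saJ JM _ en); last by rewrite /J !bscaleAl !bscaleAr !scalerA mulrC.
set r := rsq _ e; have rM : inM r.
  apply: inM_inv => //; first exact: rsq_unit.
  by apply: (inMD M_vN); [exact: inMM|apply: inMZ => //; exact: inM1].
have SrM : inM (S * r) by exact: inMM.
have ke : 0 < k ^+ 2 + e ^+ 2 by rewrite ltr_wpDl ?exprn_gt0 ?sqr_ge0.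
have Er : s S = (k ^+ 2 + e ^+ 2) * s (S * r).
  rewrite -(sgZ sT) //; congr s.
  have u1 : (k%:C *: S * (k%:C *: S) + (e ^+ 2)%:C *: (1 : bop HH)) * r = 1.
    by apply: mulbV; exact: rsq_unit.
  rewrite -[LHS]mulr1 -u1 bscaleAl bscaleAr scalerA -rmorphM mulrA mulrDr !bscaleAr mulr1.
  by rewrite mulrA S3 -scalerDl -rmorphD bscaleAl expr2.
rewrite /J bscaleAl (sgZ sT) // Er /k.
have n0 : m ^+ 2 * t ^+ 2 + e ^+ 2 != 0.
  by move: ke; rewrite /k exprMn mulrC => /lt0r_neq0.
rewrite exprMn [t ^+ 2 * _]mulrC; set y := _ + e ^+ 2 in n0 *; clearbody y.
by field.
Qed.

(** The path from [i e] to [h + i e] is replaced by the two sides through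
    [J + i e], and [s S = 1 - 2 s (Xi h)]. *)
Lemma logint_from_zero eta : 0 < eta -> exists2 d, 0 < d &
  forall e, 0 < e -> e < d ->
    `|logi (sh 0 e) (sh h e) - (pi * s Xib - pi / 2)| <= eta.
Proof.
move=> eta0; have e2 : 0 < eta / 2 by rewrite divr_gt0.
have [d d0 hd] := logint_to_sign e2.
have sS0 : 0 <= `|s S| by [].
have p0 : 0 < eta / (2 * (`|s S| + 1)) by rewrite divr_gt0 // mulr_gt0 // ltr_wpDl.
have [X X0 hX] := atan_near_pihalf p0.
exists (Num.min d (m / X)) => [|e e0]; first by rewrite lt_min d0 divr_gt0.
rewrite lt_min => /andP[/(hd _ e0) h1 h2].
have {h2} /hX /andP[a1 a2] : X <= m / e.
  by rewrite ler_pdivlMr // mulrC; move: h2; rewrite ltr_pdivlMr // => /ltW.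
have M0 := inM0 M_vN; have sa0 : adj (0 : bop HH) = 0 := adj0.
have tri := dissip_triangle M_vN iT e0 (shM e M0) (shM e hM) (shM e JM) (dis e sa0) (dis e sah) (dis e saJ).
rewrite logint_sign // in tri.
have -> : logi (sh 0 e) (sh h e) - (pi * s Xib - pi / 2) =
   (pi / 2 - atan (m / e)) * s S - logi (sh h e) (sh J e).
  have -> : logi (sh 0 e) (sh h e) = - (atan (m / e) * s S) - logi (sh h e) (sh J e) by rewrite tri addrK.
  by rewrite trace_sgn; field.
rewrite [leRHS]splitr; apply: le_trans (ler_normB _ _) (lerD _ h1).
rewrite normrM ger0_norm; last by rewrite subr_ge0.
apply: (@le_trans _ _ (eta / (2 * (`|s S| + 1)) * (`|s S| + 1))).
  by apply: ler_pM => //; [rewrite subr_ge0|rewrite lerBlDr addrC -lerBlDr|rewrite lerDl].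
rewrite le_eqVlt; apply/orP; left; apply/eqP; field.
by rewrite gt_eqF // ltr_wpDl.
Qed.

End OneOperator.

(** The boundary values of the logarithm: [Im log] jumps from [0] to [pi] at the
    origin, and [Xi] records this jump. *)
Lemma logint_limit a b eta : adj a = a -> inM a -> adj b = b -> inM b -> 0 < eta ->
  exists2 d, 0 < d & forall e, 0 < e -> e < d ->
    `|logi (sh a e) (sh b e) - pi * (s (Xib b) - s (Xib a))| <= eta.
Proof.
move=> saa aM sab bM eta0; have e2 : 0 < eta / 2 by rewrite divr_gt0.
have [d d0 hd] := logint_from_zero saa aM e2; have [c c0 hc] := logint_from_zero sab bM e2.
exists (Num.min d c) => [|e e0]; first by rewrite lt_min d0.
rewrite lt_min => /andP[/(hd _ e0) h1 /(hc _ e0) h2].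
have shM c' : inM c' -> inM (sh c' e).
  by move=> hx; apply: (inMD M_vN) => //; do 2 apply: inMZ => //; exact: inM1.
have dis c' : adj c' = c' -> dissip e (sh c' e).
  by move=> sa; rewrite -[X in dissip X]add0r; apply/sh_dissip/sa_dissip.
have M0 := inM0 M_vN; have sa0 : adj (0 : bop HH) = 0 := adj0.
have tri := dissip_triangle M_vN iT e0 (shM _ M0) (shM _ aM) (shM _ bM) (dis _ sa0) (dis _ saa) (dis _ sab).
rewrite (@shift_diff _ _ _ _ _ _ (pi / 2) tri).
by rewrite [leRHS]splitr; apply: le_trans (ler_normB _ _) (lerD h2 h1).
Qed.

End SignLimit.

(** * The index identity *)

Section Index.
Context {R : realType} {HH : hilbertType R}.
Implicit Types (x y : HH) (a b c : bop HH) (t e : R).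
Variables (M : set (HH -> HH)) (M_vN : von_neumann_algebra M).
Local Notation inM := (inM M).

(** A commutant is closed in norm. *)
Lemma inM_lim a : (forall eta, 0 < eta -> exists2 b, inM b & on (b - a) <= eta) -> inM a.
Proof.
move=> h; apply/(inM_commP M_vN) => c hc; apply/eqP; rewrite -subr_eq0; apply/eqP.
apply: on_eq0; apply/ler_addgt0Pr => eta eta0; rewrite add0r.
have c0 : 0 < 2 * (on c + 1) by rewrite mulr_gt0 // ltr_wpDl ?on_ge0.
have [b hb ab] := h _ (divr_gt0 eta0 c0).
have cb : b * c = c * b by have /(inM_commP M_vN) := hb; exact.
have -> : a * c - c * a = c * (b - a) - (b - a) * c.
  rewrite mulrBr mulrBl cb; ncring_in (bop HH).
apply: le_trans (onB _ _) _; have h1 := onM c (b - a); have h2 := onM (b - a) c.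
have n0 := on_ge0 c.
have h3 : on c * on (b - a) <= eta / 2.
  apply: (@le_trans _ _ ((on c + 1) * (eta / (2 * (on c + 1))))).
    by apply: ler_pM => //; [exact: on_ge0|rewrite lerDl].
  rewrite le_eqVlt; apply/orP; left; apply/eqP; field.
  by rewrite gt_eqF // ltr_wpDl.
rewrite [leRHS]splitr; apply: lerD; first exact: le_trans h1 h3.
by apply: le_trans h2 _; rewrite mulrC.
Qed.

Variables (tau : (HH -> HH) -> R[i]) (tauP : normal_tracial_state M tau).
Local Notation s := (retau tau).
Local Notation logi := (logint (imtau tau)).
Let sP := retau_ptrace M_vN tauP.
Let sT := ptrace_tracial sP.
Let iT := imtau_tracial M_vN tauP.

Lemma seg_subr a b t : seg a (a - b) t = a - t%:C *: b.
Proof. by rewrite /seg addrAC subrr add0r scalerN. Qed.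

Lemma on_sh a e : 0 <= e -> on (sh a e - a) <= e.
Proof.
move=> e0; rewrite /sh addrAC subrr add0r; apply: le_trans (onZr _ _) _.
rewrite ger0_norm // ler_piMr // /ib; apply: le_trans (on_i _) _; exact: on1.
Qed.

Lemma inM_sh a e : inM a -> inM (sh a e).
Proof. by move=> ha; apply: (inMD M_vN) => //; do 2 apply: inMZ => //; exact: inM1. Qed.

Let four_dist (u v w p q x1 x2 x3 x4 : R) : `|u - p * (x1 - x2)| <= q ->
  `|v - p * (x3 - x4)| <= q -> `|v + w - u| <= q -> `|w| <= q ->
  `|p * (x1 - x2 - (x3 - x4))| <= 4 * q.
Proof.
rewrite [p * (_ - _ - _)]mulrBr; move: (p * (x1 - x2)) (p * (x3 - x4)) => y1 y2; rewrite !ler_norml.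
move=> /andP[? ?] /andP[? ?] /andP[? ?] /andP[? ?]; apply/andP; split; lra.
Qed.

Variables (h k n L : bop HH).
Hypotheses (hM : inM h) (sah : adj h = h) (kM : inM k) (nM : inM n) (san : adj n = n).
Hypotheses (un : unitb n).
Hypothesis limL : forall eta, 0 < eta -> exists2 d, 0 < d &
  forall e, 0 < e -> e < d -> on (k * res h e * adj k - L) <= eta.

Let NN : bop HH := n - L.
Let A : bop HH := re_part NN.
Let B : bop HH := - im_part L.

Let resM e : e != 0 -> inM (res h e).
Proof. by move=> e0; apply: inM_inv => //; [exact: sh_unit|exact: inM_sh]. Qed.
Let kM' : inM (adj k). Proof. exact: inM_adj. Qed.

Lemma boundary_inM : inM L.
Proof.
apply: inM_lim => eta /limL[d d0 hd]; have e0 : 0 < d / 2 by rewrite divr_gt0.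
exists (k * res h (d / 2) * adj k); last by apply: hd => //; lra.
by do 2 apply: (inMM M_vN) => //; apply: resM; rewrite gt_eqF.
Qed.
Let LM := boundary_inM.
Let NNM : inM NN. Proof. exact: inMB. Qed.
Let AM : inM A. Proof. exact: inM_re_part. Qed.
Let B_pos : pos B := neg_im_limit_pos sah limL.
Let B0 : s B = 0 := im_limit_trace0 M_vN sP hM sah kM LM limL.
Let BM : inM B. Proof. by apply: (inMN M_vN); exact: inM_im_part. Qed.

Lemma im_part_sa0 a : adj a = a -> im_part a = 0.
Proof. by move=> sa; rewrite /im_part sa subrr !scaler0. Qed.

Lemma im_boundary : im_part NN = B.
Proof. by rewrite /NN im_partD im_partN im_part_sa0 // add0r. Qed.

Lemma boundary_cartesian : NN = A + ib * B.
Proof. by rewrite [LHS]re_imE im_boundary ibE. Qed.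

(** This is [trace0_mul] for [b = Im nn], whose trace is zero. *)
Lemma trace_boundary_im c : inM c -> imtau tau (ib * B * c) = 0 /\ s (ib * B * c) = 0.
Proof.
move=> cM; have BcM := inMM M_vN BM cM.
have Bi b : inM b -> s (B * b) = 0 by move=> bM; have := (trace0_mul M_vN sP BM B_pos B0 bM).
have icM : inM (ib * c) by apply: (inMM M_vN) => //; apply: inMZ => //; exact: inM1.
rewrite -mulrA; split; last by rewrite mulrA -ibC -mulrA Bi.
rewrite -ibE (imtau_re M_vN tauP); last exact: inMZ.
by rewrite scalerA -expr2 sqrCi scaleN1r opprK Bi.
Qed.

Hypothesis uA : unitb A.

(** For small [e] and [d],
    [logint (h + i e) (h1 + i e) = logint n n_e] with
    [n_e = n - k (h + i e)^-1 k^*], which is close to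
    [logint (n + i d) (n_e + i d)], hence to the sum of
    [logint (n + i d) (A + i d)] and [logint (A + i d) (n_e + i d)]; the last
    term is close to [logint A nn = 0]. *)
Theorem index_identity :
  s (Xib (h - adj k * binv n * k)) - s (Xib h) = s (Xib A) - s (Xib n).
Proof.
set h1 := h - _; have inM_n := inM_inv M_vN un nM.
have saV : adj (adj k * binv n * k) = adj k * binv n * k.
  by rewrite !adjM adjK (adj_binv un) san mulrA.
have sah1 : adj h1 = h1 by rewrite adjB sah saV.
have h1M : inM h1 by apply: (inMB M_vN) => //; do 2 apply: (inMM M_vN) => //.
have saA : adj A = A := re_part_sa _.
have [K K0 hK] := sa_im_unit saA uA B_pos.
have segA t : seg A NN t = A + t%:C *: (ib * B).
  by rewrite /seg boundary_cartesian addrAC subrr add0r.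
have hKA t : 0 <= t <= 1 -> unitb (seg A NN t) /\ on (binv (seg A NN t)) <= K.
  by move=> /andP[t0 t1]; rewrite segA; apply: hK; apply/andP; split; lra.
have log0 : logi A NN = 0.
  rewrite /logint (@intab_ext _ _ _ _ (fun=> 0)) ?intab_cst ?mul0r // => t ht.
  rewrite {1}boundary_cartesian addrAC subrr add0r.
  refine (trace_boundary_im _).1; apply: inM_inv => //; first by case: (hKA t ht).
  exact: inM_seg.
have pi0 : 0 < pi :> R := pi_gt0 R.
apply/eqP; rewrite -subr_eq0; apply/eqP; set X := _ - _ - _.
apply: (@small_eq0 _ _ 4) => // eta eta0.
have eta' : 0 < pi * eta by rewrite mulr_gt0.
pose C := 4 * K + 2 * K ^+ 2 * on (NN - A).
have C0 : 0 <= C by rewrite addr_ge0 // !mulr_ge0 ?on_ge0.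
(* the radius of the perturbation of the segment from A to NN *)
pose rho := Num.min (2 * (K + 1))^-1 (pi * eta / (C + 1)).
have rho0 : 0 < rho by rewrite lt_min invr_gt0 divr_gt0 ?ltr_wpDl // mulr_gt0 // ltr_wpDl.
have rhoK : 2 * K * rho <= 1.
  apply: (@le_trans _ _ (2 * K * (2 * (K + 1))^-1)).
    by apply: ler_wpM2l; [rewrite mulr_ge0|rewrite /rho ge_min lexx].
  by rewrite ler_pdivrMr ?mulr_gt0 ?ltr_wpDl // mul1r ler_wpM2l // lerDl.
have rhoC : rho * C <= pi * eta.
  apply: (@le_trans _ _ (pi * eta / (C + 1) * (C + 1))); last by rewrite divfK // gt_eqF // ltr_wpDl.
  by apply: ler_pM; rewrite ?(ltW rho0) ?lerDl // /rho ge_min lexx orbT.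
have rho2 : 0 < rho / 2 by rewrite divr_gt0.
have [d1 d10 lim1] := logint_limit M_vN tauP sah hM sah1 h1M eta'.
have [d2 d20 lim2] := limL rho2.
pose e := Num.min d1 d2 / 2.
have e0 : 0 < e by rewrite divr_gt0 // lt_min d10.
have [ed1 ed2] : e < d1 /\ e < d2.
  have : e < Num.min d1 d2 by rewrite /e ltr_pdivrMr // ltr_pMr ?lt_min ?d10 // ltr1n.
  by rewrite lt_min => /andP[].
have en : e != 0 by rewrite gt_eqF.
pose NE := n - k * res h e * adj k.
have NEM : inM NE.
  by apply: (inMB M_vN) => //; do 2 apply: (inMM M_vN) => //; exact: resM.
have {}lim2 : on (NE - NN) <= rho / 2.
  by rewrite /NE /NN opprD addrACA subrr add0r opprK addrC onBC; exact: lim2.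
have {}lim1 := lim1 e e0 ed1.
have seg1h t : seg (sh h e) (sh h e - adj k * binv n * k) t = sh (seg h h1 t) e.
  by rewrite -seg_sh; congr seg; rewrite /h1 /sh addrAC.
have dis0 a : adj a = a -> dissip e (sh a e).
  by move=> sa; rewrite -[X in dissip X]add0r; apply/sh_dissip/sa_dissip.
have uh t : 0 <= t <= 1 -> unitb (seg (sh h e) (sh h e - adj k * binv n * k) t) /\
    on (binv (seg (sh h e) (sh h e - adj k * binv n * k) t)) <= e^-1.
  move=> ht; rewrite seg1h -seg_sh; apply: dissip_unit => //.
  by apply: dissip_seg => //; exact: dis0.
(* from here on e is fixed and the base segment is that from n to NE *)
have push : logi (sh h e) (sh h1 e) = logi n NE.
  have -> : sh h1 e = sh h e - adj k * binv n * k by rewrite /h1 /sh addrAC.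
  apply: (logint_push M_vN iT) => //; [exact: inM_sh|exact: sh_unit|].
  by move=> t /uh[].
pose c := on (binv n) + on (binv n) * on k * e^-1 * on k * on (binv n).
have ie0 : 0 <= e^-1 by rewrite invr_ge0 ltW.
have c0 : 0 <= c by rewrite addr_ge0 ?mulr_ge0 ?on_ge0.
have hc t : 0 <= t <= 1 -> unitb (seg n NE t) /\ on (binv (seg n NE t)) <= c.
  move=> ht; have [t0 t1] := andP ht; have [u1 b1] := uh t ht.
  have e1 : seg (sh h e) (sh h e - adj k * binv n * k) t = sh h e - adj k * binv n * (t%:C *: k).
    by rewrite seg_subr bscaleAr.
  have e2 : seg n NE t = n - (t%:C *: k) * binv (sh h e) * adj k.
    by rewrite /NE seg_subr !bscaleAl.
  rewrite e1 in u1 b1; have [u2 ie _] := push_through (sh_unit sah en) un u1.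
  rewrite e2; split=> //; rewrite ie; apply: le_trans (onD _ _) _; rewrite lerD2l.
  have tk : on (t%:C *: k) <= on k.
    by apply: le_trans (onZr _ _) _; rewrite ger0_norm // ler_piMl ?on_ge0.
  do 4 (apply: le_trans (onM _ _) _; apply: ler_pM; rewrite ?on_ge0 ?on_adj //).
pose C' := 4 * c + 2 * c ^+ 2 * on (NE - n).
have C'0 : 0 <= C' by rewrite addr_ge0 // !mulr_ge0 ?on_ge0.
have [d3 d30 lim3] := logint_limit M_vN tauP san nM saA AM eta'.
(* four conditions: the limit at n and A, and the two perturbations *)
pose dd := Num.min (Num.min (d3 / 2) (rho / 2)) (Num.min (2 * (c + 1))^-1 (pi * eta / (C' + 1))).
have dd0 : 0 < dd.
  by rewrite !lt_min !divr_gt0 //= ?invr_gt0 ?mulr_gt0 ?ltr_wpDl.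
have [q1 q2 q3 q4] : [/\ dd <= d3 / 2, dd <= rho / 2, dd <= (2 * (c + 1))^-1 & dd <= pi * eta / (C' + 1)].
  by rewrite /dd !ge_min !lexx !orbT.
have {lim3}l3 : `|logi (sh n dd) (sh A dd) - pi * (s (Xib A) - s (Xib n))| <= pi * eta.
  by apply: lim3 => //; lra.
have cK : 2 * c * dd <= 1.
  apply: (@le_trans _ _ (2 * c * (2 * (c + 1))^-1)); first by rewrite ler_wpM2l // mulr_ge0.
  by rewrite ler_pdivrMr ?mulr_gt0 ?ltr_wpDl // mul1r ler_wpM2l // lerDl.
have shd a : on (sh a dd - a) <= dd by apply: on_sh; exact: ltW.
have [_ l4] := logint_perturb M_vN iT nM NEM c0 hc (inM_sh dd nM) (inM_sh dd NEM) cK (shd n) (shd NE).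
have {}l4 : `|logi (sh n dd) (sh NE dd) - logi n NE| <= pi * eta.
  apply: le_trans l4 _; apply: (@le_trans _ _ (pi * eta / (C' + 1) * (C' + 1))).
    by apply: ler_pM => //; [exact: ltW|rewrite lerDl].
  by rewrite divfK // gt_eqF // ltr_wpDl.
have b1 : on (sh A dd - A) <= rho by apply: le_trans (shd A) _; lra.
have b2 : on (sh NE dd - NN) <= rho.
  have -> : sh NE dd - NN = (sh NE dd - NE) + (NE - NN) by rewrite addrA subrK.
  by apply: le_trans (onD _ _) _; have := shd NE; lra.
have [_ l5] := logint_perturb M_vN iT AM NNM K0 hKA (inM_sh dd AM) (inM_sh dd NEM) rhoK b1 b2.
have {}l5 : `|logi (sh A dd) (sh NE dd)| <= pi * eta.
  by move: l5; rewrite log0 subr0 => l5; exact: le_trans l5 rhoC.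
have dd_sh a : dissip 0 a -> dissip dd (sh a dd).
  by move=> da; rewrite -[X in dissip X]add0r; exact: sh_dissip.
have disNE : dissip 0 NE.
  move=> x; rewrite mul0r -im_part_rip /NE im_partD im_partN (im_part_sa0 san) add0r (im_res sah k en) opprK.
  have : pos (e%:C *: (k * rsq h e * adj k)).
    by apply: posZ; [exact: ltW|rewrite -{1}(adjK k); apply: pos_conj; exact: rsq_pos].
  by case.
have tri := dissip_triangle M_vN iT dd0 (inM_sh dd nM) (inM_sh dd AM) (inM_sh dd NEM)
  (dd_sh _ (sa_dissip san)) (dd_sh _ (sa_dissip saA)) (dd_sh _ disNE).
rewrite push in lim1; rewrite tri in l4.
have fin : `|pi * X| <= 4 * (pi * eta).
  rewrite /X; exact: four_dist lim1 l3 l4 l5.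
rewrite normrM (gtr0_norm pi0) mulrCA ler_pM2l // in fin.
by rewrite mulrC.
Qed.

End Index.

(** * Paths of operators and their determinants *)

Section PathTranslation.
Context {R : realType} {HH : hilbertType R}.
Implicit Types (x y : HH) (a b c : bop HH) (s t e d : R) (G : R -> HH -> HH).
Variables (M : set (HH -> HH)) (M_vN : von_neumann_algebra M).
Local Notation inM := (inM M).
Local Notation I01 x := (0 <= (x : R) <= 1).

(** Paths and homotopies consist of bare functions; the default value makes
    the passage to bounded operators total. *)
Definition tob (A : HH -> HH) : bop HH :=
  if pselect (bounded_operator A) is left bA then Bop bA else 0.

Lemma tobE (A : HH -> HH) : bounded_operator A -> tob A = A :> (HH -> HH).
Proof. by rewrite /tob; case: pselect. Qed.

Lemma tob_bop a : tob a = a.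
Proof. by apply: bop_inj; rewrite tobE //; exact: bopP. Qed.

Lemma in_algE a : inM a = M a. Proof. by []. Qed.

Lemma mem01 t : (t \in `[0, 1]) = I01 t. Proof. by rewrite in_itv. Qed.

Lemma punctured01 t d : I01 t -> 0 < d -> exists m, [/\ I01 m, m != t & `|m - t| < d].
Proof.
move=> /andP[t0 t1] d0; pose r := Num.min (d / 2) (1 / 2).
have r0 : 0 < r by rewrite lt_min !divr_gt0.
have [rd r1] : r <= d / 2 /\ r <= 1 / 2 by rewrite /r !ge_min !lexx orbT.
have [th|th] := lerP t (1 / 2).
  exists (t + r); split; [apply/andP; split; lra|by rewrite -subr_eq0 addrAC subrr add0r gt_eqF|].
  by rewrite addrAC subrr add0r gtr0_norm //; lra.
exists (t - r); split; [apply/andP; split; lra|by rewrite -subr_eq0 addrAC subrr add0r oppr_eq0 gt_eqF|].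
by rewrite addrAC subrr add0r normrN gtr0_norm //; lra.
Qed.

Definition derivable_at (g : R -> bop HH) t D := forall e, 0 < e ->
  exists2 d, 0 < d & forall m, I01 m -> `|m - t| < d ->
    on (g m - g t - (m - t)%:C *: D) <= e * `|m - t|.

Lemma path_derivativeP G t (D : HH -> HH) : (forall m, I01 m -> bounded_operator (G m)) -> I01 t ->
  bounded_operator D ->
  is_path_derivative G t D <-> derivable_at (tob \o G) t (tob D).
Proof.
move=> bG ht bD.
have E m : I01 m -> ((m - t)^-1)%:C *: (G m - G t) - D =
    (((m - t)^-1)%:C *: (tob (G m) - tob (G t)) - tob D : bop HH) :> (HH -> HH).
  by move=> hm; apply/funext => x; rewrite bBE bZE bBE !tobE //; exact: bG.
have key m : m != t -> I01 m ->
    on (tob (G m) - tob (G t) - (m - t)%:C *: tob D) =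
    `|m - t| * on (((m - t)^-1)%:C *: (tob (G m) - tob (G t)) - tob D).
  move=> mt hm; have mt0 : m - t != 0 by rewrite subr_eq0.
  have -> : tob (G m) - tob (G t) - (m - t)%:C *: tob D =
     (m - t)%:C *: (((m - t)^-1)%:C *: (tob (G m) - tob (G t)) - tob D).
    by rewrite scalerBr scalerA -rmorphM divff // scale1r.
  apply/eqP; rewrite eq_le onZr /=.
  set X := _ - tob D.
  have := onZr (m - t)^-1 ((m - t)%:C *: X).
  rewrite scalerA -rmorphM mulVf // scale1r normfV ler_pdivlMl ?normr_gt0 //.
split=> [[_ cv] e e0|h].
  have /cvgrPdist_le/(_ _ e0) := cv.
  rewrite /prop_near1 /within /= => -[d /= d0 hd]; exists d => // m hm mt.
  have [->|ne] := eqVneq m t.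
    by rewrite !subrr scale0r subr0 on0 normr0 mulr0.
  rewrite /= key // mulrC ler_wpM2r //.
  have := hd m; rewrite /= distrC => /(_ mt ne).
  rewrite in_itv /= => /(_ hm); rewrite sub0r normrN E // ger0_norm //; exact: on_ge0.
split=> //; apply/cvgrPdist_le => e e0; have [d d0 hd] := h e e0.
rewrite /prop_near1 /within /=; exists d => // m /= mt ne; rewrite in_itv /= => hm.
rewrite sub0r normrN E // ger0_norm; last exact: on_ge0.
rewrite distrC in mt; have := hd m hm mt; rewrite /= key // mulrC ler_pM2r // normr_gt0 subr_eq0 //.
Qed.

Lemma derivable_at_unique g t D D' : I01 t -> derivable_at g t D -> derivable_at g t D' -> D = D'.
Proof.
move=> ht h h'; apply/eqP; rewrite -subr_eq0; apply/eqP/on_eq0/ler_addgt0Pr => e e0.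
rewrite add0r; have e2 : 0 < e / 2 by rewrite divr_gt0.
have [d d0 hd] := h _ e2; have [d' d0' hd'] := h' _ e2.
have [m [hm mt]] := punctured01 ht (ltac:(by rewrite lt_min d0; exact: d0') : 0 < Num.min d d').
rewrite lt_min => /andP[/(hd _ hm) {}hd /(hd' _ hm) {}hd'].
have mp : 0 < `|m - t| by rewrite normr_gt0 subr_eq0.
rewrite -(ler_pM2l mp).
have -> : `|m - t| * on (D - D') = on ((m - t)%:C *: (D - D')).
  apply/eqP; rewrite eq_le onZr andbT.
  have := onZr (m - t)^-1 ((m - t)%:C *: (D - D')).
  by rewrite scalerA -rmorphM mulVf ?subr_eq0 // scale1r normfV ler_pdivlMl.
have -> : (m - t)%:C *: (D - D') = (g m - g t - (m - t)%:C *: D') - (g m - g t - (m - t)%:C *: D).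
  rewrite scalerBr; ncring_in (bop HH).
apply: le_trans (onB _ _) _; lra.
Qed.

Lemma inM_derivative g t D : I01 t -> (forall m, I01 m -> inM (g m)) -> derivable_at g t D -> inM D.
Proof.
move=> ht hg h; apply: (inM_lim M_vN) => e e0; have [d d0 hd] := h _ e0.
have [m [hm mt /(hd _ hm) {}hd]] := punctured01 ht d0.
have mt0 : m - t != 0 by rewrite subr_eq0.
exists (((m - t)^-1)%:C *: (g m - g t)).
  by apply: inMZ => //; apply: (inMB M_vN); exact: hg.
have -> : ((m - t)^-1)%:C *: (g m - g t) - D = ((m - t)^-1)%:C *: (g m - g t - (m - t)%:C *: D).
  by rewrite [RHS]scalerBr scalerA -rmorphM mulVf // scale1r.
by apply: le_trans (onZr _ _) _; rewrite normfV ler_pdivrMl ?normr_gt0 // mulrC.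
Qed.

(** The derivative of a path in [M] is in [M], which is closed in norm. *)
Lemma C1_pathE G : C1_path M G -> let g := tob \o G in let D := tob \o path_derive G in
  [/\ forall t, I01 t -> unitb (g t) /\ inM (g t),
      forall t, I01 t -> inM (D t), derb 0 1 g D & contb 0 1 D].
Proof.
move=> C g D.
have bG t : I01 t -> bounded_operator (G t).
  by rewrite -mem01 => /C[[/(M_bounded M_vN)]].
have gE t : I01 t -> g t = G t :> (HH -> HH) by move=> /bG; exact: tobE.
have ug t : I01 t -> unitb (g t) /\ inM (g t).
  move=> ht; have := ht; rewrite -mem01 => /C[[MG iG] _ _].
  by rewrite in_algE gE //; split=> //; apply/has_bounded_inverseE; rewrite gE.
have bD t : I01 t -> is_path_derivative G t (path_derive G t).
  by rewrite -mem01 => /C[_ [D0 hD0] _]; rewrite /path_derive; case: xgetP => [D' _ //|/(_ D0) []].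
have der t : I01 t -> derivable_at g t (D t).
  by move=> ht; apply/path_derivativeP => //; [exact: (bD t ht).1|exact: bD].
split=> //.
- by move=> t ht; apply: inM_derivative (der t ht) => // m /ug[].
move=> t ht e e0; have := ht; rewrite -mem01 => /C[_ _ /cvgrPdist_le/(_ _ e0)].
rewrite /prop_near1 /within /= => -[d /= d0 hd]; exists d => // m hm mt.
have := hd m; rewrite /= distrC => /(_ mt); rewrite in_itv /= => /(_ hm).
rewrite sub0r normrN; apply: le_trans.
suff -> : path_derive G m - path_derive G t = (D m - D t : bop HH) :> (HH -> HH) by exact: ler_norm.
by apply/funext => x; rewrite bBE !tobE //; [exact: (bD t ht).1|exact: (bD m hm).1].
Qed.

(** Derivatives at points of the segment are unique, so [path_derive] is the
    constant [b]. *)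
Lemma affine_C1 G a b : (forall t, G t = (a + t%:C *: b : bop HH)) ->
  (forall t, I01 t -> unitb (a + t%:C *: b) /\ inM (a + t%:C *: b)) ->
  C1_path M G /\ forall t, I01 t -> path_derive G t = b.
Proof.
move=> GE uG.
have tG t : (tob \o G) t = a + t%:C *: b by rewrite /= GE tob_bop.
have bG m : I01 m -> bounded_operator (G m) by move=> _; rewrite GE; exact: bopP.
have der t : I01 t -> is_path_derivative G t b.
  move=> ht; apply/(path_derivativeP bG ht (bopP b)) => e e0; exists 1 => // m hm _.
  rewrite !tG tob_bop opprD addrACA subrr add0r -scalerBl -rmorphB subrr on0.
  by rewrite mulr_ge0 // ltW.
have pd t : I01 t -> path_derive G t = b.
  move=> ht; rewrite /path_derive; case: xgetP => [D _ hD|/(_ b)]; last by case; exact: der.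
  have := derivable_at_unique ht ((path_derivativeP bG ht hD.1).1 hD)
    ((path_derivativeP bG ht (bopP b)).1 (der t ht)).
  by rewrite tob_bop => <-; rewrite tobE //; exact: hD.1.
split=> // t; rewrite mem01 => ht; split.
- by rewrite GE /invertibles /=; have [u m] := uG t ht; split=> //; exact/(@has_bounded_inverseE _ _ (a + t%:C *: b)).
- by exists b; exact: der.
apply/cvgrPdist_le => e e0; rewrite /prop_near1 /within /=.
exists 1 => //= m _; rewrite in_itv /= => hm; rewrite sub0r normrN !pd //.
have -> : (b : HH -> HH) - (b : HH -> HH) = (b - b : bop HH).
  by apply/funext => x; rewrite bBE.
by rewrite subrr -/(on 0) on0 normr0 ltW.
Qed.

Variables (tau : (HH -> HH) -> R[i]) (tauP : normal_tracial_state M tau).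

Definition logder (sg : bop HH -> R) G :=
  intab 0 1 (fun t => sg (tob (path_derive G t) * binv (tob (G t)))).

Lemma dlHS_detE G : C1_path M G ->
  dlHS_det tau G = expC (logder (retau tau) G +i* logder (imtau tau) G).
Proof.
move=> C; have [ug MD _ _] := C1_pathE C.
have E t : I01 t -> tau (path_derive G t \o op_inv (G t)) =
    tau (tob (path_derive G t) * binv (tob (G t)) : bop HH).
  move=> ht; have [uG' MG'] := ug t ht.
  have ht' : t \in `[0, 1] by rewrite mem01.
  have [[MG _] _ _] := C t ht'; have bG := M_bounded M_vN MG.
  have bD : bounded_operator (path_derive G t).
    have [_ [D0 hD0] _] := C t ht'; rewrite /path_derive.
    by case: xgetP => [D' _ []//|/(_ D0) []].
  congr tau; apply/funext => x; rewrite bME /= tobE //; congr (path_derive G t _).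
  by rewrite -(op_invE uG') /= tobE.
rewrite /dlHS_det; congr expC; rewrite /Cintegral01 /logder; congr (_ +i* _).
  by apply: eq_Rintegral => t; rewrite inE /= in_itv /= => ht; rewrite E.
by apply: eq_Rintegral => t; rewrite inE /= in_itv /= => ht; rewrite E.
Qed.

Lemma homotopic_logder G P (sg : bop HH -> R) : tracial M sg -> C1_path M P -> C1_path M G ->
  homotopic M P G -> logder sg G = logder sg P.
Proof.
move=> sgT CP CG [F [hF hends hsides]]; symmetry.
have [uP MDP dP cP] := C1_pathE CP; have [uG MDG dG cG] := C1_pathE CG.
have sq s t : I01 s -> I01 t -> (`[0%R, 1%R] `*` `[0%R, 1%R])%classic (s, t).
  by move=> hs ht; split; rewrite /= in_itv.
have i0 : I01 0 by rewrite lexx ler01.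
have i1 : I01 1 by rewrite ler01 lexx.
pose f s t := tob (F (s, t)).
have FE s t : I01 s -> I01 t -> f s t = F (s, t) :> (HH -> HH).
  by move=> hs ht; apply: tobE; have [[MF _] _] := hF _ (sq _ _ hs ht); exact: (M_bounded M_vN).
apply: (@homotopy_invariance _ _ _ M_vN _ sgT f _ _ (tob \o P) (tob \o path_derive P)
  (tob \o G) (tob \o path_derive G) _ _ _ _ MDP MDG dP cP dG cG).
- move=> s t hs ht; have [[MF iF] _] := hF _ (sq _ _ hs ht).
  by rewrite in_algE FE //; split=> //; apply/has_bounded_inverseE; rewrite FE.
- move=> s t hs ht e e0; have [_ /cvgrPdist_le/(_ _ e0)] := hF _ (sq _ _ hs ht).
  rewrite /prop_near1 /within /= => /nbhs_ballP[d /= d0 hd]; exists d => // s' t' hs' ht' h1 h2.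
  have := hd (s', t') _ (sq _ _ hs' ht'); rewrite sub0r normrN => h.
  apply: le_trans (h _); last by split; rewrite /ball /= distrC.
  suff -> : F (s', t') - F (s, t) = (f s' t' - f s t : bop HH) :> (HH -> HH) by exact: ler_norm.
  by apply/funext => x; rewrite bBE !FE.
- by move=> t ht; rewrite /f /=; have [-> _] := hends t (ltac:(by rewrite mem01)).
- by move=> t ht; rewrite /f /=; have [_ ->] := hends t (ltac:(by rewrite mem01)).
- move=> s hs; rewrite /f; have [-> _] := hsides s (ltac:(by rewrite mem01)).
  by have [-> _] := hsides 0 (ltac:(by rewrite mem01)).
- move=> s hs; rewrite /f; have [_ ->] := hsides s (ltac:(by rewrite mem01)).
  by have [_ ->] := hsides 0 (ltac:(by rewrite mem01)).
Qed.

End PathTranslation.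

(** * The characteristic function and the determinant *)

Section SquareRoot.
Context {R : realType} {HH : hilbertType R}.
Implicit Types (x y : HH) (a b c j : bop HH).

(** A self-adjoint [b] that commutes with the square of a positive [j] commutes
    with [j]: the commutator [c = j b - b j] is skew and anticommutes with [j],
    so that [c^* j c] is at the same time positive and negative. *)
Lemma sqrt_commute j b : pos j -> adj b = b -> b * (j * j) = (j * j) * b -> b * j = j * b.
Proof.
move=> pj sb bj; have sj := pos_sa pj.
have [c cE] : exists c, c = j * b - b * j by exists (j * b - b * j).
have adjc : adj c = - c by rewrite cE adjB !adjM sj sb opprB.
have anti : j * c = - (c * j).
  apply/eqP; rewrite -addr_eq0; apply/eqP; rewrite cE.
  transitivity (j * j * b - b * (j * j)); first by ncring_in (bop HH).
  by rewrite bj subrr.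
have jcc : j * (c * c) = c * c * j by rewrite mulrA anti mulNr -[c * j * c]mulrA anti mulrN opprK mulrA.
have cc : adj c * c = - (c * c) by rewrite adjc mulNr.
have p1 : pos (j * (adj c * c)).
  by apply: pos_mul => //; [exact: pos_adjM|rewrite cc mulrN mulNr jcc].
have p2 : pos (adj c * j * c) by exact: pos_conj.
have e : j * (adj c * c) = - (adj c * j * c).
  by rewrite cc adjc !mulNr opprK mulrN [j * (c * c)]mulrA anti mulNr opprK.
have jc0 : j * c = 0.
  apply: bop_ext => x; rewrite bME b0E; apply: (pos_ker pj).
  have [_ /(_ x)] := p1; rewrite e bNE ripNl oppr_ge0 !bME adj_rip; exact.
have cj0 : c * j = 0 by apply/eqP; rewrite -oppr_eq0 -anti jc0.
have c3 : c * c * c = 0.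
  have -> : c * c = - (c * b * j) by rewrite {2}cE mulrBr mulrA cj0 mul0r sub0r mulrA.
  by rewrite mulNr -[c * b * j * c]mulrA jc0 mulr0 oppr0.
have cc0 : adj c * c = 0.
  apply: bop_ext => x; rewrite b0E; apply: nr_eq0; apply/eqP; rewrite -sqrf_eq0 -rip_nr.
  have sa : adj (adj c * c) = adj c * c by rewrite adjM adjK.
  by rewrite -{1}sa adj_rip ripC -bME cc mulrN mulNr opprK mulrA c3 mul0r b0E rip0l.
suff : c = 0 by move/eqP; rewrite cE subr_eq0 => /eqP.
apply: bop_ext => x; rewrite b0E; apply: nr_eq0; apply/eqP.
by rewrite -sqrf_eq0 -rip_nr -adj_rip -bME cc0 b0E rip0l.
Qed.

Variables (M : set (HH -> HH)) (M_vN : von_neumann_algebra M).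

Lemma sqrt_inM j : pos j -> inM M (j * j) -> inM M j.
Proof.
move=> pj jjM; apply/(inM_commP M_vN) => b hb.
have hb' : inM' M (adj b).
  move=> c hc; have := hb _ (inM_adj M_vN hc) => /(congr1 (@adj _ _)).
  by rewrite !adjM adjK => <-.
have key d : adj d = d -> inM' M d -> j * d = d * j.
  by move=> sd hd; rewrite (sqrt_commute pj sd) //; exact: hd.
have r1 : inM' M (re_part b).
  by move=> c hc; rewrite /re_part bscaleAl bscaleAr mulrDl mulrDr hb // hb'.
have r2 : inM' M (im_part b).
  by move=> c hc; rewrite /im_part !bscaleAl !bscaleAr mulrBl mulrBr hb // hb'.
have k1 := key _ (re_part_sa b) r1; have k2 := key _ (im_part_sa b) r2.
move: k1 k2 (re_imE b); move: (re_part b) (im_part b) => r i k1 k2 ->.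
by rewrite mulrDl mulrDr bscaleAl bscaleAr k1 k2.
Qed.

(** The two cases are those of the choice operator.  In the second one the
    segment path below is constant. *)
Lemma op_sqrtP b : inM M b -> exists j, [/\ op_sqrt b = j :> (HH -> HH), inM M j, adj j = j &
  j * j = b \/ j = 0].
Proof.
move=> hb; rewrite /op_sqrt; case: xgetP => [J _ [bJ pJ JJ]|_].
  have pj : pos (Bop bJ) by exact: (@op_ge0_pos _ _ (Bop bJ)).
  have jj : Bop bJ * Bop bJ = b by apply: bop_inj; rewrite -JJ.
  exists (Bop bJ); split=> //; [|exact: pos_sa|by left].
  by apply: sqrt_inM => //; rewrite jj.
by exists 0; split=> //; [exact: inM0|exact: adj0|right].
Qed.

End SquareRoot.

Section ExpC.
Context {R : realType}.

Lemma expC0 : expC (0 : R[i]) = 1.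
Proof. by rewrite /expC /= expR0 cos0 sin0 mul1r. Qed.

Lemma expC_imN (x : R) : expC (0 +i* x) * expC (0 +i* (- x)) = 1.
Proof.
rewrite /expC /= expR0 !mul1r cosN sinN; apply/eqP; rewrite eq_complex /=.
by rewrite mulrN opprK -!expr2 cos2Dsin2 eqxx /= mulrN mulrC addNr.
Qed.

End ExpC.

Section Segment.
Context {R : realType} {HH : hilbertType R}.
Implicit Types (x y : HH) (a b c j : bop HH).
Variables (M : set (HH -> HH)) (M_vN : von_neumann_algebra M).
Local Notation inM := (inM M).
Variables (nn j b a : bop HH).
Hypotheses (nnM : inM nn) (jM : inM j) (pb : pos b) (jj : j * j = b \/ j = 0).
Hypotheses (saa : adj a = a) (ua : unitb a) (nnE : nn = a + ib * b) (unn : unitb nn).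

Definition char_op : bop HH := - ((2 * 'i : R[i]) *: (j * binv nn * j)).

(** Woodbury's formula with [- 2 i t j] on the left and [j] on the right; the
    complementary operator is [nn - 2 i t j^2]. *)
Lemma segment_unit (t : R) : 0 <= t <= 1 ->
  let u := nn - j * binv 1 * ((t%:C * (2 * 'i)) *: j) in
  [/\ unitb (1 + t%:C *: char_op), inM (1 + t%:C *: char_op), inM (binv u) &
   char_op * binv (1 + t%:C *: char_op) = - ((2 * 'i : R[i]) *: (j * binv u * j))].
Proof.
move=> /andP[t0 t1] u; have u1 : unitb (1 : bop HH) by exists 1; split; rewrite mulr1.
have i1 : binv 1 = 1 :> bop HH by apply: binv_eq; split; rewrite mulr1.
have [K _ hK] := sa_im_unit saa ua pb.
have uu : unitb u.
  rewrite /u i1 mulr1 bscaleAr; case: jj => [->|->]; last by rewrite mulr0 scaler0 subr0.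
  have -> : nn - (t%:C * (2 * 'i)) *: b = a + (1 - 2 * t)%:C *: (ib * b).
    rewrite nnE -ibE rmorphB rmorphM rmorph1 rmorph_nat scalerBl scale1r -addrA; congr (_ + (_ - _)).
    by rewrite scalerA mulrCA mulrA.
  by case: (hK (1 - 2 * t) (ltac:(apply/andP; split; lra))).
have [w1 w2 w3] := push_through unn u1 uu.
have E : 1 + t%:C *: char_op = 1 - (t%:C * (2 * 'i)) *: j * binv nn * j.
  by rewrite /char_op scalerN scalerA !bscaleAl.
have M1 := inM1 M_vN; have inn := inM_inv M_vN unn nnM.
have jnj := inMM M_vN (inMM M_vN jM inn) jM.
rewrite E; split=> //.
- by rewrite !bscaleAl; apply: (inMB M_vN) => //; exact: inMZ.
- apply: inM_inv => //; apply: (inMB M_vN) => //.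
  by rewrite i1 mulr1; apply: (inMM M_vN) => //; exact: inMZ.
rewrite /char_op mulNr bscaleAl; congr (- (_ *: _)).
move: w3; set v := binv (1 - _) => w3.
have -> : j * binv nn * j * v = j * (binv nn * j * v) by rewrite !mulrA.
by rewrite w3 -/u; set w := binv u; rewrite i1 mulr1 mulrA.
Qed.

(** The logarithmic derivative of the segment path has trace zero: by
    cyclicity it is the trace of a multiple of [b] by an element of [M]. *)
Lemma segment_trace (sg : bop HH -> R) (t : R) : tracial M sg -> 0 <= t <= 1 ->
  (forall c, inM c -> sg (b * c) = 0) -> sg (char_op * binv (1 + t%:C *: char_op)) = 0.
Proof.
move=> sgT ht sgb; have [_ _ uM ->] := segment_unit ht; set v := binv _ in uM *.
have m1 : inM ((- (2 * 'i : R[i])) *: v) by exact: inMZ.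
have -> : - ((2 * 'i : R[i]) *: (j * v * j)) = j * ((- (2 * 'i : R[i])) *: v) * j.
  by rewrite bscaleAr bscaleAl scaleNr.
rewrite (sgC sgT) //; last exact: inMM.
rewrite mulrA; case: jj => [->|->]; first exact: sgb.
by rewrite !mul0r (sg0 M_vN sgT).
Qed.

End Segment.

Section Assembly.
Context {R : realType} {HH : hilbertType R}.
Variables (M : set (HH -> HH)) (M_vN : von_neumann_algebra M).
Variables (tau : (HH -> HH) -> R[i]) (tauP : normal_tracial_state M tau).
Implicit Types (a b : bop HH).

Lemma Xi_Xib a : adj a = a -> Xi a = Xib a :> (HH -> HH).
Proof.
by move=> sa; rewrite XiE // -half_C.
Qed.

Lemma xi_indexE a b : adj a = a -> adj b = b -> inM M a -> inM M b ->
  xi_index tau a b = (retau tau (Xib b) - retau tau (Xib a))%:C.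
Proof.
have real c : adj c = c -> inM M c -> tau (Xi c) = (retau tau (Xib c))%:C.
  move=> sc cM; rewrite Xi_Xib //; have XM := inM_Xib M_vN sc cM.
  have sX : adj (Xib c) = Xib c.
    by rewrite adjD adjZr (neg_proj_proj sc).1 (ker_proj_proj sc).1.
  have [] := tau_sa_bound M_vN tauP XM sX; rewrite /imtau /retau; case: (tau (Xib c)) => u v /= -> _.
  by [].
by move=> sa sb aM bM; rewrite /xi_index !real // rmorphB.
Qed.

End Assembly.

Theorem theorem4p3 (R : realType) (HH : hilbertType R) (M : set (HH -> HH))
    (tau : (HH -> HH) -> R[i]) (H0 V K N L : HH -> HH)
    (M_vN : von_neumann_algebra M) (M_finite : finite_type M)
    (tau_trace : normal_tracial_state M tau)
    (H0_in : M H0) (H0_sa : adjoint H0 = H0)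
    (V_in : M V) (V_sa : adjoint V = V)
    (K_in : M K)
    (N_in : M N) (N_sa : adjoint N = N) (N_inv : has_bounded_inverse N)
    (V_factor : V = - (adjoint K \o op_inv N \o K))
    (L_lim : norm_lim_0p
       (fun e : R => K \o op_inv (H0 + ('i * e%:C : R[i]) *: idfun) \o adjoint K)
       L) :
  let H := H0 + V in
  let NN := N - L in
  has_bounded_inverse NN ->
  has_bounded_inverse (op_re NN) ->
  let S := characteristic0 NN in
  let Theta := expC (- (2 * pi%:C * 'i * xi_index tau N (op_re NN))) in
  is_class_det M tau (segment_path S)
    (Theta * expC (- (2 * pi%:C * 'i * xi_index tau H H0))).
Proof.
have bM := M_bounded M_vN.
pose h := Bop (bM _ H0_in); pose k := Bop (bM _ K_in); pose n := Bop (bM _ N_in).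
have [bL limF] := L_lim; pose l := Bop bL.
have sah : adj h = h by apply: bop_inj; rewrite -adjointE.
have san : adj n = n by apply: bop_inj; rewrite -adjointE.
have un : unitb n by exact/(@has_bounded_inverseE _ _ n).
have hM : inM M h := H0_in; have kM : inM M k := K_in; have nM : inM M n := N_in.
have limL eta : 0 < eta -> exists2 d, 0 < d &
    forall e, 0 < e -> e < d -> on (k * res h e * adj k - l) <= eta.
  move=> eta0; have /cvgrPdist_le/(_ _ eta0) := limF.
  rewrite /prop_near1 /within /= => -[d /= d0 hd]; exists d => // e e0 ed.
  have := hd e; rewrite /= sub0r normrN gtr0_norm // => /(_ ed e0).
  rewrite sub0r normrN; apply: le_trans.
  suff -> : K \o op_inv (H0 + ('i * e%:C : R[i]) *: idfun) \o adjoint K - L =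
      (k * res h e * adj k - l : bop HH) :> (HH -> HH) by exact: ler_norm.
  have ue : unitb (sh h e) by apply: sh_unit => //; rewrite gt_eqF.
  have -> : H0 + ('i * e%:C : R[i]) *: idfun = sh h e :> (HH -> HH).
    by rewrite -shE; apply/funext => x; rewrite bDE bZE b1E.
  by apply/funext => x; rewrite bBE !bME op_invE // (adjointE k).
move=> H NN iNN iA S Theta.
have lM := boundary_inM M_vN hM sah kM limL.
pose nn : bop HH := n - l; pose a := re_part nn; pose b : bop HH := - im_part l.
have NNE : NN = nn by apply/funext => x; rewrite bBE.
have nnM : inM M nn by exact: inMB.
have unn : unitb nn by apply/has_bounded_inverseE; rewrite -NNE.
have AE : op_re NN = a by rewrite NNE op_reE.
have ua : unitb a by apply/has_bounded_inverseE; rewrite -AE.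
have saa : adj a = a := re_part_sa nn. have aM : inM M a by exact: inM_re_part.
have HE : H = h - adj k * binv n * k.
  apply/funext => x; rewrite bBE !bME -(adjointE k) -op_invE //.
  by rewrite /H V_factor.
have h1M : inM M (h - adj k * binv n * k).
  apply: (inMB M_vN) => //; apply: (inMM M_vN) => //; apply: (inMM M_vN); last exact: inM_inv.
  exact: inM_adj.
have sah1 : adj (h - adj k * binv n * k) = h - adj k * binv n * k.
  by rewrite adjB sah !adjM adjK (adj_binv un) san mulrA.
have -> : Theta * expC (- (2 * pi%:C * 'i * xi_index tau H H0)) = 1.
  have id := index_identity M_vN tau_trace hM sah kM nM san un limL ua.
  rewrite /Theta AE HE (xi_indexE M_vN tau_trace san saa nM aM) (xi_indexE M_vN tau_trace sah1 sah h1M hM).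
  set x := retau tau (Xib a) - _; set y := _ - retau tau (Xib (_ - _)).
  have yE : y = - x by rewrite /x -id /y opprB.
  have zE (r : R) : - (2 * pi%:C * 'i * r%:C) = 0 +i* (- (2 * pi * r)).
    by rewrite -complexiE; apply/eqP; rewrite eq_complex /=; apply/andP; split; apply/eqP; ring.
  by rewrite !zE yE mulrN expC_imN.
have [j [jE jM saj jj]] := op_sqrtP M_vN (inM_im_part M_vN nnM).
have imE : im_part nn = b by exact: im_boundary.
have b0 : retau tau b = 0 := im_limit_trace0 M_vN (retau_ptrace M_vN tau_trace) hM sah kM lM limL.
have pb : pos b := neg_im_limit_pos sah limL.
have nnE : nn = a + ib * b by rewrite [LHS]re_imE imE ibE.
rewrite imE in jj.
pose D := char_op nn j.
have GE t : segment_path S t = (1 + t%:C *: D : bop HH).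
  apply/funext => x.
  rewrite /segment_path /S /characteristic0 NNE op_imE jE (op_invE unn).
  transitivity (t%:C *: (x - (2 * 'i : R[i]) *: j (binv nn (j x))) + (1 - t)%:C *: x); first by [].
  rewrite bDE b1E bZE /D /char_op bNE bZE !bME scalerBr scalerN rmorphB rmorph1 scalerBl scale1r.
  by rewrite addrC addrA subrK.
have [CG dG] : C1_path M (segment_path S) /\ forall t, 0 <= t <= 1 -> path_derive (segment_path S) t = D.
  apply: affine_C1 => // t ht; have [u1 u2 _ _] := segment_unit M_vN nnM jM pb jj saa ua nnE unn ht.
  by [].
split=> // G CG' _ _ hom.
rewrite (dlHS_detE M_vN tau CG').
have zero sg : tracial M sg -> (forall c, inM M c -> sg (b * c) = 0) -> logder sg G = 0.
  move=> sgT sgb; rewrite (homotopic_logder M_vN sgT CG CG' hom) /logder.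
  rewrite (@intab_ext _ _ _ _ (fun=> 0)) ?intab_cst ?mul0r // => t ht.
  rewrite dG // GE !tob_bop; exact: (segment_trace M_vN nnM jM pb jj saa ua nnE unn sgT ht sgb).
have bM' : inM M b by rewrite -imE; exact: inM_im_part.
have rb c : inM M c -> retau tau (b * c) = 0.
  by move=> cM; exact: (trace0_mul M_vN (retau_ptrace M_vN tau_trace) bM' pb b0 cM).
rewrite !zero ?expC0 //.
- exact: imtau_tracial.
- move=> c cM; rewrite (imtau_re M_vN tau_trace); last exact: inMM.
  by rewrite -scaleNr -bscaleAr rb //; exact: inMZ.
- exact: retau_tracial.
Qed.
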